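(* The table reduction morphism $TR:\mathcal{E}\to\mathcal{X}$ from the Barratt-Eccles operad to the surjection operad preserves filtrations, i.e. $TR(F_n\mathcal{E})\subseteq F_n\mathcal{X}$ for all $n\ge1$. Moreover, the induced morphisms $F_nTR:F_n\mathcal{E}\to F_n\mathcal{X}$ are quasi-isomorphisms of differential graded operads.
   Context: $\mathbb{F}$ is a fixed commutative ground ring; operads are in dg-modules over $\mathbb{F}$, and the formulas concern arities $r,s\ge1$. Barratt-Eccles operad: $\mathcal{E}(r)_d$ is the $\mathbb{F}$-module generated by $(d+1)$-tuples $(w_0,\ldots,w_d)$ of elements of $\Sigma_r$, modulo the tuples with $w_i=w_{i+1}$ for some $i$; $\delta(w_0,\ldots,w_d)=\sum_{i}(-1)^i(w_0,\ldots,\widehat{w_i},\ldots,w_d)$; diagonal $\Sigma_r$-action. A permutation is written as its sequence of values. For $u\in\Sigma_r$, $v\in\Sigma_s$, $u\circ_k v\in\Sigma_{r+s-1}$ is obtained from $(u(1),\ldots,u(r))$ by replacing the entry $k$ by $(v(1)+k-1,\ldots,v(s)+k-1)$ and increasing by $s-1$ the entries $u(i)>k$. For $u\in\mathcal{E}(r)_d$, $v\in\mathcal{E}(s)_e$, $u\circ_k v=\sum\pm(u_{x_0}\circ_k v_{y_0},\ldots,u_{x_{d+e}}\circ_k v_{y_{d+e}})$ over lattice paths from $(0,0)$ to $(d,e)$ with unit steps increasing $x$ or $y$; the sign is the signature of the shuffle moving all $x$-steps before all $y$-steps. Surjection operad: $\mathcal{X}(r)_d$ is the $\mathbb{F}$-module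 generated by maps $u:\{1,\ldots,r+d\}\to\{1,\ldots,r\}$, written as sequences $(u(1),\ldots,u(r+d))$, where non-surjective maps and degenerate ones ($u(i)=u(i+1)$ for some $i$) are set to zero. $\Sigma_r$ acts by $\sigma\cdot u=(\sigma(u(1)),\ldots,\sigma(u(r+d)))$. The caesuras of $u$ are the $d$ elements $u(i)$ that are not the last occurrence of their value. The table arrangement of $u$ splits the sequence into $d+1$ consecutive lines, each line except the last ending with a caesura. Differential: $\delta(u)=\sum_i\pm(u(1),\ldots,\widehat{u(i)},\ldots,u(r+d))$; the caesuras get alternating signs $+,-,+,\ldots$ in order; the last occurrence of a value that occurs at least twice gets the sign opposite to that of the previous occurrence of this value; omission of a value that occurs only once gives $0$. Composition: let $u(i_1),\ldots,u(i_n)$ be the occurrences of $k$ in $u\in\mathcal{X}(r)_d$, $i_0=1$, $i_{n+1}=r+d$. For $v\in\mathcal{X}(s)_e$ and each choice $1=j_0\le j_1\le\cdots\le j_n=s+e$, form a composite surjection by replacing $u(i_m)$ by $(v(j_{m-1}),\ldots,v(j_m))$, increasing the terms of $v$ by $k-1$ and the terms $u(i)>k$ by $s-1$. Then $u\circ_k v$ is the sum of these, each with the Koszul sign of the permutation from $U_1\cdots U_{n+1}V_1\cdots V_n$ to $U_1V_1U_2\cdots V_nU_{n+1}$, where $U_m=(u(i_{m-1}),\ldots,u(i_m))$ and $V_m=(v(j_{m-1}),\ldots,v(j_m))$ have as degree the number of lines of the table arrangement of $u$ (resp. $v$) that they meet, minus $1$. Table reduction: $TR(w_0,\ldots,w_d)=\sum_{(r_0,\ldots,r_d)}w'$,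 over all $r_0,\ldots,r_d\ge1$ with $r_0+\cdots+r_d=r+d$, where $w'$ is the concatenation of lines of lengths $r_0,\ldots,r_d$, line $i$ consisting of the first $r_i$ terms of $(w_i(1),\ldots,w_i(r))$ which do not occur among the non-final entries of the preceding lines (the last entry of each preceding line is disregarded). Filtrations: $F_n\mathcal{E}(r)$ is spanned by the tuples $(w_0,\ldots,w_d)$ such that, for all $i<j$, the relative order of $i$ and $j$ in the sequences $w_0,\ldots,w_d$ changes at most $n-1$ times. $F_n\mathcal{X}(r)$ is spanned by the surjections $u$ such that, for all $i<j$, the subsequence of $u$ formed by the occurrences of $i$ and $j$ has at most $n$ variations (places where consecutive terms differ). These are suboperads. *)

(* Defs.v *)
From HB Require Import structures.
From mathcomp Require Import all_boot all_order all_algebra all_fingroup.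

Set Implicit Arguments.
Unset Strict Implicit.
Unset Printing Implicit Defensive.

Import GRing.Theory.
Local Open Scope ring_scope.

(* All values and positions are 0-based: permutations act on 'I_r and values
   range over 0, ..., r - 1, so that the substitution u o_k v shifts the values
   of v by k (and not by k - 1). *)

Section FreeModules.

Variable R : comPzRingType.

Definition free_mod (I : finType) : lmodType R := {ffun I -> R^o}.

Definition basis_elt (I : finType) (i : I) : free_mod I :=
  [ffun j => (j == i)%:R].

Definition spanned (I : finType) (A : pred I) (x : free_mod I) : Prop :=
  exists c : I -> R, x = \sum_(i | A i) c i *: basis_elt i.

Definition lin_ext (I : finType) (V : lmodType R) (f : I -> V)
  (x : free_mod I) : V := \sum_i (x i : R) *: f i.

Fact lin_ext_is_linear (I : finType) (V : lmodType R) (f : I -> V) :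
  linear (lin_ext f).
Proof.
move=> a x y; rewrite /lin_ext scaler_sumr -big_split /=.
by apply: eq_bigr => i _; rewrite !ffunE scalerDl scalerA.
Qed.

HB.instance Definition _ (I : finType) (V : lmodType R) (f : I -> V) :=
  GRing.isLinear.Build R (free_mod I) V *:%R (lin_ext f) (lin_ext_is_linear f).

End FreeModules.

(* The structure maps of a symmetric operad in (non-negatively graded, of
   degree -1 differential) dg-modules. Only arities r >= 1 are meaningful. *)
Record operad_data (R : comPzRingType) := OperadData {
  op_mod :> nat -> nat -> lmodType R;
  op_diff : forall r d, {linear op_mod r d.+1 -> op_mod r d};
  op_act : forall r d, 'S_r -> {linear op_mod r d -> op_mod r d};
  op_unit : op_mod 1 0;
  op_comp : forall r s d e, 'I_r ->
    op_mod r d -> op_mod s e -> op_mod (r + s).-1 (d + e)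
}.

Arguments op_diff {R P r d} : rename.
Arguments op_act {R P r d} : rename.
Arguments op_unit {R P} : rename.
Arguments op_comp {R P r s d e} : rename.

Section OperadTheory.

Variable R : comPzRingType.

Definition sub_data (P : operad_data R) := forall r d, P r d -> Prop.

Definition is_suboperad (P : operad_data R) (F : sub_data P) : Prop :=
  [/\ forall r d, (0 < r)%N ->
        F r d 0 /\ (forall a x y, F r d x -> F r d y -> F r d (a *: x + y)),
      forall r d x, (0 < r)%N -> F r d.+1 x -> F r d (op_diff x),
      forall r d sigma x, (0 < r)%N -> F r d x -> F r d (op_act sigma x),
      F 1 0 op_unit
    & forall r s d e (k : 'I_r) x y, (0 < s)%N -> F r d x -> F s e y ->
        F _ _ (op_comp k x y)].

(* The restriction of f to F is a morphism of dg-operads from F to G. *)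
Definition is_operad_morphism (P Q : operad_data R)
  (F : sub_data P) (G : sub_data Q)
  (f : forall r d, {linear P r d -> Q r d}) : Prop :=
  [/\ forall r d x, (0 < r)%N -> F r d x -> G r d (f r d x),
      forall r d x, (0 < r)%N -> F r d.+1 x ->
        f r d (op_diff x) = op_diff (f r d.+1 x),
      forall r d sigma x, (0 < r)%N -> F r d x ->
        f r d (op_act sigma x) = op_act sigma (f r d x),
      f 1 0 op_unit = op_unit
    & forall r s d e (k : 'I_r) x y, (0 < s)%N -> F r d x -> F s e y ->
        f _ _ (op_comp k x y) = op_comp k (f r d x) (f s e y)].

Definition is_cycle (P : operad_data R) (F : sub_data P) (r d : nat) :
  P r d -> Prop :=
  match d with
  | 0 => fun x => F r 0 x
  | d'.+1 => fun x => F r d'.+1 x /\ op_diff x = 0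
  end.

Definition homologous (P : operad_data R) (F : sub_data P) (r d : nat)
  (x y : P r d) : Prop := exists c : P r d.+1, F r d.+1 c /\ x - y = op_diff c.

(* Injectivity and surjectivity of the map induced by f between the quotients
   of the cycles of F and G by the relations [homologous]. *)
Definition homology_bijective (P Q : operad_data R)
  (F : sub_data P) (G : sub_data Q)
  (f : forall r d, {linear P r d -> Q r d}) (r d : nat) : Prop :=
  (forall x y, is_cycle F x -> is_cycle F y ->
     homologous G (f r d x) (f r d y) -> homologous F x y) /\
  (forall z, is_cycle G z -> exists2 x, is_cycle F x & homologous G (f r d x) z).

Definition is_operad_quasi_iso (P Q : operad_data R)
  (F : sub_data P) (G : sub_data Q)
  (f : forall r d, {linear P r d -> Q r d}) : Prop :=
  [/\ is_suboperad F, is_suboperad G, is_operad_morphism F G f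
    & forall r d, (0 < r)%N -> homology_bijective F G f r d].

End OperadTheory.

Section Words.

Definition nondegenerate (T : eqType) (s : seq T) : bool :=
  sorted [rel x y | x != y] s.

Definition variations (T : eqType) (s : seq T) : nat :=
  if s is x :: s' then count id (pairmap (fun a b => a != b) x s') else 0.

Definition delete (T : Type) (i : nat) (s : seq T) : seq T :=
  take i s ++ drop i.+1 s.

Definition segment (s : seq nat) (a b : nat) : seq nat :=
  [seq nth 0 s p | p <- index_iota a b.+1].

(* Replaces the successive occurrences of k in u by the successive words of vs,
   which have values in {0, ..., s - 1}. *)
Fixpoint substitute (s k : nat) (u : seq nat) (vs : seq (seq nat)) : seq nat :=
  if u is a :: u' then
    if a == k then [seq (b + k)%N | b <- head [::] vs]
                   ++ substitute s k u' (behead vs)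
    else (if k < a then a + s.-1 else a)%N :: substitute s k u' vs
  else [::].

(* Exponent of the Koszul sign of the rearrangement of the duplicate-free word
   w of graded letters into w'. *)
Definition koszul (T : eqType) (deg : T -> nat) (w w' : seq T) : nat :=
  \sum_(a <- w)
    \sum_(b <- w | (index a w < index b w)%N && (index b w' < index a w')%N)
      deg a * deg b.

End Words.

Section BarrattEccles.

Variable R : comPzRingType.

Definition perm_seq (r : nat) (w : 'S_r) : seq nat :=
  [seq val (w i) | i <- enum 'I_r].

Definition perm_comp (r s : nat) (k : 'I_r) (u : 'S_r) (v : 'S_s) :
  'S_(r + s).-1 :=
  odflt 1%g
    [pick w | perm_seq w == substitute s k (perm_seq u) [:: perm_seq v]].

Definition ebasis (r d : nat) : finType :=
  {t : d.+1.-tuple 'S_r | nondegenerate t}.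

Definition emod (r d : nat) : lmodType R := free_mod R (ebasis r d).

(* The class of the tuple t, which is 0 if t is degenerate. *)
Definition egen (r d : nat) (t : seq 'S_r) : emod r d :=
  [ffun b : ebasis r d => ((val (val b) : seq 'S_r) == t)%:R].

Definition ediff_gen (r d : nat) (t : ebasis r d.+1) : emod r d :=
  \sum_(i < d.+2) (-1) ^+ i *: egen d (delete i (val t)).

(* [(w * sigma)%g] is the composite of permutations sigma o w. *)
Definition eact_gen (r d : nat) (sigma : 'S_r) (t : ebasis r d) : emod r d :=
  egen d [seq (w * sigma)%g | w <- val t].

(* The lattice path p is the sequence of its steps, [true] for x-steps. *)
Definition path_x (p : seq bool) (i : nat) : nat := count id (take i p).
Definition path_y (p : seq bool) (i : nat) : nat := count negb (take i p).

Definition path_sign (p : seq bool) : nat :=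
  let steps := iota 0 (size p) in
  koszul (fun=> 1%N) steps
    ([seq i <- steps | nth false p i] ++ [seq i <- steps | ~~ nth false p i]).

Definition ecomp_gen (r s d e : nat) (k : 'I_r)
  (u : ebasis r d) (v : ebasis s e) : emod (r + s).-1 (d + e) :=
  \sum_(p : (d + e).-tuple bool | count id p == d)
    (-1) ^+ path_sign p *:
    egen (d + e)
      [seq perm_comp k (nth 1%g (val u) (path_x p i))
                       (nth 1%g (val v) (path_y p i)) | i <- iota 0 (d + e).+1].

Definition barratt_eccles : operad_data R := {|
  op_mod := emod;
  op_diff := fun r d => lin_ext (@ediff_gen r d);
  op_act := fun r d sigma => lin_ext (@eact_gen r d sigma);
  op_unit := egen 0 [:: 1%g : 'S_1];
  op_comp := fun r s d e k x y =>
    lin_ext (fun u => lin_ext (@ecomp_gen r s d e k u) y) x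
|}.

(* [(w^-1)%g i] is the position of the value i in the sequence of w. *)
Definition efilt_gen (n r d : nat) (t : ebasis r d) : bool :=
  [forall i : 'I_r, forall j : 'I_r, (i < j)%N ==>
     (variations [seq ((w^-1)%g i < (w^-1)%g j)%N | w : 'S_r <- val t]
        <= n.-1)%N].

Definition efilt (n : nat) : sub_data barratt_eccles :=
  fun r d => spanned (@efilt_gen n r d).

End BarrattEccles.

Section Surjections.

Variable R : comPzRingType.

Definition xbasis (r d : nat) : finType :=
  {u : (r + d).-tuple 'I_r | [forall a, a \in u] && nondegenerate u}.

Definition xmod (r d : nat) : lmodType R := free_mod R (xbasis r d).

Definition xseq (r d : nat) (u : xbasis r d) : seq nat :=
  [seq val a | a <- val (val u)].

(* The class of the word u, which is 0 if u is degenerate or not surjective. *)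
Definition xgen (r d : nat) (u : seq nat) : xmod r d :=
  [ffun b : xbasis r d => (xseq b == u)%:R].

Definition caesura (u : seq nat) (p : nat) : bool :=
  nth 0 u p \in drop p.+1 u.

(* The index of the line of the table arrangement which contains position p. *)
Definition line (u : seq nat) (p : nat) : nat :=
  count (caesura u) (iota 0 p).

Definition prev_occ (u : seq nat) (p : nat) : nat :=
  last 0 [seq q <- iota 0 p | nth 0 u q == nth 0 u p].

Definition xdiff_coef (u : seq nat) (p : nat) : R :=
  if caesura u p then (-1) ^+ line u p
  else if nth 0 u p \in take p u then - (-1) ^+ line u (prev_occ u p)
  else 0.

Definition xdiff_gen (r d : nat) (u : xbasis r d.+1) : xmod r d :=
  \sum_(p < r + d.+1) xdiff_coef (xseq u) p *: xgen r d (delete p (xseq u)).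

Definition xact_gen (r d : nat) (sigma : 'S_r) (u : xbasis r d) : xmod r d :=
  xgen r d [seq val (sigma a) | a <- val (val u)].

(* The number of lines met by the positions a, ..., b, minus 1. *)
Definition seg_deg (u : seq nat) (a b : nat) : nat :=
  (size (undup [seq line u p | p <- index_iota a b.+1])).-1.

Definition occurrences (k : nat) (u : seq nat) : seq nat :=
  [seq p <- iota 0 (size u) | nth 0 u p == k].

(* The letters (false, m) and (true, m) stand for the segments U_(m+1) and
   V_(m+1). *)
Definition xcomp_sign (k : nat) (u v js : seq nat) : nat :=
  let n := size (occurrences k u) in
  let ps := 0 :: rcons (occurrences k u) (size u).-1 in
  let deg (l : bool * nat) :=
    if l.1 then seg_deg v (nth 0 js l.2) (nth 0 js l.2.+1)
    else seg_deg u (nth 0 ps l.2) (nth 0 ps l.2.+1) in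
  koszul deg
    ([seq (false, m) | m <- iota 0 n.+1] ++ [seq (true, m) | m <- iota 0 n])
    (flatten [seq [:: (false, m); (true, m)] | m <- iota 0 n]
       ++ [:: (false, n)]).

Definition xcomp_word (s k : nat) (u v js : seq nat) : seq nat :=
  substitute s k u
    [seq segment v (nth 0 js m) (nth 0 js m.+1)
       | m <- iota 0 (size (occurrences k u))].

Definition xcomp_gen (r s d e : nat) (k : 'I_r)
  (u : xbasis r d) (v : xbasis s e) : xmod (r + s).-1 (d + e) :=
  \sum_(j : (size (occurrences k (xseq u))).+1.-tuple 'I_(s + e)
        | let js := [seq val a | a <- j] in
          [&& sorted leq js, head 0 js == 0 & last 0 js == (s + e).-1]%N)
    let js := [seq val a | a <- j] in
    (-1) ^+ xcomp_sign k (xseq u) (xseq v) js *: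
    xgen (r + s).-1 (d + e) (xcomp_word s k (xseq u) (xseq v) js).

Definition surjection_operad : operad_data R := {|
  op_mod := xmod;
  op_diff := fun r d => lin_ext (@xdiff_gen r d);
  op_act := fun r d sigma => lin_ext (@xact_gen r d sigma);
  op_unit := xgen 1 0 [:: 0%N];
  op_comp := fun r s d e k x y =>
    lin_ext (fun u => lin_ext (@xcomp_gen r s d e k u) y) x
|}.

Definition xfilt_gen (n r d : nat) (u : xbasis r d) : bool :=
  [forall i : 'I_r, forall j : 'I_r, (i < j)%N ==>
     (variations [seq a <- val (val u) | (a == i) || (a == j)] <= n)%N].

Definition xfilt (n : nat) : sub_data surjection_operad :=
  fun r d => spanned (@xfilt_gen n r d).

End Surjections.

Section TableReduction.

Variable R : comPzRingType.

(* The lines of lengths rs extracted from the words ws, concatenated; used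
   contains the non-final entries of the preceding lines. *)
Fixpoint tr_word (used : seq nat) (ws : seq (seq nat)) (rs : seq nat) :
  seq nat :=
  match ws, rs with
  | w :: ws', m :: rs' =>
      let l := take m [seq a <- w | a \notin used] in
      l ++ tr_word (used ++ take (size l).-1 l) ws' rs'
  | _, _ => [::]
  end.

Definition tr_gen (r d : nat) (t : ebasis r d) : surjection_operad R r d :=
  \sum_(rs : d.+1.-tuple 'I_(r + d).+1
        | all (fun m => 0 < val m)%N rs
          && (sumn [seq val m | m <- rs] == r + d)%N)
    xgen R r d (tr_word [::] [seq perm_seq w | w <- val t]
                             [seq val m | m <- rs]).

Definition TR (r d : nat) :
  {linear barratt_eccles R r d -> surjection_operad R r d} :=
  lin_ext (@tr_gen r d).

End TableReduction.

(* Main.v *)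
Require Import Defs.
From mathcomp Require Import all_boot all_order all_algebra all_fingroup.
From mathcomp Require Import zify.
Import Defs.

(** Both filtered operads are glued from the same contractible pieces, and the
    table reduction respects the pieces. An edge-labelled complete graph on
    0, ..., r - 1 is a pair k = (mu, sigma) of numbers mu i j for i < j and of a
    total order sigma; the pair (mu, sigma) lies below (nu, tau) when
    mu i j <= nu i j, strictly wherever sigma and tau order i and j differently.
    A tuple of permutations and a surjection both have such a model: the numbers
    count changes of order (plus one), respectively variations, and sigma is the
    first permutation, respectively the order of first occurrences. The basis
    elements with model below k span a subcomplex, the cell of k. It is
    contracted to sigma by prepending sigma to the tuples, and by the operator
    [cone] on surjections ([wdiff_cone]). The n-th stage of each filtration is
    spanned by the elements whose model has labels at most n, a condition closed
    under passing to smaller models. An acyclic carrier argument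
    ([carried_homology_bijective]) then shows that an augmentation-preserving
    chain map which sends each basis element into its own cell is an isomorphism
    in homology on every stage of the filtrations.

    The table reduction is such a map because its coefficients are explicit: the
    coefficient of a word z in TR (w_0, ..., w_d) is 1 or 0 according to the
    recursive criterion [compat], which reads z letter by letter, asks that no
    later letter come before the current one in the current permutation, and
    passes to the next permutation at each caesura ([TR_egen]). That TR preserves
    cells, hence filtrations, is [compat_variations]: each change of the leading
    letter among i and j is paid for by a change of order in the tuple. That TR
    commutes with the differentials ([TR_diff]) follows from a recursion on
    words, [sum_compat_wdiff], once the differential of surjections is itself
    written recursively ([wdiff]).

    For the composition, let z be a word without equal neighbours in the values
    of the composite. It is obtained by substitution in exactly one way: its
    maximal runs of values coming from the second operad element are the
    substituted words, and contracting them leaves a skeleton ([unsubst]). The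
    word occurs in the composite of two surjections only if its runs overlap in
    their end points, and then for one choice of cuts. It occurs in the table
    reduction of a composite of tuples along one lattice path only, whose step
    at a caesura of z is dictated by z: the second tuple moves inside a run, the
    first one elsewhere ([forced_path_unique]). The criterion [compat] along this
    path splits into the criteria for the skeleton and for the glued runs
    ([compat_path]), and both signs count the same pairs of caesuras
    ([forced_path_koszul]). The stability of the filtrations holds because faces,
    and restrictions of composites to two values, only delete and repeat letters
    ([thins]), which cannot increase a number of variations. *)

Set Implicit Arguments.
Unset Strict Implicit.
Unset Printing Implicit Defensive.

Import GRing.Theory.
Local Open Scope ring_scope.

(** * Free modules *)

Section FreeModuleTheory.

Variable R : comPzRingType.

Definition lin_closed (V : lmodType R) (S : V -> Prop) : Prop :=
  S 0 /\ forall a x y, S x -> S y -> S (a *: x + y).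

Lemma lin_closedZ (V : lmodType R) (S : V -> Prop) a x :
  lin_closed S -> S x -> S (a *: x).
Proof. by case=> S0 SP Sx; rewrite -[_ *: _]addr0; apply: SP. Qed.

Lemma lin_closedD (V : lmodType R) (S : V -> Prop) x y :
  lin_closed S -> S x -> S y -> S (x + y).
Proof. by case=> S0 SP Sx Sy; rewrite -[x]scale1r; apply: SP. Qed.

Lemma lin_closedB (V : lmodType R) (S : V -> Prop) x y :
  lin_closed S -> S x -> S y -> S (x - y).
Proof.
move=> SP Sx Sy; rewrite -scaleN1r; apply: lin_closedD => //.
exact: lin_closedZ.
Qed.

Lemma lin_closed_sum (V : lmodType R) (S : V -> Prop) (I : Type) (s : seq I)
  (P : pred I) (f : I -> V) :
  lin_closed S -> (forall i, P i -> S (f i)) -> S (\sum_(i <- s | P i) f i).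
Proof.
move=> SP Sf; elim/big_rec: _ => [|i x Pi Sx]; first by case: SP.
by apply: lin_closedD => //; apply: Sf.
Qed.

Variables I : finType.
Implicit Type x : free_mod R I.

Lemma basis_eltE (i j : I) : basis_elt R i j = (j == i)%:R.
Proof. by rewrite /basis_elt ffunE. Qed.

Lemma lin_ext_basis (V : lmodType R) (f : I -> V) i :
  lin_ext f (basis_elt R i) = f i.
Proof.
rewrite /lin_ext (bigD1 i) //= basis_eltE eqxx scale1r.
rewrite big1 ?addr0 // => j /negbTE ne_ji.
by rewrite basis_eltE ne_ji scale0r.
Qed.

Lemma coef0 i : (0 : free_mod R I) i = 0.
Proof. by rewrite ffunE. Qed.

Lemma coefD x y i : (x + y) i = x i + y i.
Proof. by rewrite ffunE. Qed.

Lemma coefN x i : (- x) i = - x i.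
Proof. by rewrite ffunE. Qed.

Lemma coefZ (a : R) x i : (a *: x) i = a * (x i : R).
Proof. by rewrite ffunE. Qed.

Lemma coef_sum (T : Type) (s : seq T) (P : pred T) (f : T -> free_mod R I) i :
  (\sum_(t <- s | P t) f t) i = \sum_(t <- s | P t) f t i.
Proof. by rewrite sum_ffunE. Qed.

Lemma free_mod_basis x : x = \sum_i (x i : R) *: basis_elt R i.
Proof.
apply/ffunP=> j; rewrite coef_sum (bigD1 j) //= coefZ basis_eltE eqxx mulr1.
rewrite big1 ?addr0 // => i /negbTE ne_ij.
by rewrite coefZ basis_eltE eq_sym ne_ij mulr0.
Qed.

Lemma linear_lin_ext (V : lmodType R) (g : {linear free_mod R I -> V}) x :
  g x = lin_ext (fun i => g (basis_elt R i)) x.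
Proof.
rewrite {1}[x]free_mod_basis linear_sum /lin_ext.
by apply: eq_bigr => i _; rewrite linearZ.
Qed.

Lemma eq_linear (V : lmodType R) (g h : {linear free_mod R I -> V}) :
  (forall i, g (basis_elt R i) = h (basis_elt R i)) -> g =1 h.
Proof.
move=> gh x; rewrite (linear_lin_ext g) (linear_lin_ext h) /lin_ext.
by apply: eq_bigr => i _; rewrite gh.
Qed.

(** Membership in a span of basis elements is a condition on coefficients,
    which avoids choosing the coefficients of a linear combination. *)
Lemma spannedP (A : pred I) x :
  spanned A x <-> forall i, ~~ A i -> x i = 0.
Proof.
split=> [[c ->] i nAi | x0].
  rewrite coef_sum big1 // => j Aj; rewrite coefZ basis_eltE.
  by case: eqP => [eij|_]; [rewrite eij Aj in nAi | rewrite mulr0].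
exists (fun i => x i : R); rewrite [LHS]free_mod_basis (bigID A) /=.
by rewrite [X in _ + X]big1 ?addr0 // => i nAi; rewrite x0 // scale0r.
Qed.

Lemma spanned_closed (A : pred I) : lin_closed (@spanned R I A).
Proof.
split=> [|a x y]; first by apply/spannedP=> i _; rewrite coef0.
move=> /spannedP x0 /spannedP y0; apply/spannedP=> i nAi.
by rewrite coefD coefZ x0 // y0 // mulr0 addr0.
Qed.

Lemma spanned_basis (A : pred I) i : A i -> spanned A (basis_elt R i).
Proof.
move=> Ai; apply/spannedP=> j nAj; rewrite basis_eltE.
by case: eqP nAj => // ->; rewrite Ai.
Qed.

Lemma spanned_lin_ext (V : lmodType R) (S : V -> Prop) (A : pred I)
  (f : I -> V) x :
  lin_closed S -> spanned A x -> (forall i, A i -> S (f i)) -> S (lin_ext f x).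
Proof.
move=> SP /spannedP x0 Sf; rewrite /lin_ext.
rewrite (bigID A) /= [X in _ + X]big1 ?addr0 => [|i nAi].
  by apply: lin_closed_sum => // i Ai; apply: lin_closedZ => //; apply: Sf.
by rewrite x0 // scale0r.
Qed.

Lemma spanned_linear (V : lmodType R) (S : V -> Prop) (A : pred I)
  (g : {linear free_mod R I -> V}) x :
  lin_closed S -> spanned A x -> (forall i, A i -> S (g (basis_elt R i))) ->
  S (g x).
Proof. by move=> SP Ax Sg; rewrite linear_lin_ext; apply: spanned_lin_ext Ax _. Qed.

Lemma spannedS (A B : pred I) x :
  subpred A B -> spanned A x -> spanned B x.
Proof.
move=> sAB /spannedP x0; apply/spannedP=> i nBi; apply: x0.
by apply: contra nBi; apply: sAB.
Qed.

End FreeModuleTheory.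

Lemma lin_extE (R : comPzRingType) (I J : finType) (f : I -> free_mod R J)
  (x : free_mod R I) (j : J) :
  lin_ext f x j = \sum_i (x i : R) * (f i j : R).
Proof. by rewrite /lin_ext coef_sum; apply: eq_bigr => i _; rewrite coefZ. Qed.

(** * Acyclic carriers *)

Section AcyclicCarriers.

Variables (R : comPzRingType) (K : Type) (le : rel K) (ok : pred K).
Hypothesis le_trans : transitive le.
Hypothesis le_refl : reflexive le.

(** The contraction cc_ct k onto the point cc_pt k is defined on the whole
    complex, so that it is a linear map of free modules; the cell of k is only
    required to be stable under it. The predicate ok excludes the indices
    whose cell is empty. *)
Record carried_complex := CarriedComplex {
  cc_ix : nat -> finType;
  cc_diff : forall d,
    {linear free_mod R (cc_ix d.+1) -> free_mod R (cc_ix d)};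
  cc_aug : {linear free_mod R (cc_ix 0) -> R^o};
  cc_model : forall d, cc_ix d -> K;
  cc_pt : K -> free_mod R (cc_ix 0);
  cc_ct : K -> forall d,
    {linear free_mod R (cc_ix d) -> free_mod R (cc_ix d.+1)};
  cc_cell := fun k d => @spanned R (cc_ix d) [pred b | le (cc_model b) k];
  cc_diff2 : forall d x, cc_diff d (cc_diff d.+1 x) = 0;
  cc_aug_diff : forall x, cc_aug (cc_diff 0 x) = 0;
  cc_aug_pt : forall k, cc_aug (cc_pt k) = 1;
  cc_ct0 : forall k x,
    cc_diff 0 (cc_ct k 0 x) = x - (cc_aug x : R) *: cc_pt k;
  cc_ctS : forall k d x,
    cc_diff d.+1 (cc_ct k d.+1 x) + cc_ct k d (cc_diff d x) = x;
  cc_model_ok : forall d (b : cc_ix d), ok (cc_model b);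
  cc_pt_cell : forall k, ok k -> cc_cell k (cc_pt k);
  cc_ct_cell : forall k d x, ok k -> cc_cell k x -> cc_cell k (cc_ct k d x);
  cc_diff_cell : forall d (b : cc_ix d.+1),
    cc_cell (cc_model b) (cc_diff d (basis_elt R b))
}.

Notation chains A d := (free_mod R (cc_ix A d)).

(** Carried maps preserve the subcomplexes spanned by any down-closed set of
    models, since the target of a basis element has smaller models only. *)
Definition carried (A B : carried_complex) (m d : nat)
  (g : chains A d -> chains B m) : Prop :=
  forall b : cc_ix A d, cc_cell (cc_model b) (g (basis_elt R b)).

Lemma cell_closed (A : carried_complex) k d : lin_closed (@cc_cell A k d).
Proof. exact: spanned_closed. Qed.

Lemma cell_trans (A : carried_complex) k k' d (x : chains A d) :
  le k k' -> cc_cell k x -> cc_cell k' x.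
Proof. by move=> kk'; apply: spannedS => b /= /le_trans; apply. Qed.

Lemma carried_cell (A B : carried_complex) d m
  (g : {linear chains A d -> chains B m}) k x :
  carried g -> cc_cell k x -> cc_cell k (g x).
Proof.
move=> cg cx; apply: spanned_linear cx _; first exact: cell_closed.
by move=> b kb; apply: cell_trans kb (cg b).
Qed.

Lemma carried_filt (A B : carried_complex) d m
  (g : {linear chains A d -> chains B m}) (Phi : pred K) x :
  (forall k k', le k k' -> Phi k' -> Phi k) -> carried g ->
  spanned [pred b | Phi (cc_model b)] x -> spanned [pred b | Phi (cc_model b)] (g x).
Proof.
move=> PhiP cg cx; apply: spanned_linear cx _; first exact: spanned_closed.
by move=> b kb; apply: spannedS (cg b) => c /= /PhiP; apply.
Qed.

Section CarriedMap.

Variables A B : carried_complex.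

Fixpoint carried_map d : {linear chains A d -> chains B d} :=
  match d with
  | 0 => lin_ext (fun b =>
           (cc_aug A (basis_elt R b) : R) *: cc_pt B (cc_model b))
  | d'.+1 => lin_ext (fun b =>
      cc_ct B (cc_model b) d' (carried_map d' (cc_diff A d' (basis_elt R b))))
  end.

(** The map is built by induction on the degree: it contracts the image of the
    boundary of a basis element inside the cell of that element, so that the
    result stays in this cell. *)
Lemma carried_mapP :
  [/\ forall d, carried (carried_map d),
      forall x, cc_aug B (carried_map 0 x) = cc_aug A x
    & forall d x, carried_map d (cc_diff A d x) =
                  cc_diff B d (carried_map d.+1 x)].
Proof.
have c0: carried (carried_map 0).
  move=> b; rewrite /= lin_ext_basis; apply: lin_closedZ; first exact: cell_closed.
  exact/cc_pt_cell/cc_model_ok.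
have cS d: carried (carried_map d) -> carried (carried_map d.+1).
  move=> cd b; rewrite /= lin_ext_basis; apply: cc_ct_cell (cc_model_ok b) _.
  exact/carried_cell/cc_diff_cell.
have a0 x: cc_aug B (carried_map 0 x) = cc_aug A x.
  rewrite [in RHS](linear_lin_ext (cc_aug A)) /= /lin_ext linear_sum.
  apply: eq_bigr => b _; rewrite linearZ linearZ /= cc_aug_pt.
  by congr (_ *: _); apply: mulr1.
split=> //; first by elim=> // d /cS.
elim=> [|d IHd]; move=> x.
  apply: (@eq_linear _ _ _ (carried_map 0 \o cc_diff A 0)
                           (cc_diff B 0 \o carried_map 1)) => b /=.
  rewrite [in RHS]lin_ext_basis cc_ct0 a0 cc_aug_diff scale0r subr0.
  by [].
apply: (@eq_linear _ _ _ (carried_map d.+1 \o cc_diff A d.+1)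
                         (cc_diff B d.+1 \o carried_map d.+2)) => b.
rewrite [LHS]/= [X in _ = cc_diff _ _ X]lin_ext_basis.
have := cc_ctS (cc_model b) (carried_map d.+1 (cc_diff A d.+1 (basis_elt R b))).
by rewrite -IHd cc_diff2 !linear0 addr0 => ->.
Qed.

Variables g g' : forall d, {linear chains A d -> chains B d}.
Hypothesis gP : forall d, carried (g d).
Hypothesis gP' : forall d, carried (g' d).
Hypothesis ga : forall x, cc_aug B (g 0 x) = cc_aug B (g' 0 x).
Hypothesis gd : forall d x, g d (cc_diff A d x) = cc_diff B d (g d.+1 x).
Hypothesis gd' : forall d x, g' d (cc_diff A d x) = cc_diff B d (g' d.+1 x).

Fixpoint carried_homotopy d : {linear chains A d -> chains B d.+1} :=
  match d with
  | 0 => lin_ext (fun b => let x := basis_elt R b in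
           cc_ct B (cc_model b) 0 (g 0 x - g' 0 x))
  | d'.+1 => lin_ext (fun b => let x := basis_elt R b in
      cc_ct B (cc_model b) d'.+1
        (g d'.+1 x - g' d'.+1 x - carried_homotopy d' (cc_diff A d' x)))
  end.

(** What the homotopy has to bound on a basis element is a cycle in the cell
    of that element; its contraction in the same cell is a bounding chain. *)
Lemma carried_homotopyP :
  [/\ forall d, carried (carried_homotopy d),
      forall x, cc_diff B 0 (carried_homotopy 0 x) = g 0 x - g' 0 x
    & forall d x, cc_diff B d.+1 (carried_homotopy d.+1 x) =
        g d.+1 x - g' d.+1 x - carried_homotopy d (cc_diff A d x)].
Proof.
have c0: carried (carried_homotopy 0).
  move=> b; rewrite /= lin_ext_basis; apply: cc_ct_cell (cc_model_ok b) _.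
  by apply: lin_closedB; [apply: cell_closed | apply: gP | apply: gP'].
have cS d: carried (carried_homotopy d) -> carried (carried_homotopy d.+1).
  move=> cd b; rewrite /= lin_ext_basis; apply: cc_ct_cell (cc_model_ok b) _.
  apply: lin_closedB; [exact: cell_closed | | exact/carried_cell/cc_diff_cell].
  by apply: lin_closedB; [apply: cell_closed | apply: gP | apply: gP'].
have d0 x: cc_diff B 0 (carried_homotopy 0 x) = g 0 x - g' 0 x.
  apply: (@eq_linear _ _ _ (cc_diff B 0 \o carried_homotopy 0)
                           (g 0 \- g' 0)) => b.
  by rewrite [LHS]/= lin_ext_basis cc_ct0 linearB ga subrr scale0r subr0.
split=> //; first by elim=> // d /cS.
elim=> [|d IHd] x.
  apply: (@eq_linear _ _ _ (cc_diff B 1 \o carried_homotopy 1)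
     ((g 1 \- g' 1) \- (carried_homotopy 0 \o cc_diff A 0))) => b.
  rewrite [LHS]/= lin_ext_basis.
  have := cc_ctS (cc_model b) (g 1 (basis_elt R b) - g' 1 (basis_elt R b) -
             carried_homotopy 0 (cc_diff A 0 (basis_elt R b))).
  rewrite [cc_diff B 0 _]linearB [cc_diff B 0 (_ - _)]linearB -gd -gd' d0.
  by rewrite subrr linear0 addr0 => ->.
apply: (@eq_linear _ _ _ (cc_diff B d.+2 \o carried_homotopy d.+2)
   ((g d.+2 \- g' d.+2) \- (carried_homotopy d.+1 \o cc_diff A d.+1))) => b.
rewrite [LHS]/= [X in cc_diff _ _ X]lin_ext_basis.
have := cc_ctS (cc_model b) (g d.+2 (basis_elt R b) - g' d.+2 (basis_elt R b) -
           carried_homotopy d.+1 (cc_diff A d.+1 (basis_elt R b))).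
rewrite [cc_diff B d.+1 _]linearB [cc_diff B d.+1 (_ - _)]linearB -gd -gd' IHd.
by rewrite cc_diff2 linear0 subr0 subrr linear0 addr0 => ->.
Qed.

End CarriedMap.

Lemma carried_comp (A B C : carried_complex) d m n
  (g : {linear chains A d -> chains B m})
  (h : {linear chains B m -> chains C n}) :
  carried g -> carried h -> carried (h \o g).
Proof. by move=> cg ch b; apply: carried_cell ch (cg b). Qed.

Lemma carried_id (A : carried_complex) d : carried (@idfun (chains A d)).
Proof. by move=> b; apply: spanned_basis => /=. Qed.

Definition cc_cycle (A : carried_complex) (Phi : pred K) d :
  chains A d -> Prop :=
  match d with
  | 0 => fun x => spanned [pred b | Phi (cc_model b)] x
  | d'.+1 => fun x => spanned [pred b | Phi (cc_model b)] x /\ cc_diff A d' x = 0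
  end.

Definition cc_homologous (A : carried_complex) (Phi : pred K) d
  (x y : chains A d) : Prop :=
  exists c : chains A d.+1,
    spanned [pred b | Phi (cc_model b)] c /\ x - y = cc_diff A d c.

(** In the opposite direction there is the carried map given by the
    contractions of A. The two composites and the identities are carried,
    hence related by carried homotopies, and all of these maps preserve the
    subcomplex spanned by the models in Phi. *)
Lemma carried_homology_bijective (A B : carried_complex) (Phi : pred K)
  (f : forall d, {linear chains A d -> chains B d}) :
  (forall k k', le k k' -> Phi k' -> Phi k) ->
  (forall d, carried (f d)) ->
  (forall x, cc_aug B (f 0 x) = cc_aug A x) ->
  (forall d x, f d (cc_diff A d x) = cc_diff B d (f d.+1 x)) ->
  forall d,
  (forall x y, cc_cycle Phi x -> cc_cycle Phi y ->
     cc_homologous Phi (f d x) (f d y) -> cc_homologous Phi x y) /\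
  (forall z, cc_cycle Phi z ->
     exists2 x, cc_cycle Phi x & cc_homologous Phi (f d x) z).
Proof.
move=> PhiP fc fa fd d.
have [gc ga gd] := carried_mapP B A; set g := carried_map B A in gc ga gd.
have SP (C : carried_complex) e := @spanned_closed R (cc_ix C e)
                                [pred b | Phi (cc_model b)].
have cyc (C : carried_complex) e (x : chains C e.+1) :
  cc_cycle Phi x -> cc_diff C e x = 0 by case.
have span (C : carried_complex) e (x : chains C e) :
  cc_cycle Phi x -> spanned [pred b | Phi (cc_model b)] x.
  by case: e x => // e x [].
split=> [x y cx cy [c [Sc fxy]]|z cz].
  have [] := @carried_homotopyP A A (fun e => g e \o f e) (fun e => idfun).
  - by move=> e; apply: carried_comp.
  - by move=> e; apply: carried_id.
  - by move=> u /=; rewrite ga fa.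
  - by move=> e u /=; rewrite fd gd.
  - by [].
  set H := carried_homotopy _ _ => Hc H0 HS.
  (* H corrects the difference between g (f (x - y)) and x - y. *)
  exists (g d.+1 c - H d (x - y)); split.
    apply: lin_closedB => //; first exact: carried_filt (gc _) Sc.
    apply: carried_filt (Hc _) _ => //.
    by apply: lin_closedB => //; apply: span.
  rewrite linearB -gd -fxy.
  case: d c Sc x y cx cy fxy => [|d] c Sc x y cx cy fxy.
    by rewrite H0 /= (linearB (f 0%N)) subKr.
  rewrite HS [cc_diff A d _]linearB (cyc _ _ _ cx) (cyc _ _ _ cy) subrr.
  by rewrite linear0 subr0 /= (linearB (f d.+1)) subKr.
have [] := @carried_homotopyP B B (fun e => f e \o g e) (fun e => idfun).
- by move=> e; apply: carried_comp.
- by move=> e; apply: carried_id.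
- by move=> u /=; rewrite fa ga.
- by move=> e u /=; rewrite gd fd.
- by [].
set H := carried_homotopy _ _ => Hc H0 HS.
exists (g d z).
  case: d z cz => [|d] z cz; first exact: carried_filt (gc _) cz.
  split; first exact: carried_filt (gc _) (span _ _ _ cz).
  by rewrite -gd (cyc _ _ _ cz) linear0.
exists (H d z); split; first exact: carried_filt (Hc _) (span _ _ _ cz).
case: d z cz => [|d] z cz; first by rewrite H0.
by rewrite HS (cyc _ _ _ cz) linear0 subr0.
Qed.

End AcyclicCarriers.

(** * Recursive differentials of words and tuples *)

Section WordDifferential.

(** The differential of a surjection, read from the left, with phi receiving
    the faces. A first letter a which occurs again is a caesura, so it changes
    the signs of all the later faces. The last correction concerns a single
    later occurrence of a: it is isolated in u', where its omission is counted
    as 0, but it is a last occurrence in a :: u', with the sign opposite to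
    that of the first letter. *)
Fixpoint wdiff (V : zmodType) (phi : seq nat -> V) (u : seq nat) : V :=
  if u is a :: u' then
    let psi := fun v => phi (a :: v) in
    if a \in u' then
      phi u' - wdiff psi u' - (if count_mem a u' == 1 then psi (rem a u') else 0)
    else wdiff psi u'
  else 0.

Variable V : zmodType.
Implicit Types (phi psi : seq nat -> V) (u v : seq nat).

Lemma wdiff_cons phi a u :
  wdiff phi (a :: u) =
    if a \in u then
      phi u - wdiff (fun v => phi (a :: v)) u -
        (if count_mem a u == 1 then phi (a :: rem a u) else 0)
    else wdiff (fun v => phi (a :: v)) u.
Proof. by []. Qed.

Lemma mem_rem_cons (a : nat) u : a \in u -> a :: rem a u =i u.
Proof. by move=> au b; rewrite -(perm_mem (perm_to_rem au)). Qed.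

(** All the faces of a word with nonzero coefficient keep all its values;
    properties of the faces pass to the differential. *)
Lemma wdiff_ind (S : V -> Prop) phi u :
  S 0 -> (forall x y, S x -> S y -> S (x - y)) ->
  (forall v, v =i u -> (size v).+1 = size u -> subseq v u -> S (phi v)) ->
  S (wdiff phi u).
Proof.
move=> S0 SB; elim: u phi => [//|a u IHu] phi Sphi; rewrite wdiff_cons.
have Scons: S (wdiff (fun v => phi (a :: v)) u).
  apply: IHu => v vu sv sub; apply: Sphi => /=; rewrite ?eqxx ?sv //.
  by move=> b; rewrite !inE vu.
case: ifP => // au; apply: (SB); first apply: (SB) => //.
  apply: Sphi => //; last exact: subseq_cons.
  by move=> b; rewrite inE; case: eqP => // ->.
case: ifP => // _; apply: Sphi => /=; last by rewrite eqxx rem_subseq.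
  by move=> b; rewrite mem_rem_cons // inE; case: eqP => // ->.
by rewrite size_rem //; case: (u) au.
Qed.

Lemma raddf_wdiff (W : zmodType) (L : {additive V -> W}) phi u :
  L (wdiff phi u) = wdiff (fun v => L (phi v)) u.
Proof.
elim: u phi => [|a u IHu] phi; first exact: raddf0.
have /= IHa := IHu (fun v => phi (a :: v)).
rewrite /= -IHa.
case: ifP => // _; rewrite !raddfB.
by case: ifP => // _; rewrite raddf0.
Qed.

Lemma subrACA (x y z t : V) : (x - y) - (z - t) = (x - z) - (y - t).
Proof. by rewrite !opprB addrACA [RHS]addrACA [- y - z]addrC. Qed.

Lemma wdiffB phi psi u :
  wdiff (fun v => phi v - psi v) u = wdiff phi u - wdiff psi u.
Proof.
elim: u phi psi => [|a u IHu] phi psi; first by rewrite subrr.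
rewrite !wdiff_cons IHu; case: ifP => // _; rewrite subrACA.
by case: ifP => _; [rewrite subrACA | rewrite !subr0].
Qed.

Lemma wdiffD phi psi u :
  wdiff (fun v => phi v + psi v) u = wdiff phi u + wdiff psi u.
Proof.
elim: u phi psi => [|a u IHu] phi psi; first by rewrite addr0.
rewrite !wdiff_cons IHu; case: ifP => // _; rewrite opprD addrACA.
case: ifP => _; last by rewrite !subr0.
by rewrite [- (_ + _)]opprD [LHS]addrACA.
Qed.

Lemma eq_wdiff phi psi u :
  (forall v, v =i u -> (size v).+1 = size u -> subseq v u -> phi v = psi v) ->
  wdiff phi u = wdiff psi u.
Proof.
move=> eq_phi; apply/eqP; rewrite -subr_eq0 -wdiffB; apply/eqP.
apply: (@wdiff_ind (fun x => x = 0)) => // [x y -> ->|v vu sv sub].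
  by rewrite subr0.
by rewrite eq_phi // subrr.
Qed.

Lemma wdiff_eq0 phi u :
  (forall v, v =i u -> (size v).+1 = size u -> subseq v u -> phi v = 0) ->
  wdiff phi u = 0.
Proof.
move=> phi0; apply: (@wdiff_ind (fun x => x = 0)) => // x y -> ->.
by rewrite subr0.
Qed.

Lemma mem_count c u : (c \in u) = (0 < count_mem c u)%N.
Proof. by rewrite -has_pred1 has_count. Qed.

Lemma rem_comm a c u : rem a (rem c u) = rem c (rem a u).
Proof.
have [-> //|ne_ac] := eqVneq a c; elim: u => //= b u IHu.
have [eq_bc|ne_bc] := eqVneq b c; have [eq_ba|ne_ba] := eqVneq b a.
- by rewrite -eq_bc -eq_ba eqxx in ne_ac.
- by rewrite /= eq_bc eqxx.
- by rewrite /= eq_ba eqxx.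
- by rewrite /= (negbTE ne_bc) (negbTE ne_ba) IHu.
Qed.

(** If c occurs twice in u, the faces omitting one of its two occurrences have
    opposite signs and agree once the other occurrence is removed. If c occurs
    once, no face omits it, and its removal commutes with the faces. *)
Lemma wdiff_unique phi c u :
  wdiff (fun v => if count_mem c v == 1 then phi (rem c v) else 0) u =
    if count_mem c u == 1 then wdiff phi (rem c u) else 0.
Proof.
elim: u phi => [|a u IHu] phi //.
have [<-|ne_ac] := eqVneq a c.
  rewrite wdiff_cons /= eqxx /= add1n eqSS mem_count count_mem_rem eqxx.
  have [cnt0|cnt_u] := posnP (count_mem a u).
    rewrite cnt0 eqxx; apply: eq_wdiff => v vu _ _.
    by rewrite (count_memPn _) ?vu ?mem_count ?cnt0.
  rewrite [RHS]ifN ?add1n ?eqSS -?lt0n // wdiff_eq0 => [|v vu _ _].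
    rewrite subr0; case: eqP => [->|_]; last by rewrite subr0.
    by rewrite eqxx subrr.
  by rewrite ifN // add1n eqSS -lt0n -mem_count vu mem_count.
have cntE v: count_mem c (a :: v) = count_mem c v.
  by rewrite /= (negbTE ne_ac).
have remE v: rem c (a :: v) = a :: rem c v by rewrite /= (negbTE ne_ac).
have -> : wdiff (fun v => if count_mem c v == 1
                          then phi (rem c v) else 0) (a :: u) =
  if a \in u then
    (if count_mem c u == 1 then phi (rem c u) else 0) -
    (if count_mem c u == 1 then wdiff (fun v => phi (a :: v)) (rem c u) else 0)
    - (if count_mem a u == 1 then
         if count_mem c u == 1 then phi (a :: rem c (rem a u)) else 0 else 0)
  else if count_mem c u == 1 then wdiff (fun v => phi (a :: v)) (rem c u) else 0.
  rewrite wdiff_cons -IHu cntE remE count_mem_rem (negbTE ne_ac) subn0.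
  by congr (if _ then _ - _ - _ else _); apply: eq_wdiff => v _ _ _;
    rewrite cntE remE.
rewrite cntE remE wdiff_cons !mem_count count_mem_rem [c == a]eq_sym (negbTE ne_ac).
rewrite subn0 rem_comm; case: ifP => // _; case: (count_mem c u == 1) => //.
by rewrite !subr0; case: ifP; rewrite subr0.
Qed.

(** By induction on the word; the terms which the induction hypothesis leaves
    omit the first letter and its only other occurrence, and are evaluated by
    wdiff_unique. *)
Lemma wdiff2 phi u : wdiff (wdiff phi) u = 0.
Proof.
elim: u phi => [//|a u IHu] phi; rewrite wdiff_cons.
have [au|nau] := boolP (a \in u).
  have -> : wdiff (fun v => wdiff phi (a :: v)) u = wdiff phi u -
      (if count_mem a u == 1 then wdiff (fun v => phi (a :: v)) (rem a u) else 0).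
    rewrite -wdiff_unique -[X in _ = X - _]subr0.
    rewrite -[X in _ = _ - X - _](IHu (fun v => phi (a :: v))) -!wdiffB.
    by apply: eq_wdiff => v vu _ _; rewrite wdiff_cons vu au.
  rewrite subKr; case: eqP => cnt1; last by rewrite subrr.
  by rewrite wdiff_cons mem_count count_mem_rem eqxx cnt1 subrr.
rewrite -[RHS](IHu (fun v => phi (a :: v))); apply: eq_wdiff => v vu _ _.
by rewrite wdiff_cons vu (negbTE nau).
Qed.

Lemma nondegenerate_cons (a b : nat) u :
  nondegenerate (a :: b :: u) = (a != b) && nondegenerate (b :: u).
Proof. by []. Qed.

Lemma nondegenerate_behead (a : nat) u :
  nondegenerate (a :: u) -> nondegenerate u.
Proof. by case: u => //= b u /andP[]. Qed.

(** A letter which occurs once belongs to no pair of equal neighbours. *)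
Lemma rem_unique_degenerate a u :
  ~~ nondegenerate u -> count_mem a u == 1 -> ~~ nondegenerate (rem a u).
Proof.
elim: u => [//|b [|c u] IHu] //.
rewrite nondegenerate_cons negb_and negbK => dg.
have [ab|ne_ba] := eqVneq b a; rewrite rem_cons.
  rewrite ab eqxx /= eqxx add1n eqSS => /eqP cnt0; case/orP: dg => // /eqP cb.
  by rewrite -cb ab eqxx in cnt0.
rewrite /= (negbTE ne_ba) add0n => cnt1.
case/orP: dg => [/eqP cb|dg].
  by rewrite -cb (negbTE ne_ba) /= eqxx.
have := IHu dg cnt1; rewrite /=; case: ifP => [_|_] /=.
  by case: (u) => //= d u'; rewrite negb_and orbC => ->.
by rewrite negb_and => ->; rewrite orbT.
Qed.

(** The faces omitting one of two equal neighbours agree and have opposite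
    signs; the other faces are degenerate. *)
Lemma wdiff_degenerate phi u :
  (forall v, ~~ nondegenerate v -> phi v = 0) -> ~~ nondegenerate u ->
  wdiff phi u = 0.
Proof.
elim: u phi => [|a u IHu] phi phi0 dg //.
have phi0a v: ~~ nondegenerate v -> phi (a :: v) = 0.
  by move=> dg_v; apply: phi0; apply: contra dg_v => /nondegenerate_behead.
have [dg_u|ndg_u] := boolP (nondegenerate u).
  case: u dg dg_u IHu => [//|b u] dg dg_u IHu.
  move: dg; rewrite nondegenerate_cons dg_u andbT negbK => /eqP <-{b dg_u IHu}.
  rewrite wdiff_cons mem_head wdiff_cons /= eqxx add1n eqSS.
  have dgaa v: phi [:: a, a & v] = 0 by apply: phi0; rewrite /= eqxx.
  have waa: wdiff (fun v => phi [:: a, a & v]) u = 0 by apply: wdiff_eq0.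
  have [au|nau] := boolP (a \in u).
    rewrite waa dgaa if_same !subr0 subrr sub0r ifN ?oppr0 //.
    by rewrite -lt0n -mem_count.
  by rewrite waa (count_memPn nau) eqxx subr0 subrr.
rewrite wdiff_cons (IHu _ phi0a) // phi0 //; case: ifP => // _; rewrite subr0.
case: ifP => [cnt1|_]; last by rewrite subr0.
rewrite phi0 ?subr0 //.
by apply: contra (rem_unique_degenerate ndg_u cnt1) => /nondegenerate_behead.
Qed.

End WordDifferential.

Section TupleDifferential.

Fixpoint tdiff (T : Type) (V : zmodType) (phi : seq T -> V) (t : seq T) : V :=
  if t is w :: t' then phi t' - tdiff (fun s => phi (w :: s)) t' else 0.

Variables (T : eqType) (V : zmodType).
Implicit Types (phi psi : seq T -> V) (t : seq T).

Lemma tdiff_ind (S : V -> Prop) phi t :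
  S 0 -> (forall x y, S x -> S y -> S (x - y)) ->
  (forall s, (size s).+1 = size t -> subseq s t -> S (phi s)) ->
  S (tdiff phi t).
Proof.
move=> S0 SB; elim: t phi => [//|w t IHt] phi Sphi /=; apply: (SB).
  by apply: Sphi; rewrite ?subseq_cons.
by apply: IHt => s ss sub; apply: Sphi => /=; rewrite ?eqxx ?ss.
Qed.

Lemma raddf_tdiff (W : zmodType) (L : {additive V -> W}) phi t :
  L (tdiff phi t) = tdiff (fun s => L (phi s)) t.
Proof.
elim: t phi => [|w t IHt] phi; first exact: raddf0.
by rewrite /= raddfB IHt.
Qed.

Lemma tdiffB phi psi t :
  tdiff (fun s => phi s - psi s) t = tdiff phi t - tdiff psi t.
Proof.
elim: t phi psi => [|w t IHt] phi psi /=; first by rewrite subrr.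
by rewrite IHt subrACA.
Qed.

Lemma eq_tdiff phi psi t :
  (forall s, (size s).+1 = size t -> subseq s t -> phi s = psi s) ->
  tdiff phi t = tdiff psi t.
Proof.
move=> eq_phi; apply/eqP; rewrite -subr_eq0 -tdiffB; apply/eqP.
apply: (@tdiff_ind (fun x => x = 0)) => // [x y -> ->|s ss sub].
  by rewrite subr0.
by rewrite eq_phi // subrr.
Qed.

Lemma tdiff2 phi t : tdiff (tdiff phi) t = 0.
Proof.
elim: t phi => [//|w t IHt] phi /=.
by rewrite tdiffB IHt subr0 subrr.
Qed.

Lemma tdiff_degenerate phi t :
  (forall s, ~~ nondegenerate s -> phi s = 0) -> ~~ nondegenerate t ->
  tdiff phi t = 0.
Proof.
elim: t phi => [|w t IHt] phi phi0 dg //.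
have phi0w s: ~~ nondegenerate s -> phi (w :: s) = 0.
  by move=> dg_s; apply: phi0; apply: contra dg_s; case: (s) => //= b u /andP[].
have [dg_t|ndg_t] := boolP (nondegenerate t); last first.
  by rewrite /= (IHt _ phi0w) // phi0 // subr0.
case: t dg dg_t IHt => [//|b t] dg dg_t IHt.
move: dg => /=; rewrite /= in dg_t; rewrite dg_t andbT negbK => /eqP <-.
suff -> : tdiff (fun s => phi [:: w, w & s]) t = 0 by rewrite subr0 subrr.
rewrite -[RHS](subrr (tdiff (fun=> 0 : V) t)) -tdiffB; apply: eq_tdiff => s _ _.
by rewrite subrr phi0 //= eqxx.
Qed.

End TupleDifferential.

(** * Basis words and basis tuples *)

Section BasisWords.

Lemma ord_tuple_ex m n (l : seq nat) : size l = n -> all (fun a => a < m)%N l ->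
  exists t : n.-tuple 'I_m, map val t = l.
Proof.
move=> sz lt_l; pose t : seq 'I_m := pmap insub l.
have t_val : map val t = l.
  rewrite (pmap_filter (insubK _)); apply/all_filterP.
  by apply: sub_all lt_l => a am; rewrite insubT.
have sz_t : size t == n by rewrite -(size_map val) t_val sz.
by exists (Tuple sz_t).
Qed.

Variable R : comPzRingType.

Definition xvalid r d (u : seq nat) : bool :=
  [&& size u == (r + d)%N, all (fun a => a < r)%N u,
      all (fun a => a \in u) (iota 0 r) & nondegenerate u].

Lemma nondegenerate_map (T1 T2 : eqType) (f : T1 -> T2) (s : seq T1) :
  injective f -> nondegenerate (map f s) = nondegenerate s.
Proof.
move=> f_inj; rewrite /nondegenerate sorted_map.
by apply: eq_sorted => x y /=; rewrite (inj_eq f_inj).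
Qed.

Lemma xseq_inj r d : injective (@xseq r d).
Proof. by move=> b c /(inj_map val_inj)/val_inj/val_inj. Qed.

Lemma xseq_valid r d (b : xbasis r d) : xvalid r d (xseq b).
Proof.
have /andP[/forallP surj ndg] := valP b.
rewrite /xvalid size_map size_tuple eqxx nondegenerate_map ?ndg ?andbT //=.
  apply/andP; split; first by apply/allP=> _ /mapP[a _ ->] /=.
  apply/allP=> a; rewrite mem_iota => /= lt_ar.
  exact: (map_f val (surj (Ordinal lt_ar))).
exact: val_inj.
Qed.

Lemma xvalid_ex r d u : xvalid r d u -> exists b : xbasis r d, xseq b = u.
Proof.
case/and4P=> sz_u lt_u surj ndg.
have [t t_val] := ord_tuple_ex (eqP sz_u) lt_u.
have t_ok: [forall a, a \in t] && nondegenerate t.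
  rewrite -(nondegenerate_map _ (@val_inj _ _ 'I_r)) t_val ndg andbT.
  apply/forallP=> a; rewrite -(mem_map (@val_inj _ _ 'I_r)) t_val.
  by apply: (allP surj); rewrite mem_iota /=.
by exists (Sub t t_ok); rewrite /xseq SubK.
Qed.

Lemma xgenE r d u (b : xbasis r d) : xgen R r d u b = (xseq b == u)%:R.
Proof. by rewrite /xgen ffunE. Qed.

Lemma xgen_basis r d (b : xbasis r d) : xgen R r d (xseq b) = basis_elt R b.
Proof.
by apply/ffunP=> c; rewrite xgenE basis_eltE (inj_eq (@xseq_inj r d)).
Qed.

Lemma xgen_invalid r d u : ~~ xvalid r d u -> xgen R r d u = 0.
Proof.
move=> nv; apply/ffunP=> b; rewrite xgenE coef0.
by case: eqP nv => // <-; rewrite xseq_valid.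
Qed.

(** A formula on words may be used on every word, degenerate ones included,
    provided that it vanishes there like the generators do. *)
Lemma lin_ext_xgen (V : lmodType R) r d (f : xbasis r d -> V) (F : seq nat -> V)
  u : (forall b, f b = F (xseq b)) -> (~~ xvalid r d u -> F u = 0) ->
  lin_ext f (xgen R r d u) = F u.
Proof.
move=> fF F0; have [/xvalid_ex[b <-]|nv] := boolP (xvalid r d u).
  by rewrite xgen_basis lin_ext_basis fF.
by rewrite xgen_invalid // linear0 F0.
Qed.

Definition evalid r d (t : seq 'S_r) : bool :=
  (size t == d.+1) && nondegenerate t.

Lemma eseq_valid r d (b : ebasis r d) : evalid d (val (val b)).
Proof. by rewrite /evalid size_tuple eqxx; exact: (valP b). Qed.

Lemma evalid_ex r d (t : seq 'S_r) :
  evalid d t -> exists b : ebasis r d, val (val b) = t.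
Proof.
by case/andP=> sz_t ndg; exists (Sub (Tuple sz_t) ndg); rewrite SubK.
Qed.

Lemma egenE r d (t : seq 'S_r) (b : ebasis r d) :
  egen R d t b = ((val (val b) : seq 'S_r) == t)%:R.
Proof. by rewrite /egen ffunE. Qed.

Lemma egen_basis r d (b : ebasis r d) : egen R d (val (val b)) = basis_elt R b.
Proof.
by apply/ffunP=> c; rewrite /egen /basis_elt !ffunE.
Qed.

Lemma egen_invalid r d (t : seq 'S_r) : ~~ evalid d t -> egen R d t = 0.
Proof.
move=> nv; apply/ffunP=> b; rewrite egenE coef0.
by case: eqP nv => // <-; rewrite eseq_valid.
Qed.

Lemma lin_ext_egen (V : lmodType R) r d (f : ebasis r d -> V)
  (F : seq 'S_r -> V) t :
  (forall b, f b = F (val (val b))) -> (~~ evalid d t -> F t = 0) ->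
  lin_ext f (egen R d t) = F t.
Proof.
move=> fF F0; have [/evalid_ex[b <-]|nv] := boolP (evalid d t).
  by rewrite egen_basis lin_ext_basis fF.
by rewrite egen_invalid // linear0 F0.
Qed.

End BasisWords.

Section Differentials.

Variable R : comPzRingType.

Lemma caesura_cons a u p : caesura (a :: u) p.+1 = caesura u p.
Proof. by []. Qed.

Lemma caesura0 a u : caesura (a :: u) 0 = (a \in u).
Proof. by rewrite /caesura /= drop0. Qed.

Lemma line_cons a u p : line (a :: u) p.+1 = ((a \in u) + line u p)%N.
Proof.
by rewrite /line /= caesura0 -[1%N]addn0 iotaDl count_map.
Qed.

Lemma xdiff_coef0 a u : xdiff_coef R (a :: u) 0 = (a \in u)%:R.
Proof. by rewrite /xdiff_coef caesura0 /=; case: ifP. Qed.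

Lemma prev_occ_cons a u p : nth 0%N u p \in take p u -> (p <= size u)%N ->
  prev_occ (a :: u) p.+1 = (prev_occ u p).+1.
Proof.
move=> up sz; rewrite /prev_occ /=.
rewrite -[1%N]addn0 iotaDl filter_map /=.
rewrite (eq_filter (a2 := fun q => nth 0%N u q == nth 0%N u p)) //.
set s := filter _ _.
have: s != [::].
  rewrite -has_filter; apply/hasP.
  have lt_i: (index (nth 0%N u p) (take p u) < p)%N.
    by rewrite -[X in (_ < X)%N](size_takel sz) index_mem.
  exists (index (nth 0%N u p) (take p u)); first by rewrite mem_iota.
  by rewrite -(nth_take 0%N lt_i) nth_index.
case: s => // q s _; case: ifP => _ /=; exact: (last_map (addn 1)).
Qed.

Lemma prev_occ_cons0 a u p : nth 0%N u p \notin take p u -> (p <= size u)%N ->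
  prev_occ (a :: u) p.+1 = 0%N.
Proof.
move=> up sz; rewrite /prev_occ /= -[1%N]addn0 iotaDl filter_map /=.
rewrite (eq_in_filter (a2 := pred0)) ?filter_pred0; first by case: ifP.
move=> q; rewrite mem_iota /= add0n => lt_qp; apply/negbTE; apply: contra up.
move/eqP <-; rewrite -(nth_take 0%N lt_qp) mem_nth // size_takel //.
Qed.

(** The correction appears where the role of a letter changes: an only
    occurrence of a in u is a last occurrence in a :: u. *)
Lemma xdiff_coef_cons a u p : (p < size u)%N ->
  xdiff_coef R (a :: u) p.+1 =
    (if a \in u then - xdiff_coef R u p else xdiff_coef R u p)
    - ((nth 0%N u p == a) && (count_mem a u == 1%N))%:R.
Proof.
move=> lt_p; have le_p := ltnW lt_p.
rewrite /xdiff_coef caesura_cons !line_cons /= inE.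
set x := nth 0%N u p.
have cntE: count_mem x u =
    (count_mem x (take p u) + (1 + count_mem x (drop p.+1 u)))%N.
  rewrite -[in LHS](cat_take_drop p u) count_cat (drop_nth 0%N lt_p) /=.
  by rewrite eqxx.
have caesE: caesura u p = (0 < count_mem x (drop p.+1 u))%N.
  by rewrite /caesura mem_count.
have signE m : (-1) ^+ ((a \in u) + m) =
   (if a \in u then - (-1) ^+ m else (-1) ^+ m) :> R.
  by case: (a \in u); rewrite ?exprS ?mulN1r.
case: ifP => c.
  rewrite signE; case: eqP => [<-|_]; last by rewrite subr0.
  rewrite caesE in c; case: eqP => [e|_]; last by rewrite subr0.
  by move: e c; rewrite cntE addnA; case: (count_mem x (drop p.+1 u)) => // m; rewrite addn1 addnS.
have [pin|pnin] := boolP (x \in take p u).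
  rewrite orbT prev_occ_cons // line_cons signE.
  have pin' := pin; rewrite mem_count in pin.
  case: eqP => [<-|_] /=; last by rewrite subr0; case: ifP.
  case: eqP => [e|_]; first by move: e pin; rewrite cntE addnA addn1; case: (count_mem x (take p u)).
  by rewrite subr0; case: ifP.
rewrite orbF prev_occ_cons0 //; case: eqP => [<-|_] /=; last first.
  by rewrite oppr0 if_same addr0.
rewrite /line /= expr0 oppr0 if_same sub0r.
suff -> : count_mem x u = 1%N by [].
rewrite cntE (count_memPn pnin).
by move: c; rewrite caesE lt0n => /negbFE/eqP ->.
Qed.

Lemma sum_uniqueP (V : lmodType R) (phi : seq nat -> V) a u :
  \sum_(p < size u) ((nth 0%N u p == a) && (count_mem a u == 1%N))%:R *:
      phi (delete p u) =
    if count_mem a u == 1%N then phi (rem a u) else 0.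
Proof.
case: eqP => [cnt1|_]; last first.
  by apply: big1 => p _; rewrite andbF scale0r.
have au: a \in u by rewrite mem_count cnt1.
have lt_a : (index a u < size u)%N by rewrite index_mem.
rewrite (bigD1 (Ordinal lt_a)) //= nth_index // eqxx scale1r big1 ?addr0.
  by rewrite /delete -remE.
move=> p ne_p; rewrite andbT; case: eqP => [eq_p|]; last by rewrite scale0r.
case/eqP: ne_p; apply: val_inj => /=.
move: (nat_of_ord p) (ltn_ord p) eq_p => q lt_q eq_q.
have uE: u = take q u ++ a :: drop q.+1 u.
  by rewrite -eq_q -drop_nth // cat_take_drop.
have na: a \notin take q u.
  rewrite mem_count -eqn0Ngt; move: cnt1; rewrite uE count_cat /= eqxx addnA.
  by rewrite addn1 addSn => -[/eqP]; rewrite addn_eq0 -uE => /andP[].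
rewrite uE index_cat (negbTE na) /= eqxx addn0 size_takel //.
exact: ltnW.
Qed.

(** Caesuras, lines and previous occurrences in a :: u are those in u shifted
    by one position, up to the caesura at a; the recursion of wdiff records
    this. *)
Lemma sum_xdiff_coef (V : lmodType R) (phi : seq nat -> V) u :
  \sum_(p < size u) xdiff_coef R u p *: phi (delete p u) = wdiff phi u.
Proof.
elim: u phi => [|a u IHu] phi; first by rewrite big_ord0.
rewrite big_ord_recl xdiff_coef0 wdiff_cons /delete /= drop0.
under eq_bigr => p _ do
  rewrite /bump leq0n add1n xdiff_coef_cons ?ltn_ord // scalerBl /=.
rewrite sumrB (sum_uniqueP (fun v => phi (a :: v))).
rewrite -(IHu (fun v => phi (a :: v))) addrA.
have [au|nau] := boolP (a \in u).
  congr (_ + _ - _); first by rewrite scale1r.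
  by rewrite -sumrN; apply: eq_bigr => p _; rewrite scaleNr.
by rewrite (count_memPn nau) /= subr0 scale0r add0r.
Qed.

Lemma xdiffE r d (b : xbasis r d.+1) :
  xdiff_gen R b = wdiff (xgen R r d) (xseq b).
Proof.
rewrite -sum_xdiff_coef /xdiff_gen.
have -> : size (xseq b) = (r + d.+1)%N by rewrite size_map size_tuple.
by [].
Qed.

Lemma ediffE r d (b : ebasis r d.+1) :
  ediff_gen R b = tdiff (egen R d) (val (val b)).
Proof.
rewrite /ediff_gen.
suff H (V : lmodType R) (phi : seq 'S_r -> V) t :
  \sum_(i < size t) (-1) ^+ i *: phi (delete i t) = tdiff phi t.
  by rewrite -H; have -> : size (val (val b)) = d.+2 by rewrite size_tuple.
elim: t phi => [|w t IHt] phi; first by rewrite big_ord0.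
rewrite big_ord_recl expr0 scale1r /delete /= drop0; congr (_ + _).
rewrite -IHt -sumrN; apply: eq_bigr => i _.
by rewrite /bump leq0n add1n exprS mulN1r scaleNr.
Qed.

Lemma xdiff_xgen r d u : size u = (r + d.+1)%N ->
  lin_ext (@xdiff_gen R r d) (xgen R r d.+1 u) = wdiff (xgen R r d) u.
Proof.
move=> sz_u; apply: lin_ext_xgen => [b|]; first exact: xdiffE.
have xgen0 v : ~~ xvalid r d v -> xgen R r d v = 0 by apply: xgen_invalid.
rewrite /xvalid sz_u eqxx /= andbA negb_and => /orP[nv|dg]; last first.
  apply: wdiff_degenerate => // v dg_v; apply: xgen0.
  by rewrite /xvalid (negbTE dg_v) !andbF.
apply: wdiff_eq0 => v vu _ _; apply: xgen0; apply: contra nv.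
case/and4P=> _ lt_v surj _; rewrite -(eq_all_r vu) lt_v /=.
by apply: sub_all surj => a; rewrite vu.
Qed.

Lemma ediff_egen r d (t : seq 'S_r) : size t = d.+2 ->
  lin_ext (@ediff_gen R r d) (egen R d.+1 t) = tdiff (egen R d) t.
Proof.
move=> sz_t; apply: lin_ext_egen => [b|]; first exact: ediffE.
rewrite /evalid sz_t eqxx /= => dg; apply: tdiff_degenerate => // s dg_s.
by apply: egen_invalid; rewrite /evalid (negbTE dg_s) andbF.
Qed.

End Differentials.

(** * Variations and relative orders *)

Section Variations.

Variable T : eqType.
Implicit Types (a b : T) (s t : seq T).

Lemma variations_cons2 a b s :
  variations (a :: b :: s) = ((a != b) + variations (b :: s))%N.
Proof. by []. Qed.

Lemma variations_behead a s : (variations s <= variations (a :: s))%N.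
Proof. by case: s => // b s; rewrite variations_cons2 leq_addl. Qed.

Lemma variations_triangle a b s :
  (variations (a :: s) <= (a != b) + variations (b :: s))%N.
Proof.
case: s => [|c s] //; rewrite !variations_cons2 addnA leq_add2r.
case: (eqVneq a b) => [->|_] /=; first by rewrite add0n.
by rewrite (leq_trans (leq_b1 _)).
Qed.

Lemma variations_consl a s : (variations (a :: a :: s) = variations (a :: s))%N.
Proof. by rewrite variations_cons2 eqxx. Qed.

(** Deleting and repeating letters never increases the number of variations.
    The faces of words and tuples arise in this way, and so do the
    restrictions of composites to two values. *)
Inductive thins : seq T -> seq T -> Prop :=
| thins_nil : thins [::] [::]
| thins_skip a s t : thins t s -> thins t (a :: s)
| thins_copy a s t : thins t (a :: s) -> thins (a :: t) (a :: s).

Lemma thins_refl s : thins s s.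
Proof. by elim: s => [|a s IHs]; do ?constructor. Qed.

Lemma thins0 s : thins [::] s.
Proof. by elim: s => [|a s IHs]; constructor. Qed.

Lemma subseq_thins s t : subseq t s -> thins t s.
Proof.
elim: s t => [|a s IHs] [|b t] //=; try by move=> _; apply: thins0.
by case: eqP => [->|_] /IHs; do ?constructor.
Qed.

Lemma variations_thins_cons b s t :
  thins t s -> (variations (b :: t) <= variations (b :: s))%N.
Proof.
move=> ts; elim: ts b => // [a {}s {}t _ IHts|a {}s {}t _ IHts] b.
  by rewrite (leq_trans (variations_triangle b a t)) // leq_add2l.
rewrite !variations_cons2 leq_add2l.
by rewrite -[X in (_ <= X)%N]variations_consl.
Qed.

Lemma variations_thins s t : thins t s -> (variations t <= variations s)%N.
Proof.
case: s => [|a s] ts; first by inversion ts.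
rewrite (leq_trans (variations_behead a t)) //.
by rewrite -[X in (_ <= X)%N]variations_consl variations_thins_cons.
Qed.

Lemma variations_size s : (variations s <= (size s).-1)%N.
Proof.
elim: s => //= a [|b s] //= IHs.
by rewrite -add1n -[X in (_ <= 1 + X)%N]/((size (b :: s)).-1) leq_add ?leq_b1.
Qed.

End Variations.

Lemma thins_map (T1 T2 : eqType) (f : T1 -> T2) s t :
  thins t s -> thins (map f t) (map f s).
Proof. by elim=> /= *; constructor. Qed.

Lemma thins_filter (T : eqType) (p : pred T) s t :
  thins t s -> thins (filter p t) (filter p s).
Proof.
elim=> {s t} [|a s t _ IH|a s t _] /=; first by constructor.
  by case: ifP => // _; constructor.
by case: ifP => // _; constructor.
Qed.

Lemma variations_map (T1 T2 : eqType) (f : T1 -> T2) s :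
  {in s &, injective f} -> variations (map f s) = variations s.
Proof.
elim: s => //= a [|b s] // IHs f_inj.
rewrite [LHS]variations_cons2 [RHS]variations_cons2 -IHs => [|x y xs ys].
  by congr (_ + _)%N; rewrite (inj_in_eq f_inj) ?inE ?eqxx ?orbT.
by apply: f_inj; rewrite inE ?xs ?ys orbT.
Qed.

Section Order.

Definition ord (w : seq nat) (i j : nat) : bool := (index i w < index j w)%N.

(** Words on two values are encoded by booleans, true for i, so that the
    restrictions to different pairs of values and the orders in a tuple of
    permutations can be compared with each other. *)
Definition res (i j : nat) (u : seq nat) : seq bool :=
  [seq a == i | a <- u & (a == i) || (a == j)].

Lemma ord_cons a w i j : i != j ->
  ord (a :: w) i j = if a == i then true else if a == j then false else ord w i j.
Proof.
rewrite /ord /=; case: (eqVneq a i) => [->|_] /negbTE; first by move->.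
by move=> _; case: eqP.
Qed.

Lemma res_cons i j a u :
  res i j (a :: u) =
    if (a == i) || (a == j) then (a == i) :: res i j u else res i j u.
Proof. by rewrite /res /=; case: ifP. Qed.

(** The first letter of the restriction tells which of i and j occurs
    first. *)
Lemma variations_ord_res i j u b : i != j -> i \in u -> j \in u ->
  variations (b :: res i j u) = ((ord u i j != b) + variations (res i j u))%N.
Proof.
move=> ne_ij; elim: u => // a u IHu; rewrite !inE ord_cons // res_cons.
rewrite ![_ == a]eq_sym.
have [_ _ _|_] := eqVneq a i; first by rewrite variations_cons2 eq_sym.
have [_ _ _|_] := eqVneq a j; first by rewrite variations_cons2 eq_sym.
exact: IHu.
Qed.

Lemma thins_res i j s t : thins t s -> thins (res i j t) (res i j s).
Proof. by move=> ts; apply/thins_map/thins_filter. Qed.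

Lemma size_res_uniq i j u : i != j -> uniq u -> (size (res i j u) <= 2)%N.
Proof.
move=> ne_ij uu; rewrite size_map size_filter.
rewrite (leq_trans (n := count_mem i u + count_mem j u)) //.
  rewrite -count_predUI leq_addr //.
by rewrite !count_uniq_mem // (@leq_add _ _ 1 1) ?leq_b1.
Qed.

Lemma variations_mem2 i j u : i != j -> i \in u -> j \in u ->
  (0 < variations (res i j u))%N.
Proof.
move=> ne_ij ui uj; have := variations_ord_res (~~ ord u i j) ne_ij ui uj.
have -> : (ord u i j != ~~ ord u i j) = true by case: ord.
rewrite addSn add0n; set s := res i j u.
case Es: s => [|a s'] //; rewrite variations_cons2 => e.
have hb b : b \in s.
  apply/mapP; exists (if b then i else j); last by case: b; rewrite ?eqxx // eq_sym (negbTE ne_ij).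
  by rewrite mem_filter; case: b; rewrite ?ui ?uj eqxx ?orbT.
rewrite lt0n; apply/negP => /eqP v0.
have cst b t : variations (b :: t) = 0%N -> t = nseq (size t) b.
  elim: t b => // c t IHt b; rewrite variations_cons2.
  by case: eqP => //= <- /IHt {1}->.
have := hb (~~ a); rewrite Es inE (cst _ _ _ v0) mem_nseq.
by case: (a); rewrite andbF.
Qed.

End Order.

Section PermWords.

Lemma perm_seq_mem r (w : 'S_r) : perm_eq (perm_seq w) (iota 0 r).
Proof.
rewrite /perm_seq -val_enum_ord map_comp; apply: perm_map.
apply: uniq_perm; first by rewrite map_inj_uniq ?(enum_uniq 'I_r) //; apply: perm_inj.
  exact: enum_uniq.
move=> i; rewrite mem_enum; apply/mapP; exists (w^-1 i)%g; rewrite ?mem_enum //.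
by rewrite permKV.
Qed.

Lemma perm_seq_uniq r (w : 'S_r) : uniq (perm_seq w).
Proof. by rewrite (perm_uniq (perm_seq_mem w)) iota_uniq. Qed.

Lemma mem_perm_seq r (w : 'S_r) a : (a \in perm_seq w) = (a < r)%N.
Proof. by rewrite (perm_mem (perm_seq_mem w)) mem_iota. Qed.

Lemma index_perm_seq r (w : 'S_r) (i : 'I_r) :
  index (val i) (perm_seq w) = val (w^-1 i)%g.
Proof.
rewrite -{1}(permKV w i) /perm_seq (map_comp val w) index_map; last exact: val_inj.
by rewrite index_map ?index_enum_ord //; exact: perm_inj.
Qed.

Lemma perm_seq_ex r s : perm_eq s (iota 0 r) -> exists w : 'S_r, perm_seq w = s.
Proof.
move=> s_r; have [||t t_val] := @ord_tuple_ex r r s.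
- by rewrite (perm_size s_r) size_iota.
- by apply/allP=> a; rewrite (perm_mem s_r) mem_iota.
have ut : uniq t.
  by rewrite -(map_inj_uniq val_inj) t_val (perm_uniq s_r) iota_uniq.
have f_inj: injective (tnth t) by apply/tuple_uniqP.
exists (perm f_inj); rewrite -t_val /perm_seq.
have tE: t = [seq tnth t i | i <- enum 'I_r] :> seq 'I_r.
  by rewrite map_tnth_enum.
by rewrite [in RHS]tE -[RHS]map_comp; apply: eq_map => i /=; rewrite permE.
Qed.

Lemma perm_seq_inj r : injective (@perm_seq r).
Proof.
move=> w1 w2 e; apply/permP=> i; apply: val_inj.
by have /eq_in_map/(_ i) := e; rewrite mem_enum => /(_ isT).
Qed.

Definition seq_perm r (s : seq nat) : 'S_r :=
  odflt 1%g [pick w | perm_seq w == s].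

Lemma seq_permK r s : perm_eq s (iota 0 r) -> perm_seq (seq_perm r s) = s.
Proof.
case/perm_seq_ex=> w sw; rewrite /seq_perm; case: pickP => [w' /eqP //|].
by move/(_ w); rewrite sw eqxx.
Qed.

Fixpoint firsts (u : seq nat) : seq nat :=
  if u is a :: u' then a :: [seq b <- firsts u' | b != a] else [::].

Lemma mem_firsts u : firsts u =i u.
Proof.
elim: u => // a u IHu b; rewrite !inE mem_filter IHu.
by case: eqP.
Qed.

Lemma firsts_uniq u : uniq (firsts u).
Proof.
elim: u => //= a u IHu; rewrite filter_uniq // andbT.
by rewrite mem_filter eqxx.
Qed.

Lemma ord_filter c s i j : i != j -> c != i -> c != j ->
  ord [seq b <- s | b != c] i j = ord s i j.
Proof.
move=> ne_ij ne_ci ne_cj; elim: s => //= b s IHs.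
rewrite [RHS]ord_cons //; have [->|_] := eqVneq b c; last by rewrite /= ord_cons ?IHs.
by rewrite (negbTE ne_ci) (negbTE ne_cj).
Qed.

Lemma ord_firsts u i j : i != j -> ord (firsts u) i j = ord u i j.
Proof.
move=> ne_ij; elim: u => //= a u IHu; rewrite !ord_cons //.
by case: eqVneq => // ne_ai; case: eqVneq => // ne_aj; rewrite ord_filter.
Qed.

End PermWords.

(** * A contraction of words onto a permutation *)

Local Arguments variations : simpl never.

Section WordContraction.

(** The terms of the contraction onto sigma. As long as the next value of
    sigma occurs once in u it is moved to the front; at any stage, the next
    value may instead be inserted in front of the rest. This plays the role of
    prepending sigma to a tuple. *)
Fixpoint cone_words (sigma u : seq nat) : seq (seq nat) :=
  if sigma is c :: tau then
    (if c \in u then [:: c :: u] else [::]) ++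
    (if count_mem c u == 1%N then map (cons c) (cone_words tau (rem c u))
     else [::])
  else [::].

Definition cone (V : zmodType) (phi : seq nat -> V) (sigma u : seq nat) : V :=
  \sum_(v <- cone_words sigma u) phi v.

Lemma mem_cone_words sigma u v : v \in cone_words sigma u ->
  [/\ v =i u, size v = (size u).+1 & nondegenerate v -> nondegenerate u].
Proof.
elim: sigma u v => //= c tau IHs u v; rewrite mem_cat => /orP[].
  case: ifP => // cu; rewrite inE => /eqP ->; split=> // [a|].
    by rewrite inE; case: eqP => // ->.
  exact: nondegenerate_behead.
case: ifP => // cnt1 /mapP[w /IHs[wu sw ndg] ->].
have cu: c \in u by rewrite mem_count (eqP cnt1).
split=> [a||].
- by rewrite -(mem_rem_cons cu a) !inE wu.
- by rewrite /= sw size_rem //; case: (u) cu.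
move/nondegenerate_behead/ndg; apply: contraLR => dg.
exact: rem_unique_degenerate.
Qed.

(** An inserted letter i or j agrees with the order of sigma. When i or j is
    moved to the front, it occurs nowhere else, and the restriction is left
    with at most one variation. *)
Lemma cone_words_res sigma u v i j : i != j ->
  v \in cone_words sigma u ->
  (variations (ord sigma i j :: res i j v) <=
     maxn 1 (variations (ord sigma i j :: res i j u)))%N.
Proof.
move=> ne_ij; elim: sigma u v => //= c tau IHs u v.
rewrite ord_cons // mem_cat => /orP[].
  case: ifP => // cu; rewrite inE => /eqP ->; rewrite leq_max res_cons.
  apply/orP; right; case: (eqVneq c i) => [_|_]; first by rewrite /= variations_consl.
  by case: (eqVneq c j) => [_|_] //=; rewrite variations_consl.
case: ifP => // cnt1 /mapP[w w_tau ->]; rewrite res_cons leq_max.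
have [wu _ _] := mem_cone_words w_tau.
have ncw: c \notin w by rewrite wu mem_count count_mem_rem eqxx (eqP cnt1).
have one b s : all (pred1 (~~ b)) s -> (variations (b :: b :: s) <= 1)%N.
  have cst m : variations (nseq m (~~ b)) = 0%N.
    by elim: m => // -[|m] // IHm; rewrite [LHS]variations_cons2 eqxx.
  move/all_pred1P ->; rewrite variations_consl.
  by case: (size s) => // n; rewrite [variations _]variations_cons2 (cst n.+1) addn0 leq_b1.
have [ci|ne_ci] := eqVneq c i.
  rewrite one //; apply/allP=> x /mapP[a]; rewrite mem_filter => /andP[_ aw] ->{x}.
  by apply/eqP/negbTE; apply: contra ncw => /eqP ai; rewrite ci -ai.
have [cj|ne_cj] := eqVneq c j.
  rewrite one //; apply/allP=> x /mapP[a]; rewrite mem_filter => /andP[aij aw] ->{x}.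
  rewrite /= eqb_id; case/orP: aij => // /eqP aj.
  by rewrite -cj in aj; rewrite -aj aw in ncw.
rewrite /= -leq_max; suff resE: res i j (rem c u) = res i j u.
  by rewrite -resE; apply: IHs.
rewrite /res; congr map; elim: (u) => //= a s IHu.
have [->|ne_ac] := eqVneq a c; first by rewrite (negbTE ne_ci) (negbTE ne_cj).
by rewrite /= IHu.
Qed.

Variable V : zmodType.
Implicit Types (phi psi : seq nat -> V) (sigma tau u v : seq nat).

Lemma cone_cons phi c tau u :
  cone phi (c :: tau) u =
    (if c \in u then phi (c :: u) else 0) +
    (if count_mem c u == 1%N then cone (fun v => phi (c :: v)) tau (rem c u)
     else 0).
Proof.
rewrite /cone /= big_cat /=; congr (_ + _).
  by case: ifP; rewrite ?big_seq1 ?big_nil.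
by case: ifP; rewrite ?big_map ?big_nil.
Qed.

Lemma eq_cone phi psi sigma u :
  (forall v, v =i u -> phi v = psi v) -> cone phi sigma u = cone psi sigma u.
Proof.
by move=> eq_phi; apply: eq_big_seq => v /mem_cone_words[vu _ _]; apply: eq_phi.
Qed.

(** By induction on sigma. The face omitting the inserted letter gives back
    phi u, and wdiff_unique exchanges the removal of a letter occurring once
    with the differential. The term phi sigma remains when all the letters
    have been moved to the front, that is when u has no repetition. *)
Lemma wdiff_cone phi sigma u : uniq sigma -> u =i sigma ->
  wdiff (cone phi sigma) u + cone (wdiff phi) sigma u =
    phi u - (if uniq u then phi sigma else 0).
Proof.
elim: sigma u phi => [|c tau IHs] u phi.
  case: u => [_ _|a u _ /(_ a)]; last by rewrite mem_head.
  by rewrite [wdiff _ _]/= add0r /cone big_nil subrr.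
case/andP=> nc_tau utau u_sigma; have cu: c \in u by rewrite u_sigma mem_head.
have -> : wdiff (cone phi (c :: tau)) u = wdiff (fun v => phi (c :: v)) u +
    (if count_mem c u == 1%N
     then wdiff (cone (fun v => phi (c :: v)) tau) (rem c u) else 0).
  rewrite -wdiff_unique -wdiffD; apply: eq_wdiff => v vu _ _.
  by rewrite cone_cons vu cu.
rewrite cone_cons cu wdiff_cons cu.
have uniq_u: uniq u = (count_mem c u == 1%N) && uniq (rem c u).
  rewrite (perm_uniq (perm_to_rem cu)) /= mem_count count_mem_rem eqxx.
  by move: cu; rewrite mem_count; case: (count_mem c u) => [|[|n]].
rewrite uniq_u; case: eqP => cnt1 /=; last by rewrite !subr0 !addr0 addrC subrK.
have rem_tau: rem c u =i tau.
  move=> a; have [-> | ne_ac] := eqVneq a c.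
    by rewrite (negbTE nc_tau) mem_count count_mem_rem eqxx cnt1.
  have := mem_rem_cons cu a; rewrite u_sigma !inE (negbTE ne_ac) /= => <-.
  by [].
have {}IHs := IHs _ (fun v => phi (c :: v)) utau rem_tau.
have -> : cone (fun v => wdiff phi (c :: v)) tau (rem c u) =
          cone (wdiff (fun v => phi (c :: v))) tau (rem c u).
  apply: eq_cone => v vu; rewrite wdiff_cons ifN // vu mem_count count_mem_rem.
  by rewrite eqxx cnt1.
by rewrite -addrA [X in _ + X = _]addrCA IHs subrKA addrA [X in X - _]addrC subrK.
Qed.
End WordContraction.

(** * Contractible cells of the Barratt-Eccles operad *)

Section Cells.

Variable r : nat.

(** Complete graphs on 0, ..., r - 1 with labelled edges, oriented by a total
    order of the vertices. In the relation [cell_le] a label may stay the same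
    only if the orientation of the edge does. *)
Definition cell_index : Type := ((nat -> nat -> nat) * 'S_r)%type.

Definition cell_le : rel cell_index := fun k l =>
  [forall i : 'I_r, forall j : 'I_r, (i < j)%N ==>
    (k.1 i j + (ord (perm_seq k.2) i j != ord (perm_seq l.2) i j)
       <= l.1 i j)%N].

(** A label 0 would leave the cell empty, since the labels of the models are
    positive. *)
Definition cell_ok : pred cell_index := fun k =>
  [forall i : 'I_r, forall j : 'I_r, (i < j)%N ==> (0 < k.1 i j)%N].

Lemma forall_ltP (P : nat -> nat -> bool) :
  reflect (forall i j, (i < j)%N -> (j < r)%N -> P i j)
    [forall i : 'I_r, forall j : 'I_r, (i < j)%N ==> P i j].
Proof.
apply: (iffP forallP) => [P_ij i j ij jr | P_ij i].
  have /forallP/(_ (Ordinal jr))/implyP := P_ij (Ordinal (ltn_trans ij jr)).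
  exact.
by apply/forallP=> j; apply/implyP=> ij; apply: P_ij.
Qed.

Lemma cell_leP k l :
  reflect (forall i j, (i < j)%N -> (j < r)%N ->
     k.1 i j + (ord (perm_seq k.2) i j != ord (perm_seq l.2) i j) <= l.1 i j)%N
    (cell_le k l).
Proof.
exact: (forall_ltP (fun i j =>
  k.1 i j + (ord (perm_seq k.2) i j != ord (perm_seq l.2) i j) <= l.1 i j)%N).
Qed.

Lemma cell_okP k :
  reflect (forall i j, (i < j)%N -> (j < r)%N -> 0 < k.1 i j)%N (cell_ok k).
Proof. exact: (forall_ltP (fun i j => 0 < k.1 i j)%N). Qed.

Lemma cell_le_refl : reflexive cell_le.
Proof. by move=> k; apply/cell_leP=> i j _ _; rewrite eqxx addn0. Qed.

Lemma cell_le_trans : transitive cell_le.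
Proof.
move=> l k m /cell_leP kl /cell_leP lm; apply/cell_leP=> i j ij jr.
apply: leq_trans (lm i j ij jr).
apply: leq_trans (leq_add (kl i j ij jr) (leqnn _)).
rewrite -addnA leq_add2l.
by do 3!case: ord.
Qed.

End Cells.

Section BarrattEcclesCells.

Variables (R : comPzRingType) (r : nat).

Definition eres (i j : nat) (t : seq 'S_r) : seq bool :=
  [seq ord (perm_seq w) i j | w <- t].

(** The successor relates the changes of order in a tuple to the variations of
    a word: a constant order corresponds to a word with one variation. *)
Definition emodel d (b : ebasis r d) : cell_index r :=
  (fun i j => (variations (eres i j (val (val b)))).+1,
   head 1%g (val (val b))).

(** In this form the order of k is one more entry of the tuple, so faces and
    cones are handled by comparing sequences. *)
Lemma emodel_le d (b : ebasis r d) (k : cell_index r) :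
  reflect (forall i j, (i < j)%N -> (j < r)%N ->
             (variations (ord (perm_seq k.2) i j :: eres i j (val (val b)))
                < k.1 i j)%N)
          (cell_le (emodel b) k).
Proof.
apply: (iffP (cell_leP _ _)) => H i j ij jr; have := H i j ij jr;
  have := size_tuple (val b); rewrite /emodel /=; case: (tval _) => // w t _;
  by rewrite /= variations_cons2 eq_sym addnC ?addSn ?addnS.
Qed.

Definition aug_map (I : finType) : {linear free_mod R I -> R^o} :=
  lin_ext (fun=> 1 : R^o).

Lemma aug_mapZ (I : finType) (V : lmodType R) (x : free_mod R I) (p : V) :
  (aug_map I x : R) *: p = lin_ext (fun=> p) x.
Proof.
rewrite /aug_map /= /lin_ext scaler_suml; apply: eq_bigr => i _.
by rewrite -scalerA scale1r.
Qed.

Definition ediff d : {linear emod R r d.+1 -> emod R r d} :=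
  lin_ext (@ediff_gen R r d).

Definition econe (k : cell_index r) d : {linear emod R r d -> emod R r d.+1} :=
  lin_ext (fun b => egen R d.+1 (k.2 :: val (val b))).

Lemma econe_egen k d t : econe k d (egen R d t) = egen R d.+1 (k.2 :: t).
Proof.
apply: (lin_ext_egen (F := fun t => egen R d.+1 (k.2 :: t))) => // nv.
apply: egen_invalid; apply: contra nv; rewrite /evalid /= eqSS.
by case/andP=> -> /=; case: t => //= a t /andP[].
Qed.

Lemma ediff_mapE d t : size t = d.+2 ->
  ediff d (egen R d.+1 t) = tdiff (egen R d) t.
Proof. exact: ediff_egen. Qed.

Lemma ediff2 d x : ediff d (ediff d.+1 x) = 0.
Proof.
apply: (@eq_linear _ _ _ (ediff d \o ediff d.+1) \0) => b /=.
rewrite -egen_basis [X in ediff d X]ediff_egen; last by rewrite size_tuple.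
rewrite raddf_tdiff -[RHS](tdiff2 (egen R d) (val (val b))).
apply: eq_tdiff => s ss _; rewrite [LHS]ediff_egen //.
by apply/eq_add_S; rewrite ss size_tuple.
Qed.

Local Arguments aug_map : simpl never.
Local Arguments ediff : simpl never.
Local Arguments econe : simpl never.

Lemma aug_egen1 (w : 'S_r) : aug_map _ (egen R 0 [:: w]) = 1.
Proof. by apply: (@lin_ext_egen R R^o _ _ _ (fun=> 1)) => // /negP[]. Qed.

Lemma aug_ediff x : aug_map _ (ediff 0 x) = 0.
Proof.
apply: (@eq_linear _ _ _ (aug_map _ \o ediff 0) \0) => b /=.
rewrite -egen_basis ediff_egen; last by rewrite size_tuple.
rewrite (raddf_tdiff (aug_map _)).
have := size_tuple (val b) : size (val (val b)) = 2%N.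
case: (val (val b)) => // w0 [] // w1 [] // _.
rewrite [LHS]/tdiff subr0 [X in X - _]aug_egen1 [X in _ - X]aug_egen1.
by rewrite subrr.
Qed.

Lemma econe0 k x :
  ediff 0 (econe k 0 x) = x - (aug_map _ x : R) *: egen R 0 [:: k.2].
Proof.
rewrite aug_mapZ.
apply: (@eq_linear _ _ _ (ediff 0 \o econe k 0)
         (idfun \- lin_ext (fun=> egen R 0 [:: k.2]))) => b.
rewrite -[LHS]/(ediff 0 (econe k 0 (basis_elt R b))).
rewrite -[RHS]/(basis_elt R b - lin_ext (fun=> egen R 0 [:: k.2]) (basis_elt R b)).
rewrite [in RHS]lin_ext_basis -egen_basis econe_egen.
have := size_tuple (val b) : size (val (val b)) = 1%N.
by case: (val (val b)) => // w0 [|//] _; rewrite ediff_mapE // [tdiff _ _]/tdiff subr0.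
Qed.

Lemma econeS k d x :
  ediff d.+1 (econe k d.+1 x) + econe k d (ediff d x) = x.
Proof.
apply: (@eq_linear _ _ _ ((ediff d.+1 \o econe k d.+1) \+ (econe k d \o ediff d))
         idfun) => b.
rewrite -[LHS]/(ediff d.+1 (econe k d.+1 (basis_elt R b)) +
                econe k d (ediff d (basis_elt R b))).
rewrite -[RHS]/(basis_elt R b) -egen_basis econe_egen.
have := size_tuple (val b) : size (val (val b)) = d.+2.
move: (val (val b)) => t sz_t; rewrite !ediff_mapE ?raddf_tdiff /= ?sz_t //.
rewrite -addrA addrC -[RHS]add0r; congr (_ + _).
apply/eqP; rewrite addrC subr_eq0; apply/eqP/eq_tdiff => s _ _.
by rewrite econe_egen.
Qed.

Lemma emodel_ok d (b : ebasis r d) : cell_ok (emodel b).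
Proof. exact/cell_okP. Qed.

Lemma spanned_egen d (A : pred (ebasis r d)) (t : seq 'S_r) :
  (forall b : ebasis r d, val (val b) = t -> A b) -> spanned A (egen R d t).
Proof.
move=> At; have [/evalid_ex[b tb]|nv] := boolP (evalid d t).
  by rewrite -tb egen_basis; apply: spanned_basis; apply: At.
by rewrite egen_invalid //; case: (spanned_closed R A).
Qed.

Lemma ept_cell k : cell_ok k ->
  spanned [pred b : ebasis r 0 | cell_le (emodel b) k] (egen R 0 [:: k.2]).
Proof.
move/cell_okP=> k0; apply: spanned_egen => b bk; apply/emodel_le=> i j ij jr.
by rewrite bk /= variations_cons2 eqxx k0.
Qed.

Lemma econe_cell k d x : cell_ok k ->
  spanned [pred b : ebasis r d | cell_le (emodel b) k] x ->
  spanned [pred b : ebasis r d.+1 | cell_le (emodel b) k] (econe k d x).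
Proof.
move=> _ kx; apply: spanned_lin_ext kx _; first exact: spanned_closed.
move=> b /emodel_le kb; apply: spanned_egen => c cb; apply/emodel_le=> i j ij jr.
by rewrite cb /= variations_consl kb.
Qed.

Lemma ediff_cell d (b : ebasis r d.+1) :
  spanned [pred c : ebasis r d | cell_le (emodel c) (emodel b)]
    (ediff d (basis_elt R b)).
Proof.
rewrite -egen_basis ediff_mapE ?size_tuple //.
have SP := @spanned_closed R _
  [pred c : ebasis r d | cell_le (emodel c) (emodel b)].
apply: tdiff_ind => [|x y|s _ sub]; [by case: SP | exact: lin_closedB |].
apply: spanned_egen => c cs; apply/emodel_le=> i j ij jr; rewrite cs.
rewrite -[X in (_ < X)%N]/(variations (eres i j (val (val b)))).+1 ltnS.
rewrite -[(emodel b).2]/(head 1%g (val (val b))).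
have := size_tuple (val b) : size (val (val b)) = d.+2.
case: (val (val b)) sub => // w t sub _; rewrite /= -[X in (_ <= X)%N]variations_consl.
by apply: variations_thins_cons (thins_map _ (subseq_thins sub)).
Qed.

Definition ecomplex : carried_complex R (@cell_le r) (@cell_ok r) :=
  @CarriedComplex R (cell_index r) (@cell_le r) (@cell_ok r)
    (ebasis r) ediff (aug_map _) emodel (fun k => egen R 0 [:: k.2])
    econe ediff2 aug_ediff
    (fun k => aug_egen1 k.2) econe0 econeS emodel_ok ept_cell
    econe_cell ediff_cell.
End BarrattEcclesCells.

(** * Contractible cells of the surjection operad *)

Section SurjectionCells.

Variables (R : comPzRingType) (r : nat).

Lemma xvalid_mem d u a : xvalid r d u -> (a \in u) = (a < r)%N.
Proof.
case/and4P=> _ /allP lt_u /allP surj _; apply/idP/idP => [/lt_u //|ar].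
by apply: surj; rewrite mem_iota.
Qed.

Lemma xvalid_firsts d u : xvalid r d u -> perm_eq (firsts u) (iota 0 r).
Proof.
move=> uv; apply: uniq_perm; rewrite ?firsts_uniq ?iota_uniq // => a.
by rewrite mem_firsts (xvalid_mem _ uv) mem_iota.
Qed.

Definition xmodel d (b : xbasis r d) : cell_index r :=
  (fun i j => variations (res i j (xseq b)), seq_perm r (firsts (xseq b))).

(** In this form the order of k is one more letter of the restriction, so
    faces and cones are handled by comparing words. *)
Lemma xmodel_le d (b : xbasis r d) (k : cell_index r) :
  reflect (forall i j, (i < j)%N -> (j < r)%N ->
             (variations (ord (perm_seq k.2) i j :: res i j (xseq b))
                <= k.1 i j)%N)
          (cell_le (xmodel b) k).
Proof.
have bv := xseq_valid b.
apply: (iffP (cell_leP _ _)) => H i j ij jr; have := H i j ij jr;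
  rewrite variations_ord_res ?(xvalid_mem _ bv) ?neq_ltn ?ij ?(ltn_trans ij jr) //;
  by rewrite seq_permK ?(xvalid_firsts bv) // ord_firsts ?neq_ltn ?ij // addnC.
Qed.

Definition xdiff d : {linear xmod R r d.+1 -> xmod R r d} :=
  lin_ext (@xdiff_gen R r d).

Lemma xdiff_mapE d u : size u = (r + d.+1)%N ->
  xdiff d (xgen R r d.+1 u) = wdiff (xgen R r d) u.
Proof. exact: xdiff_xgen. Qed.

Definition xcone (k : cell_index r) d : {linear xmod R r d -> xmod R r d.+1} :=
  lin_ext (fun b => cone (xgen R r d.+1) (perm_seq k.2) (xseq b)).

Lemma xcone_xgen k d u :
  xcone k d (xgen R r d u) = cone (xgen R r d.+1) (perm_seq k.2) u.
Proof.
apply: (lin_ext_xgen (F := fun u => cone (xgen R r d.+1) (perm_seq k.2) u)) => // nv.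
rewrite /cone big_seq big1 // => v /mem_cone_words[vu sv ndg].
apply: xgen_invalid; apply: contra nv => /and4P[sz_v lt_v surj /ndg ndg_u].
rewrite /xvalid ndg_u andbT -(eq_all_r vu) lt_v -eqSS -sv (eqP sz_v) addnS eqxx /=.
by apply: sub_all surj => a; rewrite vu.
Qed.

Lemma size_xseq d (b : xbasis r d) : size (xseq b) = (r + d)%N.
Proof. by rewrite size_map size_tuple. Qed.

Lemma xdiff2 d x : xdiff d (xdiff d.+1 x) = 0.
Proof.
apply: (@eq_linear _ _ _ (xdiff d \o xdiff d.+1) \0) => b.
rewrite -[LHS]/(xdiff d (xdiff d.+1 (basis_elt R b))).
rewrite -xgen_basis xdiff_mapE ?size_xseq // raddf_wdiff.
rewrite -[RHS](wdiff2 (xgen R r d) (xseq b)); apply: eq_wdiff => s _ ss _.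
by rewrite [LHS]xdiff_mapE //; apply: eq_add_S; rewrite ss size_xseq addnS.
Qed.

Lemma wdiff_uniq (V : zmodType) (phi : seq nat -> V) u :
  uniq u -> wdiff phi u = 0.
Proof.
elim: u phi => // a u IHu phi /andP[nau uu].
by rewrite wdiff_cons (negbTE nau) IHu.
Qed.

(** A word with a single repetition has two faces with nonzero coefficient, of
    opposite signs. *)
Lemma wdiff_const (V : zmodType) (c : V) u :
  size u = (size (undup u)).+1 -> wdiff (fun=> c) u = 0.
Proof.
elim: u => // a u IHu; rewrite wdiff_cons /=.
case: ifP => [au [sz_u]|_ [/IHu //]].
have uu: uniq u by rewrite -[uniq u]negbK -ltn_size_undup sz_u ltnn.
by rewrite count_uniq_mem // au wdiff_uniq // subr0 subrr.
Qed.

Lemma size_undup_xvalid d u : xvalid r d u -> size (undup u) = r.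
Proof.
move=> uv; rewrite -[RHS](size_iota 0); apply/perm_size.
apply: uniq_perm; rewrite ?undup_uniq ?iota_uniq // => a.
by rewrite mem_undup (xvalid_mem _ uv) mem_iota.
Qed.

Lemma uniq_nondegenerate (T : eqType) (u : seq T) : uniq u -> nondegenerate u.
Proof.
elim: u => // a [|b u] IHu //= /andP[]; rewrite inE negb_or => /andP[-> _].
exact: IHu.
Qed.

Lemma aug_xgen1 u : perm_eq u (iota 0 r) ->
  aug_map _ _ (xgen R r 0 u) = 1.
Proof.
move=> ur; apply: (@lin_ext_xgen R R^o _ _ _ (fun=> 1)) => // /negP[].
rewrite /xvalid (perm_size ur) size_iota addn0 eqxx /=.
rewrite uniq_nondegenerate ?(perm_uniq ur) ?iota_uniq // andbT.
apply/andP; split; apply/allP=> a; first by rewrite (perm_mem ur) mem_iota.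
by rewrite (perm_mem ur).
Qed.

Lemma aug_xdiff x : aug_map R _ (xdiff 0 x) = 0.
Proof.
apply: (@eq_linear _ _ _ (aug_map R _ \o xdiff 0) \0) => b.
rewrite -[LHS]/(aug_map R _ (xdiff 0 (basis_elt R b))).
rewrite -xgen_basis xdiff_mapE ?size_xseq // (raddf_wdiff (aug_map R _)).
have bv := xseq_valid b.
rewrite -[RHS](@wdiff_const _ (1 : R^o) (xseq b)); last first.
  by rewrite (size_undup_xvalid bv) size_xseq addn1.
apply: eq_wdiff => v vb sv _; apply: aug_xgen1.
have v_r: v =i iota 0 r by move=> a; rewrite vb (xvalid_mem _ bv) mem_iota.
have sv_r: size v = r by apply: eq_add_S; rewrite sv size_xseq addn1.
apply: uniq_perm => //; last exact: iota_uniq.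
by rewrite (uniq_size_uniq (iota_uniq 0 r)) ?size_iota ?sv_r // => a; rewrite v_r.
Qed.

Lemma xdiff_cone k d u : size u = (r + d)%N ->
  xdiff d (xcone k d (xgen R r d u)) = cone (wdiff (xgen R r d)) (perm_seq k.2) u.
Proof.
move=> sz_u; rewrite xcone_xgen raddf_sum; apply: eq_big_seq => v.
by case/mem_cone_words=> _ sv _; rewrite [LHS]xdiff_mapE // sv sz_u addnS.
Qed.

Lemma perm_seq_xseq d (b : xbasis r d) (k : cell_index r) : xseq b =i perm_seq k.2.
Proof. by move=> a; rewrite (xvalid_mem _ (xseq_valid b)) mem_perm_seq. Qed.

Lemma uniq_xseq d (b : xbasis r d) : uniq (xseq b) = (d == 0%N).
Proof.
have := ltn_size_undup (xseq b).
rewrite (size_undup_xvalid (xseq_valid b)) size_xseq -[X in (X < _)%N]addn0.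
by rewrite ltn_add2l lt0n; case: eqP; case: uniq.
Qed.

Lemma xcone0 k x :
  xdiff 0 (xcone k 0 x) = x - (aug_map R _ x : R) *: xgen R r 0 (perm_seq k.2).
Proof.
rewrite aug_mapZ.
apply: (@eq_linear _ _ _ (xdiff 0 \o xcone k 0)
         (idfun \- lin_ext (fun=> xgen R r 0 (perm_seq k.2)))) => b.
rewrite -[LHS]/(xdiff 0 (xcone k 0 (basis_elt R b))).
rewrite -[RHS]/(basis_elt R b -
                lin_ext (fun=> xgen R r 0 (perm_seq k.2)) (basis_elt R b)).
rewrite [in RHS]lin_ext_basis -xgen_basis xdiff_cone ?size_xseq //.
have := @wdiff_cone _ (xgen R r 0) _ _ (perm_seq_uniq k.2) (perm_seq_xseq b k).
by rewrite uniq_xseq wdiff_uniq ?add0r // uniq_xseq.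
Qed.

Lemma xconeS k d x :
  xdiff d.+1 (xcone k d.+1 x) + xcone k d (xdiff d x) = x.
Proof.
apply: (@eq_linear _ _ _ ((xdiff d.+1 \o xcone k d.+1) \+ (xcone k d \o xdiff d))
         idfun) => b.
rewrite -[LHS]/(xdiff d.+1 (xcone k d.+1 (basis_elt R b)) +
                xcone k d (xdiff d (basis_elt R b))).
rewrite -[RHS]/(basis_elt R b) -xgen_basis xdiff_cone ?size_xseq //.
rewrite xdiff_mapE ?size_xseq // raddf_wdiff addrC.
rewrite (eq_wdiff (psi := cone (xgen R r d.+1) (perm_seq k.2))); last first.
  by move=> v _ _ _; apply: xcone_xgen.
rewrite wdiff_cone ?perm_seq_uniq //; last exact: perm_seq_xseq.
by rewrite uniq_xseq subr0.
Qed.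

Lemma xmodel_ok d (b : xbasis r d) : cell_ok (xmodel b).
Proof.
apply/cell_okP=> i j ij jr; have bv := xseq_valid b.
by apply: variations_mem2; rewrite ?neq_ltn ?ij ?(xvalid_mem _ bv) ?(ltn_trans ij jr).
Qed.

Lemma spanned_xgen d (A : pred (xbasis r d)) u :
  (forall b, xseq b = u -> A b) -> spanned A (xgen R r d u).
Proof.
move=> Au; have [/xvalid_ex[b ub]|nv] := boolP (xvalid r d u).
  by rewrite -ub xgen_basis; apply: spanned_basis; apply: Au.
by rewrite xgen_invalid //; case: (spanned_closed R A).
Qed.

Lemma xpt_cell k : cell_ok k ->
  spanned [pred b : xbasis r 0 | cell_le (xmodel b) k] (xgen R r 0 (perm_seq k.2)).
Proof.
move/cell_okP=> k0; apply: spanned_xgen => b bk; apply/xmodel_le=> i j ij jr.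
have ne_ij: i != j by rewrite neq_ltn ij.
have bv := xseq_valid b.
rewrite bk variations_ord_res // -?bk ?(xvalid_mem _ bv) ?(ltn_trans ij jr) //.
rewrite bk eqxx (leq_trans _ (k0 i j ij jr)) //.
rewrite (leq_trans (variations_size _)) //.
by have := size_res_uniq ne_ij (perm_seq_uniq k.2); case: size => [|[|[]]].
Qed.

Lemma xcone_cell k d x : cell_ok k ->
  spanned [pred b : xbasis r d | cell_le (xmodel b) k] x ->
  spanned [pred b : xbasis r d.+1 | cell_le (xmodel b) k] (xcone k d x).
Proof.
move=> /cell_okP k0 kx; apply: spanned_lin_ext kx _; first exact: spanned_closed.
move=> b /xmodel_le kb; rewrite /cone big_seq.
apply: lin_closed_sum; first exact: spanned_closed.
move=> v vb; apply: spanned_xgen => c cv; apply/xmodel_le=> i j ij jr; rewrite cv.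
have ne_ij: i != j by rewrite neq_ltn ij.
by rewrite (leq_trans (cone_words_res ne_ij vb)) // geq_max k0 // kb.
Qed.

Lemma xdiff_cell d (b : xbasis r d.+1) :
  spanned [pred c : xbasis r d | cell_le (xmodel c) (xmodel b)]
    (xdiff d (basis_elt R b)).
Proof.
rewrite -xgen_basis xdiff_mapE ?size_xseq //.
have SP := @spanned_closed R _
  [pred c : xbasis r d | cell_le (xmodel c) (xmodel b)].
apply: wdiff_ind => [|x y|s _ _ sub]; [by case: SP | exact: lin_closedB |].
have /xmodel_le bb := cell_le_refl (xmodel b).
apply: spanned_xgen => c cs; apply/xmodel_le=> i j ij jr; rewrite cs.
apply: leq_trans (bb i j ij jr).
by apply: variations_thins_cons (thins_res _ _ (subseq_thins sub)).
Qed.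

Lemma aug_xpt (k : cell_index r) : aug_map R _ (xgen R r 0 (perm_seq k.2)) = 1.
Proof. exact/aug_xgen1/perm_seq_mem. Qed.

Definition xcomplex : carried_complex R (@cell_le r) (@cell_ok r) :=
  @CarriedComplex R (cell_index r) (@cell_le r) (@cell_ok r)
    (xbasis r) xdiff (aug_map R _) xmodel (fun k => xgen R r 0 (perm_seq k.2))
    xcone xdiff2 aug_xdiff aug_xpt xcone0 xconeS xmodel_ok xpt_cell
    xcone_cell xdiff_cell.

End SurjectionCells.

(** * The words of a table reduction *)

Section Compatibility.

Definition prec (w : seq nat) (a b : nat) : bool := (index a w <= index b w)%N.

(** The recursive criterion for z to occur in the table reduction of ws. A
    caesura ends its line, so the rest is read with the next permutation; the
    values which occur later are still available for the current line, so none
    of them may precede the current letter. *)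
Fixpoint compat (ws : seq (seq nat)) (z : seq nat) : bool :=
  if z is a :: z' then
    if ws is w :: ws' then
      all (prec w a) z' && compat (if a \in z' then ws' else ws) z'
    else false
  else size ws == 1%N.

Lemma compat_cons w ws a z :
  compat (w :: ws) (a :: z) =
    all (prec w a) z && compat (if a \in z then ws else w :: ws) z.
Proof. by []. Qed.

Lemma compat_nil z : compat [::] z = false.
Proof. by case: z. Qed.

Lemma prec_refl w a : prec w a a.
Proof. exact: leqnn. Qed.

Lemma prec_anti w a b : a \in w -> prec w a b -> prec w b a -> a = b.
Proof.
move=> aw ab ba; have: index a w = index b w by apply/eqP; rewrite eqn_leq; apply/andP.
move=> e; rewrite -(nth_index 0%N aw) e nth_index //.
by rewrite -index_mem -e index_mem.
Qed.

Lemma prec_total w a b : prec w a b || prec w b a.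
Proof. exact: leq_total. Qed.

Lemma prec_trans w : transitive (prec w).
Proof. by move=> b a c; apply: leq_trans. Qed.

(** The lines of a table arrangement end at the caesuras, so their sizes are
    determined by the word. *)
Fixpoint line_sizes (u : seq nat) : seq nat :=
  if u is a :: u' then
    if nilp u' then [:: 1%N]
    else if a \in u' then 1%N :: line_sizes u'
    else (head 0%N (line_sizes u')).+1 :: behead (line_sizes u')
  else [::].

Lemma line_sizes_pos u : u != [::] ->
  exists m s, line_sizes u = m.+1 :: s.
Proof.
elim: u => //= a [|b u] IHu _; first by exists 0%N, [::].
have [//|m [s e]] := IHu; case: ifP => _; first by exists 0%N, (line_sizes (b :: u)).
by exists (head 0 (line_sizes (b :: u)))%N, (behead (line_sizes (b :: u))).
Qed.

Variable r : nat.
Implicit Types (U w u : seq nat) (ws : seq (seq nat)) (rs : seq nat).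

Definition remaining U : nat := count (fun a => a \notin U) (iota 0 r).

Definition all_perm ws : bool := all (fun w => perm_eq w (iota 0 r)) ws.

Lemma eq_tr_word U U' ws rs : U =i U' -> tr_word U ws rs = tr_word U' ws rs.
Proof.
elim: ws rs U U' => [|w ws IHws] [|m rs] U U' UU' //=.
have -> : [seq a <- w | a \notin U] = [seq a <- w | a \notin U'].
  by apply: eq_filter => a; rewrite UU'.
by congr (_ ++ _); apply: IHws => a; rewrite !mem_cat UU'.
Qed.

Lemma mem_tr_word U ws rs a : all_perm ws ->
  a \in tr_word U ws rs -> (a \notin U) && (a < r)%N.
Proof.
elim: ws rs U => [|w ws IHws] [|m rs] U //= /andP[pw pws].
rewrite mem_cat => /orP[/mem_take|/(IHws _ _ pws)].
  by rewrite mem_filter (perm_mem pw) mem_iota.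
by rewrite mem_cat negb_or -andbA => /and3P[-> _ ->].
Qed.

Lemma size_tr_word U ws rs : (size (tr_word U ws rs) <= sumn rs)%N.
Proof.
elim: ws rs U => [|w ws IHws] [|m rs] U //=.
by rewrite size_cat leq_add ?IHws // size_take_min geq_minl.
Qed.

Lemma tr_word_line U w ws rs c s : [seq a <- w | a \notin U] = c :: s ->
  tr_word U (w :: ws) (1%N :: rs) = c :: tr_word U ws rs.
Proof. by move=> /= ->; rewrite /= take0 /= cats0. Qed.

Lemma candidates_step U w c s : uniq w ->
  [seq a <- w | a \notin U] = c :: s -> [seq a <- w | a \notin c :: U] = s.
Proof.
move=> uw e.
have := filter_uniq (fun a => a \notin U) uw; rewrite e => /andP[ncs _].
have -> : [seq a <- w | a \notin c :: U] = [seq a <- c :: s | a != c].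
  by rewrite -e -filter_predI; apply: eq_filter => a; rewrite /= inE negb_or.
rewrite /= eqxx; apply/all_filterP/allP=> a a_s.
by apply: contraNneq ncs => <-.
Qed.

Lemma tr_word_step U w ws m rs c s : uniq w ->
  [seq a <- w | a \notin U] = c :: s -> s != [::] ->
  tr_word U (w :: ws) (m.+2 :: rs) = c :: tr_word (c :: U) (w :: ws) (m.+1 :: rs).
Proof.
move=> uw e s0; have e' := candidates_step uw e.
rewrite /= e e' /=; congr (_ :: (_ ++ _)); apply: eq_tr_word => a.
by case: s s0 {e e'} => // b s _; rewrite /= !(mem_cat, inE) orbCA orbA.
Qed.

Lemma size_candidates U w : perm_eq w (iota 0 r) ->
  size [seq a <- w | a \notin U] = remaining U.
Proof. by move=> /seq.permP pw; rewrite size_filter pw. Qed.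

Lemma prec_filter (p : pred nat) w c s a :
  [seq b <- w | p b] = c :: s -> a \in c :: s -> prec w c a.
Proof.
elim: w => //= b w IHw; rewrite /prec /=.
case: ifP => [pb [<- _]|pb e a_s]; first by rewrite eqxx.
have [bc|_] := eqVneq b c.
  have : c \in filter p w by rewrite e mem_head.
  by rewrite mem_filter -bc pb.
have [ba|_] := eqVneq b a; last exact: IHw.
have : a \in filter p w by rewrite e.
by rewrite mem_filter -ba pb.
Qed.

(** A count of letters: the total length is large enough only if each line but
    the last ends with a value which is still needed later and if no value is
    skipped. Hence the lines are those of the table arrangement and each
    letter is the first available one in its permutation. *)
Lemma tr_word_inv ws rs U u : all_perm ws ->
  u = tr_word U ws rs -> size rs = size ws -> all (fun m => 0 < m)%N rs ->
  sumn rs = size u -> (size u).+1 = (remaining U + size ws)%N -> u != [::] ->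
  [/\ compat ws u, rs = line_sizes u
    & forall a, a \notin U -> (a < r)%N -> a \in u].
Proof.
elim: u ws rs U => // c u IHu [|w ws] [|[|m] rs] U // pws def_u [sz_rs] pos_rs.
move=> sum_rs sz_u _; have /andP[pw pws'] := pws.
have uw: uniq w by rewrite (perm_uniq pw) iota_uniq.
have sz_cand := size_candidates U pw.
have mem_u a : a \in c :: u -> (a \notin U) && (a < r)%N.
  by rewrite def_u; apply: mem_tr_word.
case e: [seq a <- w | a \notin U] => [|c' s].
  move: (congr1 size def_u) sum_rs; rewrite /= e /= => -> sum_rs.
  by have := size_tr_word (U ++ [::]) ws rs; lia.
have memP a : a \notin U -> (a < r)%N -> a \in c' :: s.
  by move=> aU ar; rewrite -e mem_filter aU (perm_mem pw) mem_iota.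
case: m def_u sum_rs pos_rs => [|m] def_u sum_rs pos_rs.
  move: def_u; rewrite (tr_word_line _ _ e) => -[cc def_u]; subst c'.
  case: ws pws' IHu sz_rs sz_u def_u {pws} => [|w' ws] pws' IHu sz_rs sz_u def_u.
    case: rs sz_rs def_u {sum_rs pos_rs} => // _ def_u; subst u; split=> // a aU ar.
    by have := memP a aU ar; move: sz_cand; rewrite e; case: (s) sz_u => //=; lia.
  have u0: u != [::].
    apply/eqP=> u0; move: sum_rs pos_rs sz_rs; rewrite u0 /=.
    by case: (rs) => // -[].
  have [] := IHu (w' :: ws) rs U pws' def_u => //.
  - by move: sum_rs => /= [].
  - by move: sz_u => /=; lia.
  move=> cu -> surj; have [cU cr] := andP (mem_u c (mem_head _ _)).
  have c_u := surj c cU cr.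
  split=> [||a aU ar]; last by rewrite inE surj ?orbT.
    rewrite compat_cons c_u cu andbT; apply/allP=> a a_u.
    have /andP[aU ar] := mem_u a (mem_behead (s := c :: u) a_u).
    by apply: prec_filter e _; apply: memP.
  by rewrite /= c_u; case: (u) u0.
have s0: s != [::].
  apply/eqP=> s0; move: def_u; rewrite /= e s0 /= => -[_ def_u].
  have := size_tr_word (U ++ [::]) ws rs; rewrite -def_u; move: sum_rs => /=; lia.
move: def_u; rewrite (tr_word_step _ _ _ uw e s0) => -[cc def_u]; subst c'.
have e' := candidates_step uw e.
have := size_candidates (c :: U) pw; rewrite e' => sz_s.
have u0: u != [::] by apply/eqP=> u0; move: sum_rs; rewrite u0 /=; lia.
have [] := IHu (w :: ws) (m.+1 :: rs) (c :: U) pws def_u => //.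
- by rewrite /= sz_rs.
- by move: sum_rs => /=; lia.
- by move: sz_u sz_cand; rewrite e /= sz_s; lia.
move=> cu ls surj.
have ncu: c \notin u.
  apply/negP; rewrite def_u => c_u.
  by have := @mem_tr_word (c :: U) (w :: ws) (m.+1 :: rs) c pws c_u; rewrite mem_head.
split=> [||a aU ar].
- rewrite compat_cons (negbTE ncu) cu andbT; apply/allP=> a a_u.
  have /andP[aU ar] := mem_u a (mem_behead (s := c :: u) a_u).
  by apply: prec_filter e _; apply: memP.
- by rewrite /= (negbTE ncu) -ls; case: (u) u0.
rewrite inE; case: eqP => //= /eqP ne_ac; apply: surj => //.
by rewrite inE negb_or ne_ac.
Qed.

(** By antisymmetry of the order of the current permutation, compatibility
    makes the first letter of u the first available value. *)
Lemma tr_word_line_sizes ws U u : all_perm ws ->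
  (forall a, (a \in u) = (a \notin U) && (a < r)%N) -> compat ws u -> u != [::] ->
  [/\ tr_word U ws (line_sizes u) = u, size (line_sizes u) = size ws,
      all (fun m => 0 < m)%N (line_sizes u) & sumn (line_sizes u) = size u].
Proof.
elim: u ws U => // a u IHu [|w ws] U // pws mem_u.
rewrite compat_cons => /andP[/allP prec_a cu] _; have /andP[pw pws'] := pws.
have uw: uniq w by rewrite (perm_uniq pw) iota_uniq.
have [c [s e]] : exists c s, [seq b <- w | b \notin U] = c :: s.
  have : a \in [seq b <- w | b \notin U].
    rewrite mem_filter (perm_mem pw) mem_iota /= add0n -mem_u mem_head //.
  by case: filter => // c s _; exists c, s.
have cE b : (b \in c :: s) = (b \in a :: u).
  by rewrite mem_u -e mem_filter (perm_mem pw) mem_iota.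
have ac: a = c.
  apply: (@prec_anti w); first by rewrite (perm_mem pw) mem_iota; move: (mem_u a); rewrite mem_head => /esym/andP[].
    have: c \in a :: u by rewrite -cE mem_head.
    by rewrite inE => /orP[/eqP ->|/prec_a //]; apply: prec_refl.
  by apply: prec_filter e _; rewrite cE mem_head.
subst c; have e' := candidates_step uw e.
have nas: a \notin s by rewrite -e' mem_filter mem_head.
case: (u =P [::]) => [u0|/eqP u0].
  have ws0: ws = [::].
    by move: cu; rewrite u0 /= eqSS size_eq0 => /eqP.
  have s0: s = [::].
    case: s {e e'} nas cE => // b s; rewrite inE negb_or => /andP[ne_ab _].
    move/(_ b); rewrite u0 !inE eqxx orbT eq_sym (negbTE ne_ab).
    by move/esym.
  by rewrite u0 ws0 -[line_sizes _]/[:: 1%N] (tr_word_line _ _ e).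
have /negbTE nil_u : ~~ nilp u by case: (u) u0.
have [au|nau] := boolP (a \in u).
  rewrite au in cu; rewrite /line_sizes -/line_sizes nil_u au.
  have [] := IHu ws U pws' _ cu u0.
    by move=> b; rewrite -mem_u inE; case: eqP => // ->.
  move=> tr_u sz pos sum; split=> //=; [|by rewrite sz|by rewrite sum add1n].
  by rewrite -[RHS]/(a :: u) -{2}tr_u -(tr_word_line _ _ e).
rewrite (negbTE nau) in cu.
have [] := IHu (w :: ws) (a :: U) pws _ cu u0.
  move=> b; rewrite inE negb_or -andbA -mem_u inE.
  by case: eqP => // ->; rewrite (negbTE nau).
rewrite /line_sizes -/line_sizes nil_u (negbTE nau).
have [m [l ->]] := line_sizes_pos u0 => tr_u sz pos sum.
split; rewrite -?[_ :: behead _]/(m.+2 :: l) //; last by rewrite /= -sum.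
  rewrite (tr_word_step _ _ _ uw e) ?tr_u //.
  case: s {e e' nas} cE => // /(_ (head 0%N u)); rewrite !inE.
  by case: u u0 nau {IHu tr_u sum cu prec_a mem_u nil_u} => // b u _ nau; rewrite mem_head orbT => /eqP e; rewrite -e mem_head in nau.
Qed.

(** When two consecutive permutations agree, the letter at the caesura between
    them and the next letter precede each other in the same order, hence are
    equal. *)
Lemma compat_degenerate ws u : all_perm ws -> all (fun a => a < r)%N u ->
  ~~ nondegenerate ws -> compat ws u -> ~~ nondegenerate u.
Proof.
elim: u ws => [|a u IHu] [|w ws] //; first by case: ws => // w' ws; rewrite /= eqSS.
move=> /andP[pw pws] /andP[ar ur] dg; rewrite compat_cons => /andP[/allP prec_a].
have dg_u: ~~ nondegenerate u -> ~~ nondegenerate (a :: u).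
  by apply: contra => /nondegenerate_behead.
case: ifP => [au|_] cu; last first.
  by apply/dg_u/(IHu (w :: ws)) => //=; rewrite pw.
have [ndg|dg'] := boolP (nondegenerate ws); last exact/dg_u/(IHu ws).
case: ws dg ndg pws cu => // w' ws; rewrite /= => dg ndg _ cu.
have ww': w = w' by apply/eqP; move: dg; rewrite ndg andbT negbK.
case: u au prec_a {IHu dg_u ur} cu => // b u au prec_a /andP[/allP prec_b _].
suff -> : a = b by rewrite /= eqxx.
have pa := prec_a b (mem_head _ _).
apply: (@prec_anti w) => //; first by rewrite (perm_mem pw) mem_iota.
move: au; rewrite inE => /orP[/eqP <-|/prec_b]; first exact: prec_refl.
by rewrite ww'.
Qed.

End Compatibility.

(** * The table reduction commutes with the differentials *)

Local Arguments compat : simpl never.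

Section WordSums.

Variable r : nat.

Fixpoint all_words (m : nat) : seq (seq nat) :=
  if m is m'.+1 then [seq a :: u | a <- iota 0 r, u <- all_words m']
  else [:: [::]].

Lemma mem_all_words m u :
  (u \in all_words m) = (size u == m) && all (fun a => a < r)%N u.
Proof.
elim: m u => [|m IHm] [|a u] //=.
  by apply/negbTE/negP=> /allpairsP[[b v] [_ _]].
rewrite eqSS andbCA -IHm; apply/allpairsP/idP => [[[b v] /= [b_r v_m [-> ->]]]|].
  by rewrite v_m andbT; move: b_r; rewrite mem_iota.
by case/andP=> ar um; exists (a, u); rewrite mem_iota.
Qed.

Lemma all_words_uniq m : uniq (all_words m).
Proof.
elim: m => //= m IHm; apply: allpairs_uniq => //; first exact: iota_uniq.
by move=> [a u] [b v] _ _ /= [-> ->].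
Qed.

Lemma big_all_wordsS (V : zmodType) m (F : seq nat -> V) :
  \sum_(u <- all_words m.+1) F u =
    \sum_(a <- iota 0 r) \sum_(u <- all_words m) F (a :: u).
Proof. by rewrite /= big_allpairs_dep. Qed.

Lemma sum_seq1 (T : eqType) (V : zmodType) (s : seq T) (x : T) (F : T -> V) :
  uniq s -> x \in s -> (forall y, y \in s -> y != x -> F y = 0) ->
  \sum_(y <- s) F y = F x.
Proof.
move=> us xs F0; rewrite (bigD1_seq x) //= big_seq_cond big1 ?addr0 //.
by move=> y /andP[]; apply: F0.
Qed.

Lemma sum_xbasis (V : zmodType) d (F : seq nat -> V) :
  (forall u, u \in all_words (r + d) -> ~~ xvalid r d u -> F u = 0) ->
  \sum_(b : xbasis r d) F (xseq b) = \sum_(u <- all_words (r + d)) F u.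
Proof.
move=> F0; rewrite [RHS](bigID (xvalid r d)) /= [X in _ + X]big1_seq ?addr0.
  2: by move=> u /andP[nv um]; apply: F0.
rewrite -[RHS]big_filter -[LHS](big_map (@xseq r d) predT F); apply: perm_big.
apply: uniq_perm; rewrite ?filter_uniq ?all_words_uniq //.
  rewrite map_inj_uniq; last exact: xseq_inj.
  exact: index_enum_uniq.
move=> u; rewrite mem_filter mem_all_words; apply/mapP/idP => [[b _ ->]|].
  by have bv := xseq_valid b; case/and4P: (bv) => -> -> _ _; rewrite bv.
by case/andP=> /xvalid_ex[b <-] _; exists b => //; rewrite mem_index_enum.
Qed.

End WordSums.

Local Arguments all_words : simpl never.

Section TRCoefficient.

Variables (R : comPzRingType) (r : nat).
Hypothesis r_gt0 : (0 < r)%N.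

Notation words := (map (@perm_seq r)).

Lemma all_perm_words t : all_perm r (words t).
Proof. by apply/allP=> _ /mapP[w _ ->]; apply: perm_seq_mem. Qed.

(** A word arises from one choice of line sizes at most, namely from its own,
    so that the coefficients are 0 or 1. *)
Lemma tr_genE d (t : ebasis r d) (b : xbasis r d) :
  tr_gen R t b = (compat (words (val (val t))) (xseq b))%:R.
Proof.
rewrite /tr_gen coef_sum; set ws := words _.
have pws: all_perm r ws by apply: all_perm_words.
have bv := xseq_valid b; have sz_b := size_xseq b.
have b0: xseq b != [::] by rewrite -size_eq0 sz_b -lt0n addn_gt0 r_gt0.
have sz_ws: size ws = d.+1 by rewrite size_map size_tuple.
have rem0: remaining r [::] = r.
  by rewrite /remaining (eq_count (a2 := predT)) // count_predT size_iota.
under eq_bigr => rs _ do rewrite xgenE.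
have [cb|ncb] := boolP (compat ws (xseq b)); last first.
  rewrite big1 // => rs /andP[pos sum]; case: eqP => // def_b.
  case/negP: ncb; have [] := tr_word_inv pws def_b => //.
  - by rewrite size_map size_tuple sz_ws.
  - by rewrite all_map.
  - by rewrite sz_b (eqP sum).
  - by rewrite sz_b rem0 sz_ws addnS.
have [|tr_b sz_rs pos sum] := @tr_word_line_sizes r ws [::] (xseq b) pws _ cb b0.
  by move=> a; rewrite (xvalid_mem _ bv).
have lt_rs: all (fun m => m < (r + d).+1)%N (line_sizes (xseq b)).
  apply/allP=> m m_rs; rewrite ltnS -sz_b -sum.
  by rewrite (perm_sumn (perm_to_rem m_rs)) /= leq_addr.
pose rs : seq 'I_(r + d).+1 := [seq inord m | m <- line_sizes (xseq b)].
have val_rs: map val rs = line_sizes (xseq b).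
  rewrite -map_comp -[RHS]map_id; apply/eq_in_map=> m m_rs /=.
  by rewrite inordK // (allP lt_rs).
have sz: size rs == d.+1 by rewrite size_map sz_rs sz_ws.
rewrite (bigD1 (Tuple sz)) /=; last by rewrite -all_map val_rs pos sum sz_b eqxx.
rewrite val_rs tr_b eqxx big1 ?addr0 // => rs' /andP[/andP[pos' sum'] ne_rs].
case: eqP => // def_b; case/eqP: ne_rs; apply/val_inj/(inj_map val_inj).
rewrite /= val_rs.
have [] := tr_word_inv pws def_b => //.
- by rewrite size_map size_tuple sz_ws.
- by rewrite all_map.
- by rewrite sz_b (eqP sum').
- by rewrite sz_b rem0 sz_ws addnS.
Qed.

(** For degenerate tuples both sides vanish, since the compatible words are
    degenerate too. *)
Lemma TR_egen d (t : seq 'S_r) (b : xbasis r d) : size t = d.+1 ->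
  TR R r d (egen R d t) b = (compat (words t) (xseq b))%:R.
Proof.
move=> sz_t; have [/evalid_ex[c <-]|] := boolP (evalid d t).
  by rewrite egen_basis /= lin_ext_basis tr_genE.
move=> nv; rewrite egen_invalid // linear0 coef0.
move: nv; rewrite /evalid sz_t eqxx /= => dg.
have bv := xseq_valid b.
suff /negbTE -> : ~~ compat (words t) (xseq b) by [].
apply/negP=> cb; case/and4P: (bv) => _ lt_b _ ndg.
have := compat_degenerate (all_perm_words t) lt_b _ cb.
rewrite ndg nondegenerate_map; last exact: perm_seq_inj.
by move/(_ dg).
Qed.

End TRCoefficient.

Section ChainMap.

Variables (R : comPzRingType) (r : nat).

Definition hit (v u : seq nat) : R := (v == u)%:R.

Lemma wdiff_hit0 v u : ~ (v =i u) -> wdiff (hit v) u = 0.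
Proof.
move=> ne_vu; apply: wdiff_eq0 => x xu _ _; rewrite /hit.
by case: eqP => // vx; case: ne_vu => a; rewrite vx xu.
Qed.

Lemma mul_wdiff_hit (x y : R) v u : (v =i u -> x = y) ->
  x * wdiff (hit v) u = y * wdiff (hit v) u.
Proof.
move=> xy; have [/andP[/allP vu /allP uv]|nuv] := boolP (all (mem u) v && all (mem v) u).
  by rewrite xy // => a; apply/idP/idP => [/vu|/uv].
rewrite wdiff_hit0 ?mulr0 // => e; case/negP: nuv; apply/andP.
by split; apply/allP=> a; rewrite /= e.
Qed.

Definition insertion (b : nat) (v u : seq nat) : R :=
  if count_mem b u == 1%N then hit v (rem b u) else 0.

Lemma insertion_head b v u : b \notin v -> insertion b v (b :: u) = (u == v)%:R.
Proof.
move=> nbv; rewrite /insertion /hit /= eqxx add1n eqSS [v == u]eq_sym.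
by case: (eqVneq u v) => [->|_]; [rewrite (count_memPn nbv) | case: ifP].
Qed.

Lemma insertion_tail b v u a c : a != b ->
  insertion b (c :: v) (a :: u) = (a == c)%:R * insertion b v u.
Proof.
move=> ne_ab; rewrite /insertion /hit /= (negbTE ne_ab) add0n.
case: ifP => _; last by rewrite mulr0.
by rewrite eqseq_cons [c == a]eq_sym; case: (a == c); rewrite ?mul1r ?mul0r.
Qed.

Lemma mul_insertion (x y : R) b v u :
  (b \in u -> rem b u = v -> x = y) -> insertion b v u * x = insertion b v u * y.
Proof.
move=> xy; rewrite /insertion /hit; case: eqP => [cnt1|]; last by rewrite !mul0r.
by case: eqP => [e|]; [rewrite xy // mem_count cnt1 | rewrite !mul0r].
Qed.

(** If v is compatible, there is one compatible position for the new letter b,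
    and otherwise none: it has to be inserted just before the first letter c
    of v which follows b in the order of the permutation that reads c, or else
    at the end. *)
Lemma sum_insertion ws b v : all_perm r ws -> (b < r)%N -> b \notin v ->
  all (fun a => a < r)%N v ->
  \sum_(u <- all_words r (size v).+1) insertion b v u * (compat ws u)%:R =
    (compat ws v)%:R.
Proof.
elim: v ws => [|c v IHv] ws pws br.
  move=> _ _; rewrite big_all_wordsS (@sum_seq1 _ _ _ b) ?iota_uniq ?mem_iota //.
    rewrite big_seq1 insertion_head // eqxx mul1r.
    by case: ws {pws}.
  move=> a _ ne_ab; rewrite big_seq1 /insertion /= (negbTE ne_ab) mul0r //.
move=> nbcv cvr; have := nbcv; rewrite inE negb_or => /andP[ne_bc nbv].
have /andP[cr vr] := cvr; have ne_cb: c != b by rewrite eq_sym.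
rewrite big_all_wordsS (bigD1_seq b) ?iota_uniq ?mem_iota //=.
rewrite (@sum_seq1 _ _ _ (c :: v)) ?all_words_uniq //; first last.
- by move=> u _ ne_u; rewrite insertion_head // (negbTE ne_u) mul0r.
- by rewrite mem_all_words /= eqxx cr.
rewrite insertion_head // eqxx mul1r -big_filter.
rewrite (bigD1_seq c) ?filter_uniq ?iota_uniq ?mem_filter ?ne_cb ?mem_iota //=.
rewrite [X in _ + (_ + X)]big1_seq ?addr0; last first.
  move=> a; rewrite mem_filter => /andP[ne_ac /andP[ne_ab _]].
  rewrite big1 // => u _.
  by rewrite insertion_tail // (negbTE ne_ac) !mul0r.
under eq_bigr => u _ do rewrite insertion_tail // eqxx mul1r.
case: ws pws => [|w ws] pws.
  by rewrite big1 ?addr0 // => u _; rewrite mulr0.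
have /andP[pw pws'] := pws.
set ws' := if c \in v then ws else w :: ws.
have pws1: all_perm r ws' by rewrite /ws'; case: ifP.
rewrite (eq_bigr (fun u => (all (prec w c) (b :: v))%:R *
                     (insertion b v u * (compat ws' u)%:R))) => [|u _]; last first.
  rewrite mulrCA -natrM mulnb; apply: mul_insertion => bu rem_u.
  have mem_u := mem_rem_cons bu; rewrite rem_u in mem_u.
  rewrite compat_cons -(eq_all_r mem_u) /ws'.
  by rewrite -mem_u inE (negbTE ne_cb).
rewrite -mulr_sumr IHv // -!natrM -natrD mulnb.
rewrite compat_cons (negbTE nbcv) /= [compat _ (c :: v)]compat_cons -/ws'.
congr (_%:R).
have [/allP cv|] := boolP (all (prec w c) v); last by rewrite !andbF.
case: (compat ws' v); rewrite ?andbF //= !andbT.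
have bw: b \in w by rewrite (perm_mem pw) mem_iota.
have := prec_total w b c; have := @prec_anti w b c bw.
case bc: (prec w b c); case cb: (prec w c b) => //.
  by move=> /(_ isT isT) e; rewrite e eqxx in ne_bc.
rewrite /= (_ : all _ _ = true) //; apply/allP=> a /cv; exact: prec_trans bc.
Qed.

Lemma tdiff_size (V : zmodType) (T : eqType) (g : seq T -> V) t :
  (forall s, size s != 1%N -> g s = 0) ->
  (forall s s', size s = size s' -> g s = g s') -> tdiff g t = 0.
Proof.
move=> g0 gE; case: t => [|w [|w' [|w'' t]]] //.
- by rewrite /= subr0 g0.
- by rewrite /= subr0 (gE [:: w'] [:: w]) // subrr.
apply: (@tdiff_ind _ _ (fun x => x = 0)) => // [x y -> ->|s [ss] _].
  by rewrite subr0.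
by rewrite g0 // ss.
Qed.

Lemma wdiff_hit_cons v b a u :
  wdiff (hit (b :: v)) (a :: u) =
    (if a \in u then hit (b :: v) u else 0) +
    (a == b)%:R * ((if a \in u then -1 else 1) * wdiff (hit v) u -
                   (if a \in u then insertion a v u else 0)).
Proof.
have hitE x : hit (b :: v) (a :: x) = (a == b)%:R * hit v x.
  by rewrite /hit eqseq_cons [b == a]eq_sym; case: (a == b); rewrite ?mul1r ?mul0r.
rewrite wdiff_cons.
have -> : wdiff (fun x => hit (b :: v) (a :: x)) u = (a == b)%:R * wdiff (hit v) u.
  case: (a =P b) hitE => [_|_] hitE; rewrite ?mul1r ?mul0r.
    by apply: eq_wdiff => x _ _ _; rewrite hitE mul1r.
  by apply: wdiff_eq0 => x _ _ _; rewrite hitE mul0r.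
rewrite hitE /insertion; case: ifP => _; last by rewrite add0r mul1r subr0.
rewrite mulN1r mulrDr mulrN mulrN addrA; congr (_ - _).
by case: ifP; rewrite ?mulr0.
Qed.

(** A non-empty word has exactly one letter which comes first in the order of
    w. *)
Lemma sum_first w v : perm_eq w (iota 0 r) -> all (fun a => a < r)%N v ->
  v != [::] ->
  \sum_(a <- iota 0 r) ((a \in v) && all (prec w a) v)%:R = 1 :> R.
Proof.
move=> pw vr v0.
have [a av a_min] : exists2 a, a \in v & all (prec w a) v.
  elim: v vr v0 => // a v IHv /andP[ar vr] _.
  have [-> |v0] := eqVneq v [::].
    by exists a; rewrite ?mem_head //= prec_refl.
  have [c cv /allP c_min] := IHv vr v0.
  case/orP: (prec_total w a c) => [ac|ca].
    exists a; rewrite ?mem_head //=; rewrite prec_refl.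
    by apply/allP=> e /c_min; apply: prec_trans.
  by exists c; rewrite ?inE ?cv ?orbT //= ca; apply/allP.
rewrite (@sum_seq1 _ _ _ a) ?iota_uniq ?mem_iota ?(allP vr) // ?av ?a_min //.
move=> c _ ne_ca; case: andP => // -[cv /allP c_min].
case/eqP: ne_ca; apply: (@prec_anti w); last exact: (allP a_min).
  by rewrite (perm_mem pw) mem_iota (allP vr).
exact: c_min.
Qed.

Lemma tdiff_mull (T : eqType) (x : R) (g : seq T -> R) t :
  tdiff (fun s => x * g s) t = x * tdiff g t.
Proof. by elim: t g => [|w t IHt] g /=; rewrite ?mulr0 // mulrBr IHt. Qed.

(** The commutation of TR with the differentials, coefficient by coefficient:
    both sides satisfy the same recursion on v. The words a :: b :: v, among
    which sum_first selects one, account for the face dropping the first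
    permutation. The words starting with b give the recursive term. If b does
    not occur in v, those in which it is inserted once more cancel, by
    sum_insertion, the face dropping the first permutation in the recursive
    term. *)
Lemma sum_compat_wdiff ws v : all_perm r ws -> all (fun a => a < r)%N v ->
  \sum_(u <- all_words r (size v).+1) (compat ws u)%:R * wdiff (hit v) u =
    tdiff (fun s => (compat s v)%:R : R) ws.
Proof.
elim: v ws => [|b v IHv] ws pws.
  move=> _; rewrite big_all_wordsS big1 => [|a _]; last by rewrite big_seq1 mulr0.
  by apply/esym/tdiff_size => [s|s s']; rewrite /compat; [move/negbTE-> | move->].
move=> bvr; have /andP[br vr] := bvr.
case: ws pws => [|w ws] pws.
  by rewrite big1 // => u _; rewrite compat_nil mul0r.
have /andP[pw pws'] := pws.
set sgn : R := if b \in v then -1 else 1.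
set ws1 := if b \in v then ws else w :: ws.
pose P : R := (all (prec w b) v)%:R.
have pws1: all_perm r ws1 by rewrite /ws1; case: ifP.
have -> : \sum_(u <- all_words r (size (b :: v)).+1)
    (compat (w :: ws) u)%:R * wdiff (hit (b :: v)) u =
  \sum_(a <- iota 0 r) \sum_(u <- all_words r (size v).+1)
     (compat (w :: ws) (a :: u))%:R * (if a \in u then hit (b :: v) u else 0) +
  \sum_(u <- all_words r (size v).+1)
     (compat (w :: ws) (b :: u))%:R *
        ((if b \in u then -1 else 1) * wdiff (hit v) u) -
  \sum_(u <- all_words r (size v).+1)
     (compat (w :: ws) (b :: u))%:R * (if b \in u then insertion b v u else 0).
  rewrite big_all_wordsS -addrA -sumrB.
  have F0 a : a \in iota 0 r -> a != b ->
    \sum_(u <- all_words r (size v).+1)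
      ((compat (w :: ws) (a :: u))%:R * ((a == b)%:R * ((if a \in u then -1 else 1)
         * wdiff (hit v) u - (if a \in u then insertion a v u else 0)))) = 0 :> R.
    by move=> _ /negbTE ->; rewrite big1 // => u _; rewrite mul0r mulr0.
  under eq_bigr => a _ do under eq_bigr => u _ do rewrite wdiff_hit_cons mulrDr.
  under eq_bigr => a _ do rewrite big_split /=.
  rewrite big_split; congr (_ + _).
  rewrite (sum_seq1 _ _ F0) ?iota_uniq ?mem_iota //.
  by apply: eq_bigr => u _; rewrite eqxx mul1r mulrBr.
have -> : \sum_(a <- iota 0 r) \sum_(u <- all_words r (size v).+1)
     (compat (w :: ws) (a :: u))%:R * (if a \in u then hit (b :: v) u else 0) =
   (compat ws (b :: v))%:R.
  rewrite -[RHS]mulr1 -[X in _ = _ * X](sum_first pw bvr) // mulr_sumr; apply: eq_bigr => a _.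
  rewrite (@sum_seq1 _ _ _ (b :: v)) ?all_words_uniq //; last first.
  - move=> u _ ne_u; rewrite /hit eq_sym (negbTE ne_u).
    by case: ifP; rewrite mulr0.
  - by rewrite mem_all_words /= eqxx br.
  rewrite /hit eqxx compat_cons; case: (a \in b :: v); last by rewrite !mulr0.
  by rewrite mulr1 -natrM mulnb andbC.
have -> : \sum_(u <- all_words r (size v).+1)
     (compat (w :: ws) (b :: u))%:R *
        ((if b \in u then -1 else 1) * wdiff (hit v) u) =
   P * sgn * tdiff (fun s => (compat s v)%:R : R) ws1.
  rewrite -IHv // mulr_sumr; apply: eq_bigr => u _.
  rewrite !mulrA; apply: mul_wdiff_hit => vu.
  rewrite compat_cons -(eq_all_r vu) -vu -/ws1 -/sgn -mulnb natrM.
  exact: mulrAC.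
have -> : \sum_(u <- all_words r (size v).+1)
     (compat (w :: ws) (b :: u))%:R * (if b \in u then insertion b v u else 0) =
   if b \in v then 0 else P * (compat ws v)%:R.
  have [bv|nbv] := boolP (b \in v).
    rewrite big1 // => u _; case: ifP; rewrite ?mulr0 // /insertion.
    case: eqP; rewrite ?mulr0 // => cnt1 bu; rewrite /hit; case: eqP; rewrite ?mulr0 //.
    by move=> vE; move: bv; rewrite vE mem_count count_mem_rem cnt1 eqxx.
  rewrite -(sum_insertion pws' br nbv vr) mulr_sumr; apply: eq_bigr => u _.
  rewrite compat_cons; case: ifP => bu; last first.
    by rewrite /insertion; move: bu; rewrite mem_count; case: count => // _; rewrite !(mul0r, mulr0).
  rewrite mulrC mulrCA; apply: mul_insertion => _ rem_u.
  rewrite -mulnb natrM; congr (_%:R * _).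
  by rewrite -(eq_all_r (mem_rem_cons bu)) /= prec_refl rem_u.
rewrite [RHS]/= -addrA; congr (_ + _).
have -> : tdiff (fun s => (compat (w :: s) (b :: v))%:R : R) ws =
    P * tdiff (fun s => (compat (if b \in v then s else w :: s) v)%:R) ws.
  rewrite -tdiff_mull; apply: eq_tdiff => s _ _.
  by rewrite compat_cons -mulnb natrM.
rewrite /sgn /ws1; case: (b \in v); first by rewrite subr0 mulrN1 mulNr.
by rewrite mulr1 [tdiff _ (w :: ws)]/= mulrBr addrAC subrr add0r.
Qed.

Hypothesis r_gt0 : (0 < r)%N.

Lemma coef_wdiff d (phi : seq nat -> xmod R r d) u b :
  wdiff phi u b = wdiff (fun x => phi x b : R) u.
Proof.
elim: u phi => [|a u IHu] phi; first by rewrite coef0.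
rewrite /= -(IHu (fun x => phi (a :: x))); case: ifP => // _.
by rewrite !(coefD, coefN); case: ifP => // _; rewrite coef0.
Qed.

Lemma coef_tdiff (T : eqType) d (phi : seq T -> xmod R r d) t b :
  tdiff phi t b = tdiff (fun s => phi s b : R) t.
Proof.
elim: t phi => [|w t IHt] phi; first by rewrite coef0.
by rewrite /= -(IHt (fun s => phi (w :: s))) coefD coefN.
Qed.

Lemma tdiff_map (T1 T2 : eqType) (V : zmodType) (f : T1 -> T2)
  (g : seq T2 -> V) t : tdiff g (map f t) = tdiff (fun s => g (map f s)) t.
Proof. by elim: t g => //= w t IHt g; rewrite IHt. Qed.

Lemma TR_diff d (x : emod R r d.+1) :
  TR R r d (ediff R r d x) = xdiff R r d (TR R r d.+1 x).
Proof.
apply: (@eq_linear _ _ _ (TR R r d \o ediff R r d) (xdiff R r d \o TR R r d.+1)) => t.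
rewrite -[LHS]/(TR R r d (ediff R r d (basis_elt R t))).
rewrite -[RHS]/(xdiff R r d (TR R r d.+1 (basis_elt R t))).
rewrite -egen_basis ediff_mapE ?size_tuple // raddf_tdiff.
apply/ffunP=> b; rewrite coef_tdiff.
have bv := xseq_valid b; case/and4P: (bv) => _ lt_b _ _.
set ws := map (@perm_seq r) (val (val t)).
have sz_t : size (val (val t)) = d.+2 by rewrite size_tuple.
transitivity (tdiff (fun s => (compat s (xseq b))%:R : R) ws).
  rewrite /ws tdiff_map; apply: eq_tdiff => s ss _.
  by rewrite TR_egen //; apply: eq_add_S; rewrite ss sz_t.
rewrite -sum_compat_wdiff ?all_perm_words // size_xseq.
rewrite -addnS -(@sum_xbasis r _ d.+1
                  (fun u => (compat ws u)%:R * wdiff (hit (xseq b)) u)).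
  rewrite lin_extE; apply: eq_bigr => c _; rewrite TR_egen //.
  congr (_ * _); rewrite xdiffE coef_wdiff; apply: eq_wdiff => u _ _ _.
  by rewrite xgenE.
move=> u; rewrite mem_all_words => /andP[sz_u lt_u].
rewrite /xvalid sz_u lt_u /= negb_and => /orP[nsurj|dg].
  rewrite wdiff_hit0 ?mulr0 // => bu; case/allP: nsurj => a.
  by rewrite mem_iota -bu (xvalid_mem _ bv).
rewrite wdiff_degenerate ?mulr0 // => y dg_y; rewrite /hit.
by case: eqP dg_y => // <-; case/and4P: bv => _ _ _ ->.
Qed.

End ChainMap.

(** * The table reduction preserves cells and homology *)

Section TRFiltration.

Variables (R : comPzRingType) (r : nat).
Hypothesis r_gt0 : (0 < r)%N.

Notation words := (map (@perm_seq r)).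

Lemma prec_ord w i j : i != j -> i \in w -> prec w i j = ord w i j.
Proof.
move=> ne_ij iw; rewrite /prec /ord leq_eqVlt orb_idl // => /eqP e.
case/eqP: ne_ij; apply: (@prec_anti w) => //; by rewrite /prec e.
Qed.

(** A change of the first remaining letter among i and j is matched by a
    change of order in the tuple, except for the last one, after which only
    one of the two values remains. *)
Lemma compat_variations w ws z i j : all_perm r (w :: ws) ->
  (i < r)%N -> (j < r)%N -> i != j -> compat (w :: ws) z ->
  (variations (ord w i j :: res i j z) <=
     (variations [seq ord v i j | v <- w :: ws]).+1)%N.
Proof.
move=> pws ir jr ne_ij; elim: z w ws pws => [|a z IHz] w ws pws //.
rewrite compat_cons => /andP[/allP prec_a cz]; have /andP[pw pws'] := pws.
have mem_w b : (b \in w) = (b < r)%N by rewrite (perm_mem pw) mem_iota.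
have IH: (variations (ord w i j :: res i j z) <=
     (variations [seq ord v i j | v <- w :: ws]).+1)%N.
  move: cz; case: ifP => _; last exact: IHz.
  case: ws pws' {pws} => [|w' ws] pws' cz; first by rewrite compat_nil in cz.
  rewrite /= variations_cons2 -addnS.
  by rewrite (leq_trans (variations_triangle _ (ord w' i j) _)) // leq_add2l IHz.
have one b s : all (pred1 b) s -> variations (b :: s) = 0%N.
  by elim: s => // c s IHs /andP[/eqP-> /IHs]; rewrite variations_cons2 eqxx.
rewrite res_cons; have [ai|ne_ai] := eqVneq a i => /=.
  have [jz|njz] := boolP (j \in z).
    have := prec_a j jz; rewrite ai prec_ord ?mem_w // => ordt.
    by rewrite ordt variations_consl -ordt.
  rewrite variations_cons2 one ?addn0; first by case: ord.
  apply/allP=> x /mapP[c]; rewrite mem_filter => /andP[cij cz'] ->{x}.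
  case/orP: cij => [/eqP ->|/eqP cj]; first by rewrite eqxx.
  by rewrite -cj cz' in njz.
have [aj|ne_aj] := eqVneq a j => //=.
have [iz|niz] := boolP (i \in z).
  have := prec_a i iz; rewrite aj prec_ord ?mem_w // 1?eq_sym // => ordt.
  have ordf: ord w i j = false.
    by apply/negbTE; rewrite /ord -leqNgt ltnW.
  by rewrite ordf variations_consl -ordf.
rewrite variations_cons2 one ?addn0; first by case: ord.
apply/allP=> x /mapP[c]; rewrite mem_filter => /andP[cij cz'] ->{x}.
rewrite /= eqbF_neg; apply: contra niz => /eqP <-.
by [].
Qed.

Lemma TR_carried d :
  @carried R (cell_index r) (@cell_le r) (@cell_ok r) (ecomplex R r) (xcomplex R r) d d
    (TR R r d).
Proof.
move=> t; apply/spannedP=> b /= nle.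
rewrite -egen_basis TR_egen ?size_tuple //.
suff /negbTE -> : ~~ compat (map (@perm_seq r) (val (val t))) (xseq b) by [].
apply: contra nle => cb; apply/xmodel_le=> i j ij jr.
rewrite -[X in (_ <= X)%N]/(variations (eres i j (val (val t)))).+1.
rewrite -[(emodel t).2]/(head 1%g (val (val t))).
have := size_tuple (val t) : size (val (val t)) = d.+1.
have := all_perm_words (val (val t)).
case: (val (val t)) cb => // w ws cb pws _.
have ne_ij : i != j by rewrite neq_ltn ij.
have -> : eres i j (w :: ws) = [seq ord v i j | v <- map (@perm_seq r) (w :: ws)].
  by rewrite -map_comp.
exact: compat_variations pws (ltn_trans ij jr) jr ne_ij cb.
Qed.

Lemma compat1_pairwise w z : uniq z -> compat [:: w] z = pairwise (prec w) z.
Proof.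
elim: z => // a z IHz /andP[naz uz].
by rewrite compat_cons (negbTE naz) IHz.
Qed.

Lemma pairwise_prec w : uniq w -> pairwise (prec w) w.
Proof.
suff H s1 s2 : uniq (s1 ++ s2) -> pairwise (prec (s1 ++ s2)) s2 by apply: (H [::]).
elim: s2 s1 => //= a s2 IHs s1 us; rewrite -cat_rcons IHs ?cat_rcons // andbT.
apply/allP=> b bs2; move: us; rewrite cat_uniq => /and3P[_ /hasPn ns _].
have ns1 c : c \in a :: s2 -> (c \in s1) = false by move/ns/negbTE.
rewrite /prec !index_cat !ns1 ?inE ?eqxx ?bs2 ?orbT //= eqxx addn0.
exact: leq_addr.
Qed.

Lemma compat1 w z : uniq w -> perm_eq z w -> compat [:: w] z = (z == w).
Proof.
move=> uw zw; rewrite compat1_pairwise; last by rewrite (perm_uniq zw).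
apply/idP/eqP => [pz|->]; last exact: pairwise_prec.
apply: (@sorted_eq_in _ (prec w)) => //.
- by move=> a b c _ _ _; apply: prec_trans.
- move=> a b az _ /andP[]; apply: prec_anti; by rewrite -(perm_mem zw).
- exact: pairwise_sorted.
- exact/pairwise_sorted/pairwise_prec.
Qed.

Lemma TR_degree0 (w : 'S_r) : TR R r 0 (egen R 0 [:: w]) = xgen R r 0 (perm_seq w).
Proof.
apply/ffunP=> b; rewrite TR_egen // xgenE; congr (_%:R); congr nat_of_bool.
have bv := xseq_valid b; apply: compat1; first exact: perm_seq_uniq.
apply: uniq_perm; [by rewrite uniq_xseq | exact: perm_seq_uniq | move=> a].
by rewrite (xvalid_mem _ bv) mem_perm_seq.
Qed.

Lemma TR_aug x : aug_map R _ (TR R r 0 x) = aug_map R _ x.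
Proof.
apply: (@eq_linear _ _ _ (aug_map R _ \o TR R r 0) (aug_map R _)) => t.
rewrite -[LHS]/(aug_map R _ (TR R r 0 (basis_elt R t))).
rewrite [RHS]lin_ext_basis -egen_basis.
have := size_tuple (val t) : size (val (val t)) = 1%N.
case: (val (val t)) => // w [|//] _; rewrite TR_degree0.
exact/aug_xgen1/perm_seq_mem.
Qed.

Lemma efiltE n d : (0 < n)%N ->
  @efilt_gen n r d =1 [pred b | [forall i : 'I_r, forall j : 'I_r,
                          (i < j)%N ==> ((emodel b).1 i j <= n)%N]].
Proof.
move=> n0 b; apply: eq_forallb => i; apply: eq_forallb => j; congr (_ ==> _).
rewrite -[in RHS](prednK n0) ltnS; congr (variations _ <= _)%N.
by apply: eq_map => w; rewrite /ord !index_perm_seq.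
Qed.

Lemma variations_xfilt d (b : xbasis r d) (i j : 'I_r) : i != j ->
  variations [seq a <- val (val b) | (a == i) || (a == j)] =
    variations (res i j (xseq b)).
Proof.
move=> ne_ij; rewrite /res /xseq filter_map -map_comp.
rewrite (eq_filter (a2 := fun a : 'I_r => (a == i) || (a == j))) //.
rewrite [RHS]variations_map // => a c; rewrite !mem_filter.
case/andP=> /orP[/eqP->|/eqP->] _ /andP[/orP[/eqP->|/eqP->] _] //=;
  by rewrite eqxx ?[val j == _]eq_sym (negbTE (ne_ij : val i != val j)).
Qed.

Lemma xfiltE n d :
  @xfilt_gen n r d =1 [pred b | [forall i : 'I_r, forall j : 'I_r,
                          (i < j)%N ==> ((xmodel b).1 i j <= n)%N]].
Proof.
move=> b; apply: eq_forallb => i; apply: eq_forallb => j.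
have [lt_ij|//] := boolP (i < j)%N; congr (_ ==> (_ <= _)%N).
by apply: variations_xfilt; rewrite neq_ltn lt_ij.
Qed.

Lemma eq_spanned (I : finType) (A B : pred I) (x : free_mod R I) :
  A =1 B -> spanned A x <-> spanned B x.
Proof. by move=> AB; split; apply: spannedS => i; rewrite AB. Qed.

Definition cell_filt n : pred (cell_index r) := fun k =>
  [forall i : 'I_r, forall j : 'I_r, (i < j)%N ==> (k.1 i j <= n)%N].

Lemma cell_filt_le n k l : cell_le k l -> cell_filt n l -> cell_filt n k.
Proof.
move=> /cell_leP kl /(@forall_ltP r (fun i j => l.1 i j <= n)%N) ln.
apply/(@forall_ltP r (fun i j => k.1 i j <= n)%N) => i j ij jr.
by rewrite (leq_trans _ (ln i j ij jr)) // (leq_trans _ (kl i j ij jr)) // leq_addr.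
Qed.

Lemma efilt_cell n d (x : emod R r d) : (0 < n)%N ->
  @efilt R n r d x <-> spanned [pred b : ebasis r d | cell_filt n (emodel b)] x.
Proof. by move=> n0; apply: eq_spanned; apply: efiltE. Qed.

Lemma xfilt_cell n d (x : xmod R r d) :
  @xfilt R n r d x <-> spanned [pred b : xbasis r d | cell_filt n (xmodel b)] x.
Proof. by apply: eq_spanned; apply: xfiltE. Qed.

Lemma TR_filt n d (x : emod R r d) : (0 < n)%N ->
  @efilt R n r d x -> @xfilt R n r d (TR R r d x).
Proof.
move=> n0 /(efilt_cell _ n0) ex; apply/xfilt_cell.
exact: (carried_filt (@cell_filt_le n) (@TR_carried d)).
Qed.

(** Both complexes are carried by the same cells, and the labels at most n are
    closed under passing to smaller models. *)
Lemma TR_homology n d : (0 < n)%N ->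
  homology_bijective (@efilt R n) (@xfilt R n) (TR R) r d.
Proof.
move=> n0.
have [inj surj] := carried_homology_bijective (@cell_le_trans r) (@cell_le_refl r)
  (@cell_filt_le n) TR_carried TR_aug (@TR_diff R r r_gt0) d.
have ecyc e (x : emod R r e) : @is_cycle _ (barratt_eccles R) (@efilt R n) r e x <->
    @cc_cycle _ _ _ _ (ecomplex R r) (cell_filt n) e x.
  case: e x => [|e] x; first exact: efilt_cell.
  by split=> -[/(efilt_cell _ n0)].
have xcyc e (x : xmod R r e) : @is_cycle _ (surjection_operad R) (@xfilt R n) r e x <->
    @cc_cycle _ _ _ _ (xcomplex R r) (cell_filt n) e x.
  case: e x => [|e] x; first exact: xfilt_cell.
  by split=> -[fx dx]; split=> //; apply/xfilt_cell.
split=> [x y /ecyc cx /ecyc cy [c [/xfilt_cell fc e]]|z /xcyc cz].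
  have [|c' [/(efilt_cell _ n0) fc' e']] := inj x y cx cy; first by exists c.
  by exists c'.
have [x cx [c [fc e]]] := surj z cz.
exists x; first exact/ecyc.
by exists c; split=> //; apply/xfilt_cell.
Qed.

End TRFiltration.

(** * Equivariance, units and stability of the filtrations *)

Section Action.

Variables (R : comPzRingType) (r : nat).

Notation words := (map (@perm_seq r)).

(** Words have entries in nat; extending sigma by the identity beyond r keeps
    the action injective. *)
Definition nact (sigma : 'S_r) (a : nat) : nat :=
  if (insub a : option 'I_r) is Some i then val (sigma i) else a.

Lemma nact_ord sigma (i : 'I_r) : nact sigma (val i) = val (sigma i).
Proof. by rewrite /nact valK. Qed.

Lemma nact_lt sigma a : (nact sigma a < r)%N = (a < r)%N.
Proof. by rewrite /nact; case: insubP => [i -> _|/negbTE //]; rewrite ltn_ord. Qed.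

Lemma nactK sigma : cancel (nact sigma) (nact sigma^-1%g).
Proof.
move=> a; case: (ltnP a r) => [ar|ra].
  by rewrite -[a]/(val (Ordinal ar)) !nact_ord permK.
have nactE s : nact s a = a by rewrite /nact insubN // -leqNgt.
by rewrite !nactE.
Qed.

Lemma nact_inj sigma : injective (nact sigma).
Proof. exact: can_inj (nactK sigma). Qed.

Lemma nactKV sigma : cancel (nact sigma^-1%g) (nact sigma).
Proof. by move=> a; rewrite -{1}[sigma]invgK nactK. Qed.

Lemma perm_seq_mul (w sigma : 'S_r) :
  perm_seq (w * sigma)%g = map (nact sigma) (perm_seq w).
Proof.
by rewrite /perm_seq -map_comp; apply: eq_map => i /=; rewrite permM -nact_ord.
Qed.

Lemma words_mul t sigma :
  words [seq (w * sigma)%g | w <- t] = map (map (nact sigma)) (words t).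
Proof. by rewrite -!map_comp; apply: eq_map => w; apply: perm_seq_mul. Qed.

Lemma xvalid_map sigma d u : xvalid r d (map (nact sigma) u) = xvalid r d u.
Proof.
rewrite /xvalid size_map nondegenerate_map; last exact: nact_inj.
rewrite all_map (eq_all (a2 := fun a => (a < r)%N)) => [|a]; last exact: nact_lt.
case: (size u == _) => //=; case: (all _ u) => //=; congr (_ && _).
apply/allP/allP => surj a; rewrite mem_iota /= add0n => ar.
  rewrite -(mem_map (@nact_inj sigma)); apply: surj.
  by rewrite mem_iota /= add0n nact_lt.
rewrite -[a](nactKV sigma) (mem_map (@nact_inj sigma)); apply: surj.
by rewrite mem_iota /= add0n nact_lt.
Qed.

Lemma compat_map (f : nat -> nat) ws z : injective f ->
  compat (map (map f) ws) (map f z) = compat ws z.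
Proof.
move=> f_inj; elim: z ws => [|a z IHz] [|w ws] //=.
  by rewrite /compat /= size_map.
rewrite !compat_cons mem_map // all_map; congr (_ && _).
  by apply: eq_all => b; rewrite /= /prec !index_map.
by rewrite -IHz; case: ifP.
Qed.

Lemma ord_map (f : nat -> nat) w i j : injective f ->
  ord (map f w) (f i) (f j) = ord w i j.
Proof. by move=> f_inj; rewrite /ord !index_map. Qed.

Lemma res_map (f : nat -> nat) u i j : injective f ->
  res (f i) (f j) (map f u) = res i j u.
Proof.
move=> f_inj; rewrite /res filter_map -map_comp.
rewrite (eq_filter (a2 := fun a => (a == i) || (a == j))) => [|a /=].
  by apply: eq_map => a /=; rewrite inj_eq.
by rewrite !(inj_eq f_inj).
Qed.

Lemma variations_resC i j u : i != j -> variations (res j i u) = variations (res i j u).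
Proof.
move=> ne_ij; rewrite -[RHS](@variations_map _ _ negb); last by move=> x y _ _; apply: negb_inj.
rewrite /res -map_comp (eq_filter (a2 := fun a => (a == i) || (a == j))); last by move=> a; rewrite orbC.
congr variations; apply/eq_in_map => a; rewrite mem_filter => /andP[aij _] /=.
by case/orP: aij => /eqP ->; rewrite eqxx ?[j == i]eq_sym (negbTE ne_ij).
Qed.

Lemma variations_eresC i j t : i != j -> (i < r)%N ->
  variations (@eres r j i t) = variations (eres i j t).
Proof.
move=> ne_ij ir; rewrite -[RHS](@variations_map _ _ negb); last by move=> x y _ _; apply: negb_inj.
rewrite /eres -map_comp; congr variations; apply: eq_map => w /=.
have iw : i \in perm_seq w by rewrite mem_perm_seq.
rewrite /ord -leqNgt [RHS]leq_eqVlt; case: eqVneq => //= e.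
by case/eqP: ne_ij; apply: (prec_anti iw); rewrite /prec e.
Qed.

Lemma efilt_genP n d (b : ebasis r d) : (0 < n)%N ->
  reflect (forall i j, (i < r)%N -> (j < r)%N -> i != j ->
             (variations (eres i j (val (val b))) < n)%N) (efilt_gen n b).
Proof.
move=> n0; rewrite efiltE //; apply: (iffP idP).
  move/(@forall_ltP r (fun i j => (emodel b).1 i j <= n)%N) => H i j ir jr ne_ij.
  case: (ltngtP i j) => [ij|ji|e]; first exact: H.
    by rewrite variations_eresC 1?eq_sym //; apply: H.
  by rewrite e eqxx in ne_ij.
move=> H; apply/(@forall_ltP r (fun i j => (emodel b).1 i j <= n)%N) => i j ij jr.
by apply: H; rewrite ?(ltn_trans ij) // neq_ltn ij.
Qed.

Lemma xfilt_genP n d (b : xbasis r d) :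
  reflect (forall i j, (i < r)%N -> (j < r)%N -> i != j ->
             (variations (res i j (xseq b)) <= n)%N) (xfilt_gen n b).
Proof.
rewrite xfiltE //; apply: (iffP idP).
  move/(@forall_ltP r (fun i j => (xmodel b).1 i j <= n)%N) => H i j ir jr ne_ij.
  case: (ltngtP i j) => [ij|ji|e]; first exact: H.
    by rewrite variations_resC 1?eq_sym //; apply: H.
  by rewrite e eqxx in ne_ij.
move=> H; apply/(@forall_ltP r (fun i j => (xmodel b).1 i j <= n)%N) => i j ij jr.
by apply: H; rewrite ?(ltn_trans ij) // neq_ltn ij.
Qed.

Lemma xact_genE d sigma (b : xbasis r d) :
  xact_gen R sigma b = xgen R r d (map (nact sigma) (xseq b)).
Proof.
rewrite /xact_gen /xseq -map_comp; congr xgen.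
by apply: eq_map => a /=; rewrite nact_ord.
Qed.

Lemma eact_egen d sigma (t : seq 'S_r) :
  lin_ext (@eact_gen R r d sigma) (egen R d t) = egen R d [seq (w * sigma)%g | w <- t].
Proof.
apply: (lin_ext_egen (F := fun t => egen R d [seq (w * sigma)%g | w <- t])) => // nv.
apply: egen_invalid; rewrite /evalid size_map nondegenerate_map //.
exact: mulIg.
Qed.

Lemma TR_act d sigma (x : emod R r d) : (0 < r)%N ->
  TR R r d (lin_ext (@eact_gen R r d sigma) x) =
    lin_ext (@xact_gen R r d sigma) (TR R r d x).
Proof.
move=> r_gt0.
apply: (@eq_linear _ _ _ (TR R r d \o lin_ext (@eact_gen R r d sigma))
                         (lin_ext (@xact_gen R r d sigma) \o TR R r d)) => t.
rewrite -[LHS]/(TR R r d (lin_ext (@eact_gen R r d sigma) (basis_elt R t))).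
rewrite -[RHS]/(lin_ext (@xact_gen R r d sigma) (TR R r d (basis_elt R t))).
rewrite -egen_basis eact_egen; apply/ffunP=> b.
rewrite TR_egen ?size_map ?size_tuple //.
have [c cb]: exists c : xbasis r d, xseq b = map (nact sigma) (xseq c).
  have [c cE] : exists c : xbasis r d, xseq c = map (nact sigma^-1%g) (xseq b).
    by apply: xvalid_ex; rewrite xvalid_map xseq_valid.
  by exists c; rewrite cE mapK //; apply: nactKV.
rewrite lin_extE (bigD1 c) //= TR_egen ?size_tuple // xact_genE xgenE cb eqxx mulr1.
rewrite big1 ?addr0 => [|c' ne_c'].
  by rewrite words_mul compat_map //; apply: nact_inj.
rewrite xact_genE xgenE cb (inj_eq (inj_map (@nact_inj sigma))).
by rewrite (inj_eq (@xseq_inj r d)) eq_sym (negbTE ne_c') mulr0.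
Qed.

Lemma efilt_act n d sigma (x : emod R r d) : (0 < n)%N ->
  @efilt R n r d x -> @efilt R n r d (lin_ext (@eact_gen R r d sigma) x).
Proof.
move=> n0 ex; apply: spanned_lin_ext ex _; first exact: spanned_closed.
move=> b /(efilt_genP _ n0) nb; apply: spanned_egen => c cb.
apply/(efilt_genP _ n0) => i j ir jr ne_ij; rewrite cb.
have -> : eres i j [seq (w * sigma)%g | w <- val (val b)] =
  eres (nact sigma^-1%g i) (nact sigma^-1%g j) (val (val b)).
  rewrite /eres -map_comp; apply: eq_map => w /=; rewrite perm_seq_mul.
  by rewrite -{1}[i](nactKV sigma) -{1}[j](nactKV sigma) ord_map //; apply: nact_inj.
by apply: nb; rewrite ?nact_lt // (inj_eq (@nact_inj _)).
Qed.

Lemma xfilt_act n d sigma (x : xmod R r d) :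
  @xfilt R n r d x -> @xfilt R n r d (lin_ext (@xact_gen R r d sigma) x).
Proof.
move=> ex; apply: spanned_lin_ext ex _; first exact: spanned_closed.
move=> b /xfilt_genP nb; rewrite xact_genE; apply: spanned_xgen => c cb.
apply/xfilt_genP => i j ir jr ne_ij; rewrite cb.
rewrite -[i](nactKV sigma) -[j](nactKV sigma) res_map; last exact: nact_inj.
by apply: nb; rewrite ?nact_lt // (inj_eq (@nact_inj _)).
Qed.

Lemma efilt_diff n d (x : emod R r d.+1) : (0 < n)%N ->
  @efilt R n r d.+1 x -> @efilt R n r d (ediff R r d x).
Proof.
move=> n0 /(efilt_cell _ n0) ex; apply/(efilt_cell _ n0).
exact: (@carried_filt _ _ _ _ (ecomplex R r) (ecomplex R r)
          _ _ (ediff R r d) _ _ (@cell_filt_le r n) (@ediff_cell R r d) ex).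
Qed.

Lemma xfilt_diff n d (x : xmod R r d.+1) :
  @xfilt R n r d.+1 x -> @xfilt R n r d (xdiff R r d x).
Proof.
move=> /xfilt_cell ex; apply/xfilt_cell.
exact: (@carried_filt _ _ _ _ (xcomplex R r) (xcomplex R r)
          _ _ (xdiff R r d) _ _ (@cell_filt_le r n) (@xdiff_cell R r d) ex).
Qed.

End Action.

Section Unit.

Variable R : comPzRingType.

Lemma perm_seq_S1 (w : 'S_1) : perm_seq w = [:: 0%N].
Proof.
have := perm_seq_mem w; move/perm_small_eq; exact.
Qed.

Lemma TR_unit : TR R 1 0 (egen R 0 [:: 1%g : 'S_1]) = xgen R 1 0 [:: 0%N].
Proof. by rewrite TR_degree0 // perm_seq_S1. Qed.

Lemma efilt_unit n : (0 < n)%N -> @efilt R n 1 0 (egen R 0 [:: 1%g : 'S_1]).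
Proof.
move=> n0; apply: spanned_egen => b _; apply/(efilt_genP _ n0) => i j.
by rewrite !ltnS !leqn0 => /eqP-> /eqP->.
Qed.

Lemma xfilt_unit n : @xfilt R n 1 0 (xgen R 1 0 [:: 0%N]).
Proof.
apply: spanned_xgen => b _; apply/xfilt_genP => i j.
by rewrite !ltnS !leqn0 => /eqP-> /eqP->.
Qed.

End Unit.

(** * Inverting a substitution *)

Local Close Scope ring_scope.

Section Blocks.

Variables (s k : nat).
Hypothesis s_gt0 : 0 < s.

(** The values of a composite at k which come from the second factor. *)
Definition block (a : nat) : bool := k <= a < k + s.
Definition collapse (a : nat) : nat :=
  if a < k then a else if a < k + s then k else a - s.-1.
Definition raise (a : nat) : nat := if k < a then a + s.-1 else a.

Lemma collapse_block a : block a -> collapse a = k.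
Proof. by rewrite /block /collapse => /andP[ka ->]; rewrite ltnNge ka. Qed.

Lemma collapse_eqk a : (collapse a == k) = block a.
Proof. rewrite /collapse /block; repeat (case: ltnP => ? /=); lia. Qed.

Lemma raiseK a : a != k -> collapse (raise a) = a.
Proof. rewrite /collapse /raise; case: (ltnP k a) => ?; repeat (case: ltnP => ? /=); lia. Qed.

Lemma collapseK a : ~~ block a -> raise (collapse a) = a.
Proof.
rewrite /block /collapse /raise; case: (ltnP a k) => ?;
  case: (ltnP a (k + s)) => ? /=; repeat (case: ltnP => ? /=); lia.
Qed.

Lemma block_raise a : a != k -> block (raise a) = false.
Proof. rewrite /block /raise; case: (ltnP k a) => ?; repeat (case: ltnP => ? /=); lia. Qed.

Lemma block_add b : b < s -> block (b + k).
Proof. rewrite /block; lia. Qed.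

Lemma sub_block a : block a -> a - k < s.
Proof. rewrite /block; lia. Qed.

Lemma sub_blockK a : block a -> a - k + k = a.
Proof. rewrite /block; lia. Qed.

Lemma collapse_inj a c : ~~ (block a && block c) -> collapse a = collapse c -> a = c.
Proof.
rewrite /block /collapse; repeat (case: ltnP => ? /=); lia.
Qed.

Lemma raise_lt r a : k < r -> a < r -> raise a < (r + s).-1.
Proof. rewrite /raise; case: ifP => _; lia. Qed.

Lemma block_lt r b : k < r -> b < s -> b + k < (r + s).-1.
Proof. lia. Qed.

Lemma collapse_lt r a : k < r -> a < (r + s).-1 -> collapse a < r.
Proof.
move=> kr ar; rewrite /collapse; case: (ltnP a k) => ?; first by lia.
case: (ltnP a (k + s)) => ?; lia.
Qed.

Lemma substitute_cons a u vs :
  substitute s k (a :: u) vs =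
    if a == k then [seq b + k | b <- head [::] vs] ++ substitute s k u (behead vs)
    else raise a :: substitute s k u vs.
Proof. by []. Qed.

Lemma substitute_notin u vs : k \notin u -> substitute s k u vs = map raise u.
Proof.
elim: u => //= a u IHu; rewrite inE negb_or eq_sym => /andP[/negbTE-> /IHu->].
by [].
Qed.

Definition compw (u v : seq nat) : seq nat := substitute s k u [:: v].

Lemma prec_cons c w a b :
  prec (c :: w) a b = (a == c) || ((b != c) && prec w a b).
Proof. by rewrite /prec /= ![_ == c]eq_sym; case: (c == a); case: (c == b). Qed.

Lemma eq_raise a c : c != k -> (a == raise c) = (collapse a == c).
Proof.
move=> ne_ck; apply/eqP/eqP => [->|ac]; first exact: raiseK.
by rewrite -ac collapseK // -collapse_eqk ac.
Qed.

(** Two values of the block compare as in v; otherwise the block behaves as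
    the single value k of u. *)
Lemma prec_compw u v a b : uniq u -> k \in u -> perm_eq v (iota 0 s) ->
  prec (compw u v) a b =
    if block a && block b then prec v (a - k) (b - k)
    else prec u (collapse a) (collapse b).
Proof.
move=> + + pv; elim: u => // c u IHu /andP[ncu uu]; rewrite inE /compw substitute_cons.
have mem_v e : (e \in v) = (e < s) by rewrite (perm_mem pv) mem_iota.
rewrite [c == k]eq_sym; have [kc _|ne_kc /= ku] := eqVneq k c; last first.
  have ne_ck : c != k by rewrite eq_sym.
  rewrite !prec_cons !eq_raise // IHu //; case: ifP => // /andP[ba bb].
  by rewrite !collapse_block // (negbTE ne_kc).
subst c; rewrite /= substitute_notin //.
have mem_blk e : (e \in [seq x + k | x <- v]) = block e.
  apply/mapP/idP => [[x xv ->]|be]; first by rewrite block_add -?mem_v.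
  by exists (e - k); rewrite ?mem_v ?sub_block ?sub_blockK.
have idx_blk e : block e -> index e [seq x + k | x <- v] = index (e - k) v.
  move=> be; rewrite -{1}(sub_blockK be).
  exact: (@index_map _ _ (fun x => x + k) (@addIn k)).
have idx_raise e : ~~ block e -> index e (map raise u) = index (collapse e) u.
  move=> nbe; elim: u ncu {IHu uu} => //= c u IHu.
  rewrite inE negb_or => /andP[ne_kc nku].
  by rewrite [raise c == e]eq_sym eq_raise 1?eq_sym // IHu.
rewrite prec_cons !collapse_eqk /prec !index_cat !mem_blk.
have szv : size [seq x + k | x <- v] = size v by rewrite size_map.
case ba: (block a); case bb: (block b) => /=.
- by rewrite !idx_blk.
- rewrite idx_blk // szv; apply: ltnW; apply: ltn_addr.
  by rewrite index_mem mem_v sub_block.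
- rewrite szv idx_blk //; apply/negbTE; rewrite -ltnNge; apply: ltn_addr.
  by rewrite index_mem mem_v sub_block.
- by rewrite !idx_raise ?ba ?bb // leq_add2l.
Qed.

Definition block_head (z : seq nat) : bool := if z is a :: _ then block a else false.

(** The inverse of the substitution at k into words without equal neighbours:
    the maximal runs of block values are the substituted words, and
    contracting each of them to k leaves the skeleton. *)
Fixpoint unsubst (z : seq nat) : seq nat * seq (seq nat) :=
  if z is a :: z' then
    let: (x, vs) := unsubst z' in
    if block a then
      if block_head z' then (x, (a - k :: head [::] vs) :: behead vs)
      else (k :: x, [:: a - k] :: vs)
    else (collapse a :: x, vs)
  else ([::], [::]).

Notation skel z := (unsubst z).1.
Notation runs z := (unsubst z).2.

Lemma unsubst_cons a z :
  unsubst (a :: z) =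
    if block a then
      if block_head z then (skel z, (a - k :: head [::] (runs z)) :: behead (runs z))
      else (k :: skel z, [:: a - k] :: runs z)
    else (collapse a :: skel z, runs z).
Proof. by rewrite /=; case: unsubst. Qed.

Lemma block_head_unsubst z : block_head z ->
  exists x v vs, unsubst z = (k :: x, v :: vs).
Proof.
elim: z => // a z IHz; rewrite unsubst_cons /= => ba; rewrite ba.
case: ifP => [/IHz[x [v [vs ->]]]|_].
  by exists x, (a - k :: v), vs.
by exists (skel z), [:: a - k], (runs z).
Qed.

Lemma runs_prop z :
  all (fun v => (v != [::]) && all (fun b => b < s) v) (runs z).
Proof.
elim: z => // a z IHz; rewrite unsubst_cons; case: ifP => // ba.
case: ifP => [/block_head_unsubst[x [v [vs E]]]|_] /=; last by rewrite sub_block.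
by move: IHz; rewrite E /= sub_block //= => /andP[/andP[_ ->]].
Qed.

Lemma size_runs z : size (runs z) = count_mem k (skel z).
Proof.
elim: z => // a z IHz; rewrite unsubst_cons; case: ifP => [ba|nba].
  case: ifP => [/block_head_unsubst[x [v [vs E]]]|_] /=; last by rewrite eqxx IHz.
  by rewrite -IHz E.
by rewrite /= collapse_eqk nba IHz.
Qed.

Lemma runs_nil z : (runs z == [::]) = (k \notin skel z).
Proof. by rewrite -size_eq0 size_runs mem_count -eqn0Ngt. Qed.

Lemma unsubstK z : substitute s k (skel z) (runs z) = z.
Proof.
elim: z => // a z IHz; rewrite unsubst_cons; case: ifP => ba.
  case: ifP => [bz|_]; last by rewrite /= eqxx /= sub_blockK // IHz.
  have [x [v [vs E]]] := block_head_unsubst bz.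
  by move: IHz; rewrite E /= eqxx /= sub_blockK // => ->.
have ca : (collapse a == k) = false by rewrite collapse_eqk.
by rewrite [(_, _).1]/= substitute_cons ca collapseK ?ba // IHz.
Qed.

Lemma substK x vs : nondegenerate x -> size vs = count_mem k x ->
  all (fun v => (v != [::]) && all (fun b => b < s) v) vs ->
  unsubst (substitute s k x vs) = (x, vs).
Proof.
elim: x vs => [|a x IHx] vs ndg; first by case: vs.
have ndg_x : nondegenerate x by apply: nondegenerate_behead ndg.
rewrite substitute_cons /=; case: eqP => [ak|/eqP nak]; last first.
  by rewrite add0n => sz /(IHx _ ndg_x sz) E; rewrite unsubst_cons E block_raise //= raiseK.
case: vs => // v vs [sz] /= /andP[/andP[v0 lt_v] vs_ok]; have E := IHx _ ndg_x sz vs_ok.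
have nbh : block_head (substitute s k x vs) = false.
  case: x ndg {IHx ndg_x sz E} => //= c x; rewrite ak => /andP[nkc _].
  by rewrite eq_sym (negbTE nkc) /= block_raise // eq_sym.
elim: v v0 lt_v => // b v IHv _ /andP[bs lt_v]; rewrite map_cons cat_cons unsubst_cons.
rewrite block_add //; have [v0|v0] := eqVneq v [::].
  by rewrite v0 /= nbh E /= addnK ak.
rewrite IHv //= addnK; case: v v0 lt_v {IHv} => //= c v _ /andP[cs _].
by rewrite block_add.
Qed.

Lemma mem_skel z : skel z =i map collapse z.
Proof.
elim: z => // a z IHz b; rewrite unsubst_cons.
case: ifP => [ba|_]; last by rewrite /= !inE IHz.
rewrite /= inE collapse_block //.
case: ifP => [/block_head_unsubst[x [v [vs E]]]|_] /=; last by rewrite inE IHz.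
by rewrite -IHz E inE orbA orbb.
Qed.

Lemma flatten_runs z : flatten (runs z) = [seq a - k | a <- z & block a].
Proof.
elim: z => // a z IHz; rewrite unsubst_cons /=.
case: ifP => [ba|_] //=.
case: ifP => [/block_head_unsubst[x [v [vs E]]]|_] /=; last by rewrite IHz.
by rewrite -IHz E.
Qed.

Lemma mem_nonblock a z : ~~ block a -> (a \in z) = (collapse a \in skel z).
Proof.
move=> nba; rewrite mem_skel; apply/idP/mapP => [az|[c cz e]]; first by exists a.
by rewrite (collapse_inj _ e) // (negbTE nba).
Qed.

Lemma mem_block a z : block a -> (a \in z) = (a - k \in flatten (runs z)).
Proof.
move=> ba; rewrite flatten_runs; apply/idP/mapP => [az|[c]].
  by exists a; rewrite ?mem_filter ?ba.
by rewrite mem_filter => /andP[bc cz] e; rewrite -(sub_blockK ba) e sub_blockK.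
Qed.

(** Consecutive segments of a composition of surjections share an end point;
    gluing along these end points recovers the word which was cut. *)
Fixpoint glue (vs : seq (seq nat)) : seq nat :=
  if vs is v :: vs' then v ++ behead (glue vs') else [::].

Fixpoint linked (vs : seq (seq nat)) : bool :=
  if vs is v :: vs' then
    nilp vs' || ((last 0 v == head 0 (glue vs')) && linked vs')
  else true.

Lemma glue_nil z : (glue (runs z) == [::]) = (runs z == [::]).
Proof.
have := runs_prop z; case: (runs z) => // v vs /= /andP[/andP[v0 _] _].
by case: v v0.
Qed.

Lemma mem_glue vs : all (fun v => v != [::]) vs -> linked vs -> glue vs =i flatten vs.
Proof.
elim: vs => // v vs IHvs /= /andP[v0 vs0] /orP[/nilP->|/andP[/eqP lv lvs]] b.
  by rewrite /= !cats0.
rewrite !mem_cat -IHvs //; case: (glue vs) lv => //= c g lv.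
rewrite inE; case: eqP => //= ->; rewrite -lv orbT.
by case: v v0 {lv} => //= e v _; rewrite mem_last.
Qed.

Lemma mem_glue_runs z : linked (runs z) -> glue (runs z) =i flatten (runs z).
Proof. by apply: mem_glue; apply: sub_all (runs_prop z) => v /andP[]. Qed.

(** The step which a compatible path must take at each caesura of z: the
    second tuple moves between two neighbours in a run, the first one
    elsewhere. *)
Fixpoint forced_path (z : seq nat) : seq bool :=
  if z is a :: z' then
    if a \in z' then ~~ (block a && block_head z') :: forced_path z'
    else forced_path z'
  else [::].

Fixpoint path_tuple (us vs : seq (seq nat)) (p : seq bool) : seq (seq nat) :=
  if us is u :: us' then
    if vs is v :: vs' then
      match p with
      | [::] => if nilp us' && nilp vs' then [:: compw u v] else [::]
      | b :: p' => compw u v ::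
                     (if b then path_tuple us' vs p' else path_tuple us vs' p')
      end
    else [::]
  else [::].

Lemma path_tuple0l vs p : path_tuple [::] vs p = [::].
Proof. by case: p. Qed.

Lemma path_tuple0r us p : path_tuple us [::] p = [::].
Proof. by case: us; case: p. Qed.

(** Without any run nothing is read from vs, which then must not move at
    all. *)
Definition compat_runs vs (gs : seq (seq nat)) : bool :=
  if nilp gs then size vs == 1 else compat vs (glue gs).

Variable r : nat.
Hypothesis k_lt : k < r.

(** By induction on z. By prec_compw the conditions on a letter of z are
    conditions on the skeleton and on the runs. At the end of a run followed
    by another one there is one condition more. Its last value must be needed
    again, as otherwise the first tuple would not move and would put k both
    before and after the next letter of the skeleton. As the second tuple does
    not move before the next run, this value is then both before and after the
    first value of the next run, so the two agree. *)
Lemma compat_path us vs z : all_perm r us -> all_perm s vs ->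
  all (fun a => a < (r + s).-1) z ->
  compat (path_tuple us vs (forced_path z)) z =
    [&& linked (runs z), compat us (skel z) & compat_runs vs (runs z)].
Proof.
elim: z us vs => [|a z IHz] [|u us] [|v vs] pus pvs.
- by [].
- by [].
- by rewrite /compat /= /compat_runs /= andbF.
- by case: us {pus}; case: vs {pvs}.
- by move=> _; rewrite ?path_tuple0l ?path_tuple0r !compat_nil andbF.
- by move=> _; rewrite ?path_tuple0l ?path_tuple0r !compat_nil andbF.
- by move=> _; rewrite path_tuple0r compat_nil /compat_runs compat_nil if_same !andbF.
case/andP=> ar zr; have /andP[pu pus'] := pus; have /andP[pv pvs'] := pvs.
have uu : uniq u by rewrite (perm_uniq pu) iota_uniq.
have mem_u b : (b \in u) = (b < r) by rewrite (perm_mem pu) mem_iota.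
have ku : k \in u by rewrite mem_u.
have mem_v b : (b \in v) = (b < s) by rewrite (perm_mem pv) mem_iota.
pose st := ~~ (block a && block_head z).
have -> : compat (path_tuple (u :: us) (v :: vs) (forced_path (a :: z))) (a :: z) =
   all (prec (compw u v) a) z &&
   compat (if a \in z then
             if st then path_tuple us (v :: vs) (forced_path z)
             else path_tuple (u :: us) vs (forced_path z)
           else path_tuple (u :: us) (v :: vs) (forced_path z)) z.
  rewrite [forced_path (a :: z)]/= -/st; case: ifP => az.
    by rewrite [path_tuple _ _ _]/= compat_cons az; case: st.
  case: (forced_path z) => [|b p]; rewrite [path_tuple _ _ _]/=.
    by case: ifP => _; rewrite ?compat_nil ?andbF // compat_cons az.
  by rewrite compat_cons az.
have precE b : prec (compw u v) a b =
    if block a && block b then prec v (a - k) (b - k)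
    else prec u (collapse a) (collapse b) by apply: prec_compw.
pose us1 := if (a \in z) && st then us else u :: us.
pose vs1 := if (a \in z) && ~~ st then vs else v :: vs.
have -> : (if a \in z then
             if st then path_tuple us (v :: vs) (forced_path z)
             else path_tuple (u :: us) vs (forced_path z)
           else path_tuple (u :: us) (v :: vs) (forced_path z)) =
          path_tuple us1 vs1 (forced_path z).
  by rewrite /us1 /vs1; case: (a \in z); case: (st).
rewrite IHz //; first last.
- by rewrite /vs1; case: ifP.
- by rewrite /us1; case: ifP.
rewrite unsubst_cons.
have prec_blk : block a -> all (prec (compw u v) a) z =
    all (prec v (a - k)) (flatten (runs z)) && all (prec u k) (skel z).
  move=> ba; rewrite flatten_runs (eq_all_r (mem_skel z)) !all_map.
  rewrite all_filter -all_predI; apply: eq_all => b /=.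
  rewrite precE ba (collapse_block ba) /=; case bb: (block b) => //=.
  by rewrite (collapse_block bb) prec_refl andbT.
case: ifP => [ba|nba]; last first.
  have stT: st by rewrite /st nba.
  have -> : all (prec (compw u v) a) z = all (prec u (collapse a)) (skel z).
    rewrite (eq_all_r (mem_skel z)) all_map; apply: eq_all => b /=.
    by rewrite precE nba.
  rewrite /us1 /vs1 stT andbT andbF /= compat_cons mem_nonblock ?nba //.
  by rewrite andbCA !andbA.
have a_runs := mem_block z ba.
case: ifP => [bz|nbz]; last first.
  (* [a] ends a run. *)
  have stT: st by rewrite /st nbz andbF.
  rewrite prec_blk // /us1 /vs1 stT andbT andbF /= compat_cons.
  have [runs0|runs0] := eqVneq (runs z) [::].
    have nkx: k \notin skel z by rewrite -runs_nil runs0.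
    rewrite a_runs runs0 (negbTE nkx) /compat_runs /= andbA.
    by case: (vs).
  have kx: k \in skel z by rewrite -[k \in _]negbK -runs_nil.
  have nr0 : nilp (runs z) = false by case: (runs z) runs0.
  rewrite kx /compat_runs nr0 /=.
  have glue0: glue (runs z) != [::] by rewrite glue_nil.
  have [lz|] := boolP (linked (runs z)); last by rewrite !andbF.
  case Eg: (glue (runs z)) glue0 => [|h g] // _ /=.
  have mem_g := mem_glue_runs lz; rewrite -(eq_all_r mem_g) a_runs -mem_g Eg.
  have [->|ne_h] := eqVneq (a - k) h.
    rewrite mem_head /=; case: (all (prec u k) _); rewrite ?andbF //=.
    rewrite prec_refl compat_cons; case: (all (prec v h) g) => //=.
    by rewrite !andbF.
  (* Both orders of [a - k] and [h] would hold in [v]. *)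
  apply/negbTE/negP; case: ifP => [ah|nah].
    case/andP=> /andP[/allP prec_a _] /andP[_].
    rewrite compat_cons => /andP[/allP prec_h _]; case/eqP: ne_h.
    apply: (@prec_anti v); rewrite ?mem_v ?sub_block ?prec_a ?mem_head //.
    by move: ah; rewrite inE => /orP[/eqP->|/prec_h]; rewrite ?prec_refl.
  (* Both orders of [k] and the next letter of the skeleton would hold in [u]. *)
  case/andP=> /andP[_ /allP prec_k] /andP[cx _].
  have [c [x [xE ne_c]]] : exists c x, skel z = c :: x /\ c != k.
    case: (z) nbz kx => // c z' /= nbc _; rewrite -/(unsubst (c :: z')).
    rewrite unsubst_cons nbc; exists (collapse c), (skel z').
    by rewrite collapse_eqk nbc.
  rewrite xE inE eq_sym (negbTE ne_c) /= in kx cx prec_k.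
  move: cx; rewrite compat_cons => /andP[/allP prec_c _].
  have := prec_anti ku (prec_k _ (mem_head _ _)) (prec_c _ kx).
  by move/esym/eqP; rewrite (negbTE ne_c).
(* [a] continues in a run. *)
have stF: st = false by rewrite /st ba bz.
have [x [gv [gs E]]] := block_head_unsubst bz.
have := runs_prop z; rewrite E /= => /andP[/andP[gv0 _] _].
have last_gv e : last e gv = last 0 gv by case: (gv) gv0.
rewrite prec_blk // /us1 /vs1 stF andbT andbF /= last_gv.
rewrite E /=.
have -> : (nilp gs || (last 0 gv == head 0 (glue gs)) && linked gs) = linked (runs z).
  by rewrite E.
have [lz|] := boolP (linked (runs z)); last by rewrite !andbF.
have mem_g := mem_glue_runs lz; rewrite E /= in mem_g.
rewrite -(eq_all_r mem_g) a_runs E /= -mem_g /compat_runs /=.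
rewrite [compat (v :: vs) _]compat_cons compat_cons prec_refl.
by case: (all (prec u k) x); rewrite ?andbF ?andbT //= andbCA.
Qed.

End Blocks.

(** * The forced lattice path and its sign *)

Section Caesuras.

Fixpoint caesuras (u : seq nat) : nat :=
  if u is a :: u' then (a \in u') + caesuras u' else 0.

Lemma compat_caesuras ws z : compat ws z -> size ws = (caesuras z).+1.
Proof.
elim: z ws => [|a z IHz] [|w ws] //; first by move/eqP.
rewrite compat_cons => /andP[_]; rewrite /=; case: ifP => _ /IHz.
  by rewrite add1n => ->.
by rewrite add0n.
Qed.

Lemma size_caesuras u : size u = size (undup u) + caesuras u.
Proof.
elim: u => //= a u ->; case: (a \in u) => /=; lia.
Qed.

Lemma caesuras_cat s t : caesuras t <= caesuras (s ++ t).
Proof. by elim: s => //= a s IHs; rewrite (leq_trans IHs) // leq_addl. Qed.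

End Caesuras.

Section ForcedPath.

Variables (s k r : nat).
Hypotheses (s_gt0 : 0 < s) (k_lt : k < r).

Notation skel z := (unsubst s k z).1.
Notation runs z := (unsubst s k z).2.
Notation block := (block s k).
Notation block_head := (block_head s k).
Notation collapse := (collapse s k).
Notation compw := (compw s k).

(** Let a be a caesura followed by e. If the wrong tuple moves, the relative
    order of a and e is the same before and after the step; it puts a before e
    at the caesura, and e before a afterwards because a occurs again, so a and
    e are equal neighbours. *)
Lemma forced_path_unique us vs p z : all_perm r us -> all_perm s vs ->
  all (fun a => a < (r + s).-1) z -> nondegenerate z ->
  size us = (count id p).+1 -> size vs = (count negb p).+1 ->
  compat (path_tuple s k us vs p) z -> p = forced_path s k z.
Proof.
have size_pt q us' vs' : size us' = (count id q).+1 -> size vs' = (count negb q).+1 ->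
    size (path_tuple s k us' vs' q) = (size q).+1.
  elim: q us' vs' => [|[] q IHq] [|u us'] [|v vs'] //=.
  - by case=> /size0nil -> [/size0nil ->].
  - by rewrite add1n add0n => -[su] sv; rewrite IHq.
  - by rewrite add1n add0n => su [sv]; rewrite IHq.
have head_pt u' us' v' vs' q e y a : a \in y ->
    compat (path_tuple s k (u' :: us') (v' :: vs') q) (e :: y) -> prec (compw u' v') e a.
  move=> ay; case: q => [|b q]; rewrite [path_tuple _ _ _ _ _]/=.
    by case: ifP; rewrite ?compat_nil // compat_cons => _ /andP[/allP/(_ a ay)].
  by rewrite compat_cons => /andP[/allP/(_ a ay)].
elim: z us vs p => [|a z IHz] us vs p pus pvs.
  move=> _ _ su sv; rewrite /compat size_pt //.
  by case: p {su sv}.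
case/andP=> ar zr ndg su sv; have ndg_z := nondegenerate_behead ndg.
case: us pus su => // u us pus su; case: vs pvs sv => // v vs pvs sv.
have /andP[pu pus'] := pus; have /andP[pv pvs'] := pvs.
have uu : uniq u by rewrite (perm_uniq pu) iota_uniq.
have mem_u b : (b \in u) = (b < r) by rewrite (perm_mem pu) mem_iota.
have ku : k \in u by rewrite mem_u.
have mem_v b : (b \in v) = (b < s) by rewrite (perm_mem pv) mem_iota.
case: p su sv => [|b p] su sv.
  rewrite /= in su sv; move: su sv => [/size0nil us0] [/size0nil vs0].
  rewrite us0 vs0 /= compat_cons => /andP[_]; case: ifP => [_|az c].
    by rewrite compat_nil.
  by apply: (IHz [:: u] [:: v] [::]); rewrite ?us0 ?vs0 //= ?pu ?pv.
rewrite [path_tuple _ _ _ _ _]/= compat_cons => /andP[/allP prec_a].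
have [az|naz] := boolP (a \in z); last first.
  move=> c; rewrite /= (negbTE naz).
  by apply: (IHz (u :: us) (v :: vs) (b :: p)).
move=> c; rewrite /= az.
have -> : b = ~~ (block a && block_head z).
  case: z az zr ndg prec_a c {IHz ndg_z} => // e z az /andP[er zr].
  rewrite nondegenerate_cons => /andP[ne_ae _] prec_a c.
  have az' : a \in z by move: az; rewrite inE (negbTE ne_ae).
  have pe := prec_a e (mem_head _ _).
  have ca : collapse a < r by apply: collapse_lt.
  have ne : a <> e by apply/eqP.
  rewrite /=; case: b su sv c => su sv c.
    case: us pus pus' su c => [|u' us] pus pus' su c.
      by rewrite path_tuple0l compat_nil in c.
    apply/esym/negP => /andP[ba be]; case: ne.
    have /andP[pu' _] := pus'.
    have := head_pt _ _ _ _ _ _ _ _ az' c.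
    rewrite prec_compw ?be ?ba ?(perm_uniq pu') ?iota_uniq // ?(perm_mem pu') ?mem_iota //.
    move: pe; rewrite prec_compw ?be ?ba // => pe pe'.
    rewrite -(sub_blockK s_gt0 ba) -(sub_blockK s_gt0 be) (prec_anti _ pe pe') //.
    by rewrite mem_v sub_block.
  case: vs pvs pvs' sv c => [|v' vs] pvs pvs' sv c.
    by rewrite path_tuple0r compat_nil in c.
  apply/esym/negbTE; rewrite negbK; apply: contraT => nb; case: ne.
  have /andP[pv' _] := pvs'.
  have nb' : ~~ (block e && block a) by rewrite andbC.
  have := head_pt _ _ _ _ _ _ _ _ az' c.
  rewrite prec_compw // (negbTE nb') => pe'.
  move: pe; rewrite prec_compw // (negbTE nb) => pe.
  by apply: (collapse_inj s_gt0 nb); apply: prec_anti pe pe'; rewrite mem_u.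
congr (_ :: _); case: b su sv c => su sv c.
  by apply: (IHz us (v :: vs) p) => //; case: su.
by apply: (IHz (u :: us) vs p) => //; case: sv.
Qed.

Fixpoint path_koszul (p : seq bool) : nat :=
  if p is b :: p' then (if b then 0 else count id p') + path_koszul p' else 0.

(** A run v substituted at an occurrence of k has as degree the number of
    caesuras that it adds to the glued word, and it moves past the caesuras of
    x from this occurrence on. *)
Fixpoint runs_koszul (x : seq nat) (vs : seq (seq nat)) : nat :=
  if x is a :: x' then
    if a == k then
      (caesuras (glue vs) - caesuras (glue (behead vs))) * caesuras x
        + runs_koszul x' (behead vs)
    else runs_koszul x' vs
  else 0.

Lemma runs_koszul_run x v vs :
  runs_koszul (k :: x) (v :: vs) =
    (caesuras (glue (v :: vs)) - caesuras (glue vs)) * caesuras (k :: x)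
      + runs_koszul x vs.
Proof. by rewrite /= eqxx. Qed.

Lemma caesuras_glue v vs : linked (v :: vs) -> v != [::] ->
  caesuras (glue vs) <= caesuras (glue (v :: vs)).
Proof.
case/lastP: v => // v b /= + _; rewrite last_rcons cat_rcons.
case/orP => [/nilP -> //|/andP[/eqP e _]].
case: (glue vs) e => // h g /= ->; exact: (caesuras_cat v (h :: g)).
Qed.

(** Along the forced path, an x-step is a caesura of the skeleton and a y-step a
   caesura of the glued runs; so both signs count the pairs made of a caesura in
   a run and a later caesura of the skeleton. *)
Lemma forced_path_koszul z : linked (runs z) ->
  [/\ path_koszul (forced_path s k z) = runs_koszul (skel z) (runs z),
      count id (forced_path s k z) = caesuras (skel z)
    & count negb (forced_path s k z) = caesuras (glue (runs z))].
Proof.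
elim: z => // a z IHz; rewrite (unsubst_cons s k) [forced_path _ _ _]/=.
case: ifP => ba; last first.
  move=> /IHz[e1 e2 e3]; rewrite [(_, _).2]/= [(_, _).1]/= /=.
  rewrite collapse_eqk // ba -(mem_nonblock s_gt0) ?ba //.
  by case: ifP => _ /=; rewrite ?e1 ?e2 ?e3.
have a_runs := mem_block s_gt0 z ba.
case: ifP => bz; last first.
  rewrite andbF [(_, _).2]/= [(_, _).1]/=.
  have [r0|r0] := eqVneq (runs z) [::].
    have nkx: k \notin skel z by rewrite -(runs_nil _ s_gt0) r0.
    move: IHz; rewrite r0 => /(_ isT)[e1 e2 e3] _.
    by rewrite a_runs r0 runs_koszul_run /= (negbTE nkx) /= e1 e2 e3.
  have kx: k \in skel z by rewrite -[k \in _]negbK -(runs_nil _ s_gt0).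
  have nr0 : nilp (runs z) = false by case: (runs z) r0.
  rewrite [linked _]/= nr0 /= => /andP[/eqP ah lz].
  have [e1 e2 e3] := IHz lz; have mem_g := mem_glue_runs s_gt0 lz.
  have gE: a - k :: behead (glue (runs z)) = glue (runs z).
    rewrite ah; have: glue (runs z) != [::] by rewrite (glue_nil _ s_gt0).
    by case: (glue _).
  have -> : a \in z by rewrite a_runs -mem_g -gE mem_head.
  have cE : (a - k \in behead (glue (runs z))) + caesuras (behead (glue (runs z))) =
            caesuras (glue (runs z)) by rewrite -[in RHS]gE.
  by rewrite eqxx cE subnn mul0n kx /= e1 e2 e3.
have [x [v [vs E]]] := block_head_unsubst bz.
have := runs_prop k s_gt0 z; rewrite E [all _ _]/= => /andP[/andP[v0 _] _].
have last_v e : last e v = last 0 v by case: (v) v0.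
have linkedE : linked ((a - k :: v) :: vs) = linked (v :: vs) by rewrite /= last_v.
rewrite -[_.2]/((a - k :: v) :: vs) -[_.1]/(k :: x) linkedE => lz.
have mem_g := mem_glue_runs s_gt0 (k := k) (z := z); rewrite E in mem_g.
have lz' : linked (runs z) by rewrite E.
have [e1 e2 e3] := IHz lz'; rewrite E in e1 e2 e3.
rewrite a_runs E -mem_g // runs_koszul_run.
rewrite [glue (_ :: _)]/= -[_ \in _]/(a - k \in glue (v :: vs)) -[v ++ _]/(glue (v :: vs)).
rewrite [caesuras (_ :: glue _)]/= -addnBA ?caesuras_glue //.
rewrite mulnDl -addnA -runs_koszul_run.
by case: ifP => _; rewrite -e1 -e2 -e3 /nat_of_bool ?mul1n ?mul0n ?add0n ?add1n.
Qed.

End ForcedPath.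

(** * Substitution of permutations along lattice paths *)

Lemma iota0S n : iota 0 n.+1 = 0 :: [seq i.+1 | i <- iota 0 n].
Proof. by rewrite /= (iotaDl 1 0 n). Qed.

Section PermComposition.

Variables (r s : nat) (k : 'I_r).
Hypothesis s_gt0 : 0 < s.

Notation words n := (map (@perm_seq n)).

Lemma compw_perm u v : perm_eq u (iota 0 r) -> perm_eq v (iota 0 s) ->
  perm_eq (compw s k u v) (iota 0 (r + s).-1).
Proof.
move=> pu pv; have k_lt := ltn_ord k.
have ku : val k \in u by rewrite (perm_mem pu) mem_iota.
have uu : uniq u by rewrite (perm_uniq pu) iota_uniq.
have mem_u a : (a \in u) = (a < r) by rewrite (perm_mem pu) mem_iota.
have mem_v a : (a \in v) = (a < s) by rewrite (perm_mem pv) mem_iota.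
have memE a : (a \in compw s k u v) = (a < (r + s).-1).
  have -> : (a < (r + s).-1) = if block s k a then true else collapse s k a \in u.
    rewrite mem_u /block /collapse; case: (ltnP a k) => ?; case: (ltnP a (k + s)) => ? /=; lia.
  rewrite /compw; elim: u uu ku {pu mem_u} => // c u IHu /andP[ncu uu].
  rewrite inE substitute_cons [c == _]eq_sym; have [kc _|ne_kc /= ku] := eqVneq (val k) c.
    rewrite -kc in ncu *; rewrite substitute_notin //= mem_cat inE collapse_eqk //.
    case: ifP => ba.
      apply/orP; left; apply/mapP; exists (a - k); last by rewrite (sub_blockK s_gt0).
      by rewrite mem_v sub_block.
    apply/orP/idP => [[/mapP[b bv e]|/mapP[b bu e]]|cu].
    - by move: ba; rewrite e block_add // -mem_v.
    - rewrite orbC e raiseK ?bu //; apply: contra ncu => /eqP e2; by move: bu; rewrite e2.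
    rewrite ba /= in cu; right; rewrite -(collapseK s_gt0 (negbT ba)).
    exact: map_f.
  rewrite !inE IHu // (eq_raise s_gt0) 1?eq_sym //; case: ifP => // ba.
  by rewrite orbT.
apply: uniq_perm; rewrite ?iota_uniq //; last by move=> a; rewrite memE mem_iota.
rewrite (uniq_size_uniq (iota_uniq 0 (r + s).-1)) => [|a]; last by rewrite mem_iota memE.
have szu : size u = r by rewrite (perm_size pu) size_iota.
have szv : size v = s by rewrite (perm_size pv) size_iota.
suff sz w : uniq w -> val k \in w -> size (compw s k w v) = (size w + size v).-1.
  by rewrite size_iota sz // szu szv.
elim: w => // c w IHw /andP[ncw uw].
rewrite inE /compw substitute_cons [c == _]eq_sym.
have [kc _|ne_kc /= kw] := eqVneq (val k) c.
  by rewrite substitute_notin /= ?kc // size_cat !size_map addnC.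
have -> := IHw uw kw; case: (w) kw => //= d w' _; lia.
Qed.

Lemma perm_seq_comp (u : 'S_r) (v : 'S_s) :
  perm_seq (perm_comp k u v) = compw s k (perm_seq u) (perm_seq v).
Proof.
have [w ew] := perm_seq_ex (compw_perm (perm_seq_mem u) (perm_seq_mem v)).
rewrite /perm_comp; case: pickP => [w' /eqP //|/(_ w)].
by rewrite ew eqxx.
Qed.

Lemma words_path (us : seq 'S_r) (vs : seq 'S_s) (p : seq bool) :
  size us = (count id p).+1 -> size vs = (count negb p).+1 ->
  words _ [seq perm_comp k (nth 1%g us (path_x p i)) (nth 1%g vs (path_y p i))
             | i <- iota 0 (size p).+1] =
    path_tuple s k (words r us) (words s vs) p.
Proof.
rewrite -map_comp; elim: p us vs => [|b p IHp] [|u us] [|v vs] //.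
  by case=> /size0nil -> [/size0nil ->]; rewrite /= perm_seq_comp.
move=> su sv; rewrite iota0S [path_tuple _ _ _ _ _]/= map_cons -map_comp.
congr (_ :: _); first by rewrite [LHS]/= perm_seq_comp.
rewrite -[size (b :: p)]/(size p).+1.
case: b su sv => su sv.
  by rewrite -(IHp us (v :: vs)) //; case: su.
by rewrite -(IHp (u :: us) vs) //; case: sv.
Qed.

End PermComposition.

Section PathSign.

Lemma ord_filter_in (p : pred nat) w i j : p i -> p j -> i != j ->
  ord (filter p w) i j = ord w i j.
Proof.
move=> pi pj ne_ij; elim: w => //= c w IHw; rewrite [RHS]ord_cons //.
case: ifP => pc; first by rewrite ord_cons // IHw.
case: eqP => [ci|_]; first by rewrite ci pi in pc.
by case: eqP => [cj|_] //; rewrite cj pj in pc.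
Qed.

(** The inversions of the shuffle are the pairs of a y-step and a later
    x-step. *)
Lemma path_sign_koszul p : path_sign p = path_koszul p.
Proof.
rewrite /path_sign /koszul.
set n := size p; set w' := _ ++ _.
have -> : \sum_(a <- iota 0 n) \sum_(b <- iota 0 n |
     (index a (iota 0 n) < index b (iota 0 n)) && (index b w' < index a w')) 1 * 1 =
   \sum_(a <- iota 0 n) \sum_(b <- iota 0 n) [&& a < b, nth false p b & ~~ nth false p a].
  apply: eq_big_seq => a; rewrite mem_iota add0n => /andP[_ an].
  rewrite big_mkcond; apply: eq_big_seq => b; rewrite mem_iota add0n => /andP[_ bn].
  have idx c : c < n -> index c (iota 0 n) = c.
    by move=> cn; rewrite -{1}[c](nth_iota 0 0 cn) index_uniq ?size_iota ?iota_uniq.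
  rewrite !idx //; case: (ltnP a b) => //= ab; rewrite mul1n.
  suff -> : (index b w' < index a w') = nth false p b && ~~ nth false p a by case: ifP.
  have ne_ba : b != a by rewrite neq_ltn ab orbT.
  rewrite /w' !index_cat !mem_filter !mem_iota /= !add0n an bn !andbT.
  have ordE (q : pred nat) : q b -> q a -> (index b (filter q (iota 0 n)) < index a (filter q (iota 0 n))) = false.
    move=> qb qa; rewrite -/(ord _ b a) ord_filter_in // /ord !idx //.
    by rewrite ltnNge ltnW.
  case pa: (nth false p a); case pb: (nth false p b) => //=.
  - exact: ordE.
  - apply/negbTE; rewrite -leqNgt; apply: leq_trans (leq_addr _ _).
    by rewrite ltnW // index_mem mem_filter mem_iota pa an.
  - by apply: ltn_addr; rewrite index_mem mem_filter mem_iota pb bn.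
  - by rewrite ltn_add2l; apply: ordE; rewrite ?pa ?pb.
rewrite /n {n w'}; elim: p => [|c p IHp]; first by rewrite big_nil.
rewrite [size _]/= iota0S !big_cons !big_map ltnn /= add0n -IHp.
congr (_ + _).
  case: c => /=; first by rewrite big1 // => b _; rewrite andbF.
  under eq_bigr => b _ do rewrite andbT.
  rewrite -sum1_count -(big_mkcond (fun b => nth false p b) (fun=> 1)).
  by rewrite (big_nth false) /index_iota subn0.
by apply: eq_bigr => a _; rewrite big_cons big_map add0n.
Qed.

End PathSign.

(** * Segments and the Koszul sign of a composition *)

Section Segments.

Lemma segmentE y a b : a <= b -> b < size y ->
  segment y a b = take (b - a).+1 (drop a y).
Proof.
move=> ab by_; rewrite /segment /index_iota -subSn //.
by rewrite -(map_nth_iota 0) // leq_sub2r.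
Qed.

Fixpoint segs (y : seq nat) (js : seq nat) : seq (seq nat) :=
  match js with
  | j0 :: ((j1 :: _) as js') => segment y j0 j1 :: segs y js'
  | _ => [::]
  end.

Lemma segs_cons y j0 j1 js :
  segs y [:: j0, j1 & js] = segment y j0 j1 :: segs y (j1 :: js).
Proof. by []. Qed.

Local Arguments segs : simpl never.

Lemma segsE y js :
  [seq segment y (nth 0 js m) (nth 0 js m.+1) | m <- iota 0 (size js).-1] = segs y js.
Proof.
elim: js => // j0 [|j1 js] // IHjs.
rewrite segs_cons -IHjs -[(size _).-1]/(size js).+1 iota0S map_cons -map_comp.
by congr (_ :: _).
Qed.

Lemma path_leq_last j js : path leq j js -> j <= last j js.
Proof.
by elim: js j => //= j1 js IHjs j /andP[jj1 /IHjs]; apply: leq_trans.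
Qed.

Lemma segs_glue y j js : path leq j js -> js != [::] -> last j js < size y ->
  linked (segs y (j :: js)) /\
  glue (segs y (j :: js)) = take (last j js - j).+1 (drop j y).
Proof.
elim: js j => // j1 js IHjs j /= /andP[jj1 p1] _ lt_y.
have j1l := path_leq_last p1; have j1y := leq_ltn_trans j1l lt_y.
rewrite segmentE //.
case: js p1 lt_y j1l {IHjs} (IHjs j1) => [|j2 js] p1 lt_y j1l IH.
  by rewrite /= cats0.
have [//|//|//|lk gE] := IH.
have -> : nilp (segs y [:: j1, j2 & js]) = false by [].
rewrite lk gE.
set l := last j1 _ in lt_y j1l gE *.
have dropE : drop j1 y = nth 0 y j1 :: drop j1.+1 y by rewrite -drop_nth.
have szd : (j1 - j).+1 <= size (drop j y) by rewrite size_drop; lia.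
split.
  rewrite dropE /= andbT -nth_last size_takel // nth_take //= nth_drop subnKC //.
rewrite dropE /= -[RHS](cat_take_drop (j1 - j).+1); congr (_ ++ _).
  by rewrite take_takel //; lia.
rewrite -[(l - j).+1](@subnK (j1 - j).+1); last by lia.
rewrite -take_drop drop_drop.
have -> : (l - j).+1 - (j1 - j).+1 = l - j1 by lia.
by congr (take _ (drop _ _)); lia.
Qed.

Lemma segs_inj y j js js' : path leq j js -> path leq j js' ->
  last j js < size y -> last j js' < size y ->
  segs y (j :: js) = segs y (j :: js') -> js = js'.
Proof.
elim: js j js' => [|j1 js IHjs] j [|j1' js'] //=.
move=> /andP[jj1 p1] /andP[jj1' p1'] ly ly'; rewrite !segs_cons => -[e1 e2].
have j1y := leq_ltn_trans (path_leq_last p1) ly.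
have j1y' := leq_ltn_trans (path_leq_last p1') ly'.
have ej : j1 = j1'.
  move: e1; rewrite !segmentE // => /(congr1 size).
  rewrite !size_takel ?size_drop; lia.
by rewrite -ej in e2 p1' ly' *; rewrite (IHjs _ _ p1 p1').
Qed.

(** The cuts are read off the lengths of the given words. *)
Lemma segs_ex y vs j : linked vs -> all (fun v => v != [::]) vs -> vs != [::] ->
  j < size y -> drop j y = glue vs ->
  exists js, [/\ path leq j js, last j js = (size y).-1, segs y (j :: js) = vs
               & size js = size vs].
Proof.
elim: vs j => // v vs IHvs j lk /andP[v0 vs0] _ jy dropE.
have szv : 0 < size v by case: (v) v0.
have [vs_nil|vs_nnil] := eqVneq vs [::].
  rewrite vs_nil /= cats0 in dropE; exists [:: (size y).-1].
  have jy' : j <= (size y).-1 by lia.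
  rewrite vs_nil segs_cons segmentE //; last by lia.
  split=> //=; first by rewrite jy'.
  by rewrite take_oversize ?dropE // -dropE size_drop; lia.
have nvs : nilp vs = false by case: (vs) vs_nnil.
move: lk; rewrite /= nvs /= => /andP[/eqP lv lk].
pose j1 := j + (size v).-1.
have szy : size y - j = size v + (size (glue vs)).-1.
  by rewrite -size_drop dropE /= size_cat size_behead.
have [h [g gE]] : exists h g, glue vs = h :: g.
  case: (vs) vs_nnil vs0 => // w ws _ /= /andP[w0 _].
  by case: (w) w0 => // h t _; exists h, (t ++ behead (glue ws)).
have drop1 : drop j1 y = glue vs.
  rewrite /j1 addnC -drop_drop dropE /= gE /= [in RHS](_ : h = last 0 v); last by rewrite lv gE.
  case/lastP: v v0 {szv szy lv dropE j1} => // v b _.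
  by rewrite last_rcons size_rcons /= -cats1 -catA drop_size_cat.
have j1y : j1 < size y.
  by have := size_drop j1 y; rewrite drop1 gE /=; lia.
have [js [pj lj sj zj]] := IHvs j1 lk vs0 vs_nnil j1y drop1.
exists (j1 :: js); rewrite /= pj lj zj segs_cons sj; split=> //.
  by rewrite andbT leq_addr.
congr (_ :: _); rewrite segmentE ?leq_addr // /j1 addKn prednK // dropE /=.
by rewrite take_size_cat.
Qed.

End Segments.

Section CompositionSign.

Lemma caesuras_line u b : b <= size u -> caesuras u = line u b + caesuras (drop b u).
Proof.
elim: u b => [|a u IHu] [|b] //= bu.
by rewrite line_cons (IHu b) // addnA.
Qed.

Lemma lineS u b : line u b.+1 = line u b + caesura u b.
Proof. by rewrite /line -addn1 iotaD count_cat /= addn0. Qed.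

(** Along a segment the line changes exactly after each caesura. *)
Lemma seg_degE u a b : a <= b -> b <= size u ->
  seg_deg u a b = caesuras (drop a u) - caesuras (drop b u).
Proof.
move=> ab bu; rewrite /seg_deg.
have le_line n : line u a <= line u (a + n).
  elim: n => [|n IHn]; first by rewrite addn0.
  by rewrite addnS lineS (leq_trans IHn) ?leq_addr.
have rng n : [seq line u p | p <- index_iota a (a + n).+1] =i
             iota (line u a) (line u (a + n) - line u a).+1.
  rewrite /index_iota; elim: n => [|n IHn] c.
    by rewrite addn0 !subSnn subnn.
  have -> : (a + n.+1).+1 - a = ((a + n).+1 - a) + 1 by lia.
  rewrite iotaD map_cat mem_cat IHn !mem_iota /= inE.
  have -> : a + ((a + n).+1 - a) = (a + n).+1 by lia.
  rewrite [a + n.+1]addnS !lineS; have := le_line n; case: (caesura u (a + n)) => /=; lia.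
have := rng (b - a); rewrite subnKC // => rngb.
rewrite (perm_size (perm_undup rngb)) undup_id ?iota_uniq // size_iota /=.
have e1 := caesuras_line bu; have e2 := caesuras_line (leq_trans ab bu).
have := le_line (b - a); rewrite subnKC //; lia.
Qed.

Lemma caesuras_drop u a b : a <= b -> caesuras (drop b u) <= caesuras (drop a u).
Proof.
move=> ab; have -> : drop b u = drop (b - a) (drop a u).
  by rewrite drop_drop subnK.
by rewrite -[X in _ <= caesuras X](cat_take_drop (b - a)) caesuras_cat.
Qed.

Lemma occurrences_cons k a u :
  occurrences k (a :: u) =
    (if a == k then [:: 0] else [::]) ++ [seq p.+1 | p <- occurrences k u].
Proof.
rewrite /occurrences [size _]/= iota0S /= filter_map.
by case: eqP.
Qed.

Lemma size_occurrences k u : size (occurrences k u) = count_mem k u.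
Proof.
elim: u => // a u IHu; rewrite occurrences_cons size_cat size_map IHu /=.
by case: eqP.
Qed.

Lemma sum_iotaS n (F : nat -> nat) :
  \sum_(m <- iota 0 n.+1) F m = F 0 + \sum_(m <- iota 0 n) F m.+1.
Proof. by rewrite iota0S big_cons big_map. Qed.

Lemma runs_koszul_sum k x y j js : path leq j js -> last j js = (size y).-1 ->
  0 < size y -> size js = count_mem k x ->
  runs_koszul k x (segs y (j :: js)) =
    \sum_(m <- iota 0 (count_mem k x))
      (caesuras (drop (nth 0 (j :: js) m) y) - caesuras (drop (nth 0 (j :: js) m.+1) y))
        * caesuras (drop (nth 0 (occurrences k x) m) x).
Proof.
move=> pj lj y0; elim: x j js pj lj => [|a x IHx] j js pj lj.
  by rewrite /= big_nil.
rewrite [count_mem k _]/= occurrences_cons.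
have shift n : nth 0 [seq p.+1 | p <- occurrences k x] n =
    if n < count_mem k x then (nth 0 (occurrences k x) n).+1 else 0.
  case: ltnP => n_lt; first by rewrite (nth_map 0) ?size_occurrences.
  by rewrite nth_default // size_map size_occurrences.
case: eqP => ak sz; last first.
  rewrite /= in sz; rewrite [LHS]/= (introF eqP ak) add0n (IHx j js pj lj sz).
  apply: eq_big_seq => m; rewrite mem_iota => /= m_lt.
  by rewrite shift // m_lt.
case: js pj lj sz => [|j1 js] // pj lj [sz].
have /andP[jj1 p1] := pj; rewrite /= in lj.
rewrite segs_cons ak runs_koszul_run -[true + _]/(count_mem k x).+1 sum_iotaS.
congr (_ + _).
  congr (_ * _).
  have lt_l : last j1 js < size y by rewrite lj; lia.
  have [_] := segs_glue pj isT lt_l.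
  rewrite segs_cons => ->.
  have lastE i : (last j1 js - i).+1 >= size (drop i y) by rewrite size_drop lj; lia.
  rewrite take_oversize //; congr (_ - _).
  case: (js) p1 lj lt_l lastE => [|j2 js'] p1 lj lt_l lastE.
    rewrite /= in lj; rewrite lj /segs /=.
    have -> : drop (size y).-1 y = [:: last 0 y].
      case/lastP: (y) y0 => // y' b _; rewrite size_rcons /= -cats1 drop_size_cat //.
      by rewrite cats1 last_rcons.
    by [].
  have [_ ->] := @segs_glue y j1 (j2 :: js') p1 isT lt_l.
  by rewrite take_oversize.
rewrite (IHx j1 js p1 lj sz).
apply: eq_big_seq => m; rewrite mem_iota => /= m_lt.
by rewrite shift m_lt.
Qed.

Lemma index_iota0 m n : m < n -> index m (iota 0 n) = m.
Proof. by move=> mn; rewrite -{1}[m](nth_iota 0 0 mn) index_uniq ?size_iota ?iota_uniq. Qed.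

Lemma index_letters n m0 l : l <= n ->
  index (false, m0 + l)
    (flatten [seq [:: (false, m); (true, m)] | m <- iota m0 n] ++ [:: (false, m0 + n)])
    = l.*2.
Proof.
elim: n m0 l => [|n IHn] m0 [|l] //= ln; rewrite ?addn0 ?eqxx //.
have ne : ((false, m0) == (false, m0 + l.+1)) = false.
  by apply/eqP=> -[]; lia.
by rewrite ne -addSnnS -[m0 + n.+1]addSnnS IHn.
Qed.

Lemma index_lettersT n m0 l : l < n ->
  index (true, m0 + l)
    (flatten [seq [:: (false, m); (true, m)] | m <- iota m0 n] ++ [:: (false, m0 + n)])
    = l.*2.+1.
Proof.
elim: n m0 l => [|n IHn] m0 [|l] //= ln; rewrite ?addn0 ?eqxx //.
have ne : ((true, m0) == (true, m0 + l.+1)) = false.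
  by apply/eqP=> -[]; lia.
by rewrite ne -addSnnS -[m0 + n.+1]addSnnS IHn.
Qed.

Lemma sum_drops (g : nat -> nat) m n : m <= n ->
  (forall l, m <= l -> l < n -> g l.+1 <= g l) ->
  g n <= g m /\ \sum_(m <= l < n) (g l - g l.+1) = g m - g n.
Proof.
elim: n => [|n IHn]; first by case: m => // _ _; rewrite big_geq ?subnn.
rewrite leq_eqVlt => /orP[/eqP -> _|]; first by rewrite big_geq // subnn.
rewrite ltnS => mn gP; have [|gn IH] := IHn mn.
  by move=> l ml ln; apply: gP => //; apply: ltnW.
have := gP n mn (ltnSn n); rewrite big_nat_recr //= IH; lia.
Qed.

Lemma occurrences_sorted k u : sorted leq (occurrences k u).
Proof. by apply: sorted_filter; [apply: leq_trans | apply: iota_sorted]. Qed.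

Lemma occurrences_lt k u p : p \in occurrences k u -> p < size u.
Proof. by rewrite mem_filter mem_iota => /and3P[]. Qed.

(** The inverted pairs are those of a segment of y and a later segment of x,
    and the degrees of the segments of x after the occurrence m of k add up to
    the number of caesuras from this occurrence on. *)
Lemma xcomp_signE k x y js : 0 < size x -> 0 < size y ->
  sorted leq js -> all (fun j => j < size y) js ->
  size js = (count_mem k x).+1 ->
  xcomp_sign k x y js =
    \sum_(m <- iota 0 (count_mem k x))
      (caesuras (drop (nth 0 js m) y) - caesuras (drop (nth 0 js m.+1) y))
        * caesuras (drop (nth 0 (occurrences k x) m) x).
Proof.
move=> x0 y0 js_s js_lt sz_js; rewrite /xcomp_sign size_occurrences.
set n := count_mem k x in sz_js *.
set ps := 0 :: rcons _ _.
set deg := fun l : bool * nat => _.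
set w := [seq _ | m <- iota 0 n.+1] ++ _; set w' := flatten _ ++ _.
move NE: n.+1 @w => N w.
have wF l : l < N -> index (false, l) w = l.
  move=> ln; rewrite /w index_cat (mem_map (f := pair false)) => [|a b []] //.
  rewrite mem_iota ln (index_map (f := pair false)) => [|a b []] //.
  by rewrite index_iota0.
have wT m : m < n -> index (true, m) w = N + m.
  move=> mn; rewrite /w index_cat; case: ifP => [/mapP[]//|_].
  rewrite size_map size_iota (index_map (f := pair true)) => [|a b []] //.
  by rewrite index_iota0.
have w'F l : l < N -> index (false, l) w' = l.*2.
  by rewrite -NE ltnS; apply: (@index_letters n 0).
have w'T m : m < n -> index (true, m) w' = m.*2.+1 by apply: (@index_lettersT n 0).
have -> : koszul deg w w' = \sum_(l <- iota 0 N) \sum_(m <- iota 0 n | m < l)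
    deg (false, l) * deg (true, m).
  rewrite /koszul {1}/w big_cat !big_map /= [X in _ + X]big1_seq ?addn0.
    apply: eq_big_seq => l; rewrite mem_iota /= => ln.
    rewrite {1}/w big_cat !big_map /= big_seq_cond big_pred0 ?add0n => [|l'].
      rewrite big_seq_cond [RHS]big_seq_cond; apply: eq_bigl => m.
      rewrite mem_iota /= add0n; case: ltnP => //= mn.
      rewrite wF // wT // w'F // w'T //; lia.
    rewrite mem_iota /=; case: ltnP => //= ln'.
    rewrite !wF // !w'F //; lia.
  move=> m; rewrite mem_iota /= add0n => mn.
  rewrite {1}/w big_cat !big_map /= big_seq_cond big_pred0 ?add0n => [|l].
    rewrite big_seq_cond big_pred0 // => m'.
    rewrite mem_iota /= add0n; case: ltnP => //= mn'.
    rewrite !wT // !w'T //; lia.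
  rewrite mem_iota /=; case: ltnP => //= ln.
  rewrite wF // wT // w'F // w'T //; lia.
rewrite (exchange_big_dep predT) //=; apply: eq_big_seq => m; rewrite mem_iota add0n => /= mn.
under eq_bigr => l _ do rewrite mulnC.
rewrite -big_distrr /=.
have ps_s : sorted leq ps.
  have := occurrences_sorted k x; have := @occurrences_lt k x.
  rewrite /ps /=; case: (occurrences k x) => //= p q lt_q pq.
  rewrite rcons_path pq /=.
  by rewrite -ltnS prednK // lt_q // mem_last.
have ps_lt l : nth 0 ps l < size x.
  have [lt_l|ge_l] := ltnP l (size ps); last by rewrite nth_default.
  have := mem_nth 0 lt_l; rewrite /ps inE mem_rcons inE => /or3P[/eqP->|/eqP->|] //.
    by rewrite prednK.
  exact: occurrences_lt.
have sz_ps : size ps = n.+2 by rewrite /= size_rcons size_occurrences.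
have le_ps l : l < N -> nth 0 ps l <= nth 0 ps l.+1.
  by move=> ln; apply: (sortedP 0 ps_s); rewrite sz_ps NE ltnS.
congr (_ * _).
  rewrite -[LHS]/(seg_deg y (nth 0 js m) (nth 0 js m.+1)) seg_degE //.
    by apply: (sortedP 0 js_s); rewrite sz_js ltnS.
  by apply: ltnW; apply: (all_nthP 0 js_lt); rewrite sz_js ltnS.
pose g l := caesuras (drop (nth 0 ps l) x).
have -> : \sum_(l <- iota 0 N | m < l) deg (false, l) =
          \sum_(m.+1 <= l < N) (g l - g l.+1).
  rewrite -[N in iota 0 N]subn0 -/(index_iota 0 N) (@big_cat_nat _ _ _ m.+1) //=; last by rewrite -NE ltnS ltnW.
  rewrite big_nat_cond big_pred0 ?add0n => [|l]; last by rewrite ltnS; lia.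
  rewrite big_nat_cond [RHS]big_nat; apply: congr_big => // [l|l /andP[/andP[ml lN] _]].
    by case: (m < l); rewrite ?andbT ?andbF.
  rewrite -[deg _]/(seg_deg x (nth 0 ps l) (nth 0 ps l.+1)) seg_degE // ?le_ps //.
  exact: ltnW.
have mN : m.+1 <= N by rewrite -NE ltnS ltnW.
have [|_ ->] := @sum_drops g m.+1 N mN.
  by move=> l _ lN; apply: caesuras_drop; apply: le_ps.
have -> : g N = 0.
  rewrite /g -NE /ps /= nth_rcons size_occurrences ltnn eqxx.
  case/lastP: (x) x0 => // x' b _; rewrite size_rcons /= -cats1 drop_size_cat //.
by rewrite subn0 /g /ps /= nth_rcons size_occurrences mn.
Qed.

End CompositionSign.

(** * The table reduction commutes with compositions *)

Local Open Scope ring_scope.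

Section Nondegeneracy.

Variables (s k : nat).
Hypothesis s_gt0 : (0 < s)%N.

Lemma head_skel c z : head 0%N (unsubst s k (c :: z)).1 = collapse s k c.
Proof.
rewrite unsubst_cons; case: ifP => // bc; rewrite collapse_block //.
by case: ifP => // /block_head_unsubst[x [v [vs ->]]].
Qed.

Lemma skel_nondegenerate z : nondegenerate z -> nondegenerate (unsubst s k z).1.
Proof.
elim: z => // a z IHz ndg; have {}IHz := IHz (nondegenerate_behead ndg).
have cons_ndg c : (forall e y, z = e :: y -> c != collapse s k e) ->
    nondegenerate (c :: (unsubst s k z).1).
  move=> ne; case: z IHz ne {ndg} => [|e y] // IHz ne.
  have := head_skel e y; case: ((unsubst s k (e :: y)).1) IHz => // h x IHz /= hE.
  by rewrite hE (ne _ _ erefl) -hE.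
rewrite unsubst_cons; case: ifP => ba.
  case: ifP => bz //=; apply: cons_ndg => e y zE.
  by rewrite eq_sym collapse_eqk //; move: bz; rewrite zE /= => ->.
apply: cons_ndg => e y zE; apply/eqP=> ce; move: ndg; rewrite zE nondegenerate_cons.
by rewrite (collapse_inj s_gt0 _ ce) ?eqxx // ba.
Qed.

Lemma head_glue c z : block s k c ->
  head 0%N (glue (unsubst s k (c :: z)).2) = (c - k)%N.
Proof. by move=> bc; rewrite unsubst_cons bc; case: ifP. Qed.

Lemma glue_nondegenerate z : nondegenerate z -> linked (unsubst s k z).2 ->
  nondegenerate (glue (unsubst s k z).2).
Proof.
elim: z => // a z IHz ndg; have {}IHz := IHz (nondegenerate_behead ndg).
rewrite unsubst_cons; case: ifP => ba //.
case: ifP => bz.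
  have [x [v [vs E]]] := block_head_unsubst bz.
  have := runs_prop k s_gt0 z; rewrite E [all _ _]/= => /andP[/andP[v0 _] _].
  have last_v : last (a - k)%N v = last 0%N v by case: (v) v0.
  rewrite [(_, _).2]/= [linked _]/= last_v -[nilp _ || _]/(linked (v :: vs)) => lz.
  rewrite E in IHz; have := IHz lz; rewrite [glue ((_ :: _) :: _)]/= -[v ++ _]/(glue (v :: vs)).
  case: z bz ndg E {IHz} => // c z bc; rewrite nondegenerate_cons => /andP[ne_ac _] E.
  have := head_glue z bc; rewrite E; case: (glue _) => // h g /= ->.
  move=> ->; rewrite andbT; apply: contra ne_ac => /eqP e.
  by rewrite -(sub_blockK s_gt0 ba) -(sub_blockK s_gt0 bc) e.
rewrite [(_, _).2]/= [linked _]/=; have [r0|r0] := eqVneq (unsubst s k z).2 [::].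
  by rewrite r0.
have -> : nilp (unsubst s k z).2 = false by case: (unsubst s k z).2 r0.
move=> /= /andP[/eqP ah lz]; have := IHz lz.
have: glue (unsubst s k z).2 != [::] by rewrite (glue_nil _ s_gt0).
by case: (glue _) ah => //= h g ->.
Qed.

End Nondegeneracy.

Section LinExt.

Variable R : comPzRingType.

Lemma lin_ext_swap (I J : finType) (V : lmodType R) (f : I -> J -> V)
  (x : free_mod R I) (y : free_mod R J) :
  lin_ext (fun i => lin_ext (f i) y) x = lin_ext (fun j => lin_ext (f^~ j) x) y.
Proof.
rewrite /lin_ext; under eq_bigr => i _ do rewrite scaler_sumr.
rewrite exchange_big; apply: eq_bigr => j _; rewrite scaler_sumr.
by apply: eq_bigr => i _; rewrite !scalerA mulrC.
Qed.

End LinExt.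

Section TRComposition.

Variables (R : comPzRingType) (r s d e : nat) (k : 'I_r).
Hypothesis s_gt0 : (0 < s)%N.

Notation words := (map (@perm_seq _)).
Notation skel z := (unsubst s k z).1.
Notation runs z := (unsubst s k z).2.

Let k_lt : (k < r)%N := ltn_ord k.

Lemma comp_arity_gt0 : (0 < (r + s).-1)%N.
Proof. have := ltn_ord k; lia. Qed.

Definition valid_cuts (y : seq nat) (js : seq nat) : bool :=
  [&& sorted leq js, head 0%N js == 0%N & last 0%N js == (size y).-1].

Lemma valid_cutsE y js : valid_cuts y js -> js != [::] ->
  exists js', [/\ js = 0%N :: js', path leq 0%N js' & last 0%N js' = (size y).-1].
Proof.
case: js => // j js /and3P[/= pj /eqP j0 /eqP lj] _; rewrite j0 in pj lj *.
by exists js.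
Qed.

(** The cuts run from the first position of v to the last one and consecutive
    segments share an end point, so that gluing them gives v back; the
    segments themselves are recovered from z by substK. *)
Lemma xcomp_word_inv (u : xbasis r d) (v : xbasis s e) js z :
  size js = (size (occurrences k (xseq u))).+1 ->
  all (fun j => j < s + e)%N js -> valid_cuts (xseq v) js ->
  xcomp_word s k (xseq u) (xseq v) js = z ->
  [/\ skel z = xseq u, runs z = segs (xseq v) js, linked (runs z)
    & glue (runs z) = xseq v].
Proof.
move=> sz_js js_lt js_ok <-; have sz_v := size_xseq v.
have v0 : (0 < size (xseq v))%N by rewrite sz_v addn_gt0 s_gt0.
have [|js' [jsE pj lj]] := valid_cutsE js_ok; first by case: (js) sz_js.
have bu := xseq_valid u; have ku : val k \in xseq u by rewrite (xvalid_mem _ bu).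
have occ0 : (0 < size (occurrences k (xseq u)))%N by rewrite size_occurrences -mem_count.
have js'0 : js' != [::].
  by apply/eqP=> js0; move: sz_js occ0; rewrite jsE js0 /= => -[<-].
have lt_l : (last 0%N js' < size (xseq v))%N by rewrite lj; lia.
have segsE' : [seq segment (xseq v) (nth 0%N js m) (nth 0%N js m.+1)
                 | m <- iota 0 (size (occurrences k (xseq u)))] = segs (xseq v) js.
  by rewrite -segsE sz_js.
have [lk gE] := segs_glue pj js'0 lt_l; rewrite -jsE in lk gE.
have {}gE : glue (segs (xseq v) js) = xseq v.
  by rewrite gE subn0 drop0 take_oversize // lj; lia.
have E : unsubst s k (xcomp_word s k (xseq u) (xseq v) js) =
         (xseq u, segs (xseq v) js).
  rewrite /xcomp_word [X in substitute _ _ _ X]segsE'; apply: substK => //.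
  - by case/and4P: bu.
  - by rewrite -segsE' size_map size_iota size_occurrences.
  have bv := xseq_valid v; case/and4P: (bv) => _ lt_v _ _.
  rewrite -segsE'; apply/allP=> _ /mapP[m m_lt ->]; rewrite mem_iota /= in m_lt.
  have mj : (nth 0%N js m <= nth 0%N js m.+1)%N.
    case/and3P: js_ok => js_s _ _.
    by apply: (sortedP 0%N js_s); rewrite sz_js ltnS.
  have mv : (nth 0%N js m.+1 < size (xseq v))%N.
    by rewrite sz_v; apply: (all_nthP 0%N js_lt); rewrite sz_js ltnS.
  rewrite segmentE //; apply/andP; split.
    by rewrite -size_eq0 size_takel // size_drop -subSn // leq_sub2r.
  apply/allP=> a /mem_take/mem_drop; exact: (allP lt_v).
by rewrite E.
Qed.

Section Coefficient.

Variables (t : ebasis r d) (t' : ebasis s e) (b : xbasis (r + s).-1 (d + e)).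

Let us := map (@perm_seq r) (val (val t)).
Let vs := map (@perm_seq s) (val (val t')).
Let z := xseq b.

Let pus : all_perm r us.
Proof. exact: all_perm_words. Qed.
Let pvs : all_perm s vs.
Proof. exact: all_perm_words. Qed.
Let sz_us : size us = d.+1.
Proof. by rewrite size_map size_tuple. Qed.
Let sz_vs : size vs = e.+1.
Proof. by rewrite size_map size_tuple. Qed.
Let bz := xseq_valid b.

Let z_lt : all (fun a => a < (r + s).-1)%N z.
Proof. by case/and4P: bz. Qed.
Let z_ndg : nondegenerate z.
Proof. by case/and4P: bz. Qed.

Let splits : bool := [&& linked (runs z), compat us (skel z) & compat vs (glue (runs z))].

Lemma mem_skel_comp a : (a \in skel z) = (a < r)%N.
Proof.
rewrite mem_skel //; apply/mapP/idP => [[c cz ->]|ar].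
  by apply: (collapse_lt s_gt0 k_lt); rewrite -(xvalid_mem _ bz).
have [->|ne_ak] := eqVneq a k.
  exists (0 + k)%N; last by rewrite collapse_block // block_add.
  by rewrite (xvalid_mem _ bz) block_lt.
by exists (raise s k a); [rewrite (xvalid_mem _ bz) raise_lt | rewrite raiseK].
Qed.

Lemma runs_comp_neq0 : runs z != [::].
Proof. by rewrite runs_nil // negbK mem_skel_comp k_lt. Qed.

Lemma mem_glue_comp a : linked (runs z) -> (a \in glue (runs z)) = (a < s)%N.
Proof.
move=> lz; rewrite mem_glue_runs // flatten_runs; apply/mapP/idP => [[c]|as_].
  by rewrite mem_filter => /andP[bc _] ->; apply: sub_block.
exists (a + k)%N; last by rewrite addnK.
by rewrite mem_filter block_add // (xvalid_mem _ bz) block_lt.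
Qed.

Lemma splitsE : splits = compat (path_tuple s k us vs (forced_path s k z)) z.
Proof.
rewrite (compat_path s_gt0 k_lt pus pvs z_lt) /splits /compat_runs.
by have -> : nilp (runs z) = false by case: (runs z) runs_comp_neq0.
Qed.

Lemma xvalid_undup n m (w : seq nat) : (forall a, (a \in w) = (a < n)%N) ->
  caesuras w = m -> nondegenerate w -> xvalid n m w.
Proof.
move=> mem_w cw ndg; rewrite /xvalid ndg andbT size_caesuras cw.
have -> : size (undup w) = n.
  rewrite -[RHS](size_iota 0); apply/perm_size/uniq_perm;
    rewrite ?undup_uniq ?iota_uniq // => a.
  by rewrite mem_undup mem_w mem_iota.
rewrite eqxx /=; apply/andP; split; apply/allP=> a; first by rewrite mem_w.
by rewrite mem_w mem_iota.
Qed.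

Lemma splits_basis : splits ->
  exists (u : xbasis r d) (v : xbasis s e), xseq u = skel z /\ xseq v = glue (runs z).
Proof.
case/and3P=> lz cx cv.
have [u ux] : exists u : xbasis r d, xseq u = skel z.
  apply: xvalid_ex; apply: xvalid_undup mem_skel_comp _ (skel_nondegenerate _ s_gt0 z_ndg).
  by apply: eq_add_S; rewrite -(compat_caesuras cx).
have [v vx] : exists v : xbasis s e, xseq v = glue (runs z).
  apply: xvalid_ex.
  apply: xvalid_undup (fun a => mem_glue_comp a lz) _ (glue_nondegenerate s_gt0 z_ndg lz).
  by apply: eq_add_S; rewrite -(compat_caesuras cv).
by exists u, v.
Qed.

Let sgn : R := (-1) ^+ path_koszul (forced_path s k z).

(** By forced_path_unique one lattice path at most contributes to the
    coefficient of z. *)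
Lemma TR_ecomp : TR R _ _ (ecomp_gen R k t t') b = if splits then sgn else 0.
Proof.
rewrite /ecomp_gen linear_sum coef_sum.
under eq_bigr => p _ do rewrite linearZ coefZ.
have count_e (p : (d + e).-tuple bool) : count id p == d -> count negb p = e.
  move=> /eqP cd; have := count_predC id p; rewrite size_tuple cd => /addnI.
  by move=> h; apply: etrans h; apply: eq_count.
have coefE (p : (d + e).-tuple bool) : count id p == d ->
  TR R _ _ (egen R (d + e) [seq perm_comp k (nth 1%g (val (val t)) (path_x p i))
       (nth 1%g (val (val t')) (path_y p i)) | i <- iota 0 (d + e).+1]) b =
  (compat (path_tuple s k us vs p) z)%:R.
  move=> cd; rewrite TR_egen ?comp_arity_gt0 ?size_map ?size_iota //.
  have := @words_path r s k s_gt0 (val (val t)) (val (val t')) p.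
  rewrite !size_tuple (eqP cd) (count_e p cd) => H.
  by rewrite [X in compat X _]H.
rewrite (eq_bigr (fun p : (d + e).-tuple bool =>
  (-1) ^+ path_sign p * (compat (path_tuple s k us vs p) z)%:R)) => [|p cd]; last first.
  by rewrite coefE.
have uniqP (p : (d + e).-tuple bool) : count id p == d ->
    compat (path_tuple s k us vs p) z -> tval p = forced_path s k z.
  move=> cd; apply: (forced_path_unique s_gt0 k_lt pus pvs z_lt z_ndg).
    by rewrite sz_us (eqP cd).
  by rewrite sz_vs (count_e p cd).
case: ifP => good; last first.
  rewrite big1 // => p cd; case: (boolP (compat _ z)) => [cp|_]; last by rewrite mulr0.
  by move: good; rewrite splitsE -(uniqP p cd cp) cp.
have /and3P[lz cx cv] := good.
have [ekos ex ey] := forced_path_koszul s_gt0 lz.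
have cX : caesuras (skel z) = d by apply: eq_add_S; rewrite -(compat_caesuras cx).
have cV : caesuras (glue (runs z)) = e by apply: eq_add_S; rewrite -(compat_caesuras cv).
have sz_p : size (forced_path s k z) == (d + e)%N.
  rewrite -(count_predC id) ex cX -[X in (_ + X)%N]/(count negb (forced_path s k z)).
  by rewrite ey cV.
rewrite (bigD1 (Tuple sz_p)) /=; last by rewrite ex cX.
rewrite -splitsE good mulr1 big1 ?addr0 ?path_sign_koszul // => p /andP[cd ne_p].
case: (boolP (compat _ z)) => [cp|_]; last by rewrite mulr0.
by case/eqP: ne_p; apply: val_inj; apply: uniqP.
Qed.

Let r_gt0 : (0 < r)%N.
Proof. by apply: leq_ltn_trans k_lt. Qed.

Lemma xcomp_genE (u : xbasis r d) (v : xbasis s e) :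
  xcomp_gen R k u v b =
    \sum_(j : (size (occurrences k (xseq u))).+1.-tuple 'I_(s + e)
          | valid_cuts (xseq v) [seq val a | a <- j])
      (-1) ^+ xcomp_sign k (xseq u) (xseq v) [seq val a | a <- j] *
      (z == xcomp_word s k (xseq u) (xseq v) [seq val a | a <- j])%:R.
Proof.
rewrite /xcomp_gen coef_sum; apply: congr_big => // [j|j _].
  by rewrite /valid_cuts size_xseq.
by rewrite coefZ xgenE.
Qed.

Lemma cuts_props (u : xbasis r d)
  (j : (size (occurrences k (xseq u))).+1.-tuple 'I_(s + e)) :
  size [seq val a | a <- j] = (size (occurrences k (xseq u))).+1 /\
  all (fun i => i < s + e)%N [seq val a | a <- j].
Proof.
rewrite size_map size_tuple; split=> //.
by apply/allP=> _ /mapP[a _ ->]; apply: ltn_ord.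
Qed.

Lemma xcomp_gen_eq0 (u : xbasis r d) (v : xbasis s e) :
  compat us (xseq u) -> compat vs (xseq v) -> ~~ splits -> xcomp_gen R k u v b = 0.
Proof.
move=> cu cv; rewrite xcomp_genE => nG; apply: big1 => j js_ok.
case: eqP => [zE|]; last by rewrite mulr0.
have [sz_js js_lt] := cuts_props j.
have [uE vE lz gE] := xcomp_word_inv sz_js js_lt js_ok (esym zE).
by case/negP: nG; rewrite /splits lz uE gE cu cv.
Qed.

Lemma xcomp_gen_neq (u : xbasis r d) (v : xbasis s e) :
  (xseq u, xseq v) != (skel z, glue (runs z)) -> xcomp_gen R k u v b = 0.
Proof.
move=> ne_uv; rewrite xcomp_genE; apply: big1 => j js_ok.
case: eqP => [zE|]; last by rewrite mulr0.
have [sz_js js_lt] := cuts_props j.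
have [uE vE lz gE] := xcomp_word_inv sz_js js_lt js_ok (esym zE).
by rewrite uE gE eqxx in ne_uv.
Qed.

Lemma xcomp_gen_splits (u : xbasis r d) (v : xbasis s e) : linked (runs z) ->
  xseq u = skel z -> xseq v = glue (runs z) -> xcomp_gen R k u v b = sgn.
Proof.
move=> lz uE vE; rewrite xcomp_genE.
have sz_v := size_xseq v; have v0 : (0 < size (xseq v))%N by rewrite sz_v addn_gt0 s_gt0.
have runs_ok : all (fun w => w != [::]) (runs z).
  by apply: sub_all (runs_prop _ s_gt0 z) => w /andP[].
have [|js' [pj lj sE sz_js']] := segs_ex lz runs_ok runs_comp_neq0 v0.
  by rewrite drop0.
have occE : size (occurrences k (xseq u)) = size js'.
  by rewrite size_occurrences sz_js' size_runs // uE.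
have js_lt : all (fun i => i < s + e)%N (0%N :: js').
  have le_last i l : path leq i l -> all (fun a => a <= last i l)%N (i :: l).
    elim: l i => [|a l IHl] i /=; first by rewrite leqnn.
    move=> /andP[ia pal]; have := IHl a pal; rewrite /= => /andP[al ->].
    by rewrite al (leq_trans ia al).
  by apply: sub_all (le_last _ _ pj) => a; rewrite lj -sz_v -ltnS prednK.
have [|j jE] := @ord_tuple_ex _ (size (occurrences k (xseq u))).+1 _ _ js_lt.
  by rewrite /= occE.
have jE' : [seq val a | a <- j] = 0%N :: js' by [].
have ok_j : valid_cuts (xseq v) (0%N :: js') by rewrite /valid_cuts /= pj lj !eqxx.
have zE : z = xcomp_word s k (xseq u) (xseq v) (0%N :: js').
  rewrite /xcomp_word occE.
  rewrite [X in substitute _ _ _ X](_ : _ = segs (xseq v) (0%N :: js')).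
    by rewrite sE uE unsubstK.
  by rewrite -segsE.
rewrite (bigD1 j) /=; last by rewrite jE'.
rewrite jE' -zE eqxx mulr1 big1 ?addr0 => [|j2 /andP[ok2 ne_j]]; last first.
  case: eqP => [z2|]; last by rewrite mulr0.
  have [sz2 lt2] := cuts_props j2.
  have [_ sE2 _ _] := xcomp_word_inv sz2 lt2 ok2 (esym z2).
  case/eqP: ne_j; apply/val_inj/(inj_map val_inj); rewrite -[RHS]/([seq val a | a <- j]) jE'.
  have [|js2 [jE2 pj2 lj2]] := valid_cutsE ok2; first by case: ([seq val a | a <- j2]) sz2.
  rewrite [LHS]jE2; congr (_ :: _); rewrite jE2 in sE2.
  apply: (segs_inj pj2 pj); rewrite ?lj2 ?lj ?prednK //.
  by rewrite -sE2 sE.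
rewrite /sgn; congr (_ ^+ _).
have [-> _ _] := forced_path_koszul s_gt0 lz.
have x0 : (0 < size (xseq u))%N by rewrite size_xseq addn_gt0 r_gt0.
have cnt : count_mem (k : nat) (xseq u) = size js' by rewrite -size_occurrences.
rewrite xcomp_signE //; first last.
- by rewrite /= cnt.
- by rewrite sz_v.
- by rewrite -uE -sE (runs_koszul_sum pj lj v0) // cnt.
Qed.

(** The factors and the cuts of a composition which yields z are determined by
    z, so that one term at most contributes to the coefficient. *)
Lemma TR_xcomp :
  lin_ext (fun u => lin_ext (@xcomp_gen R r s d e k u) (TR R s e (basis_elt R t')))
    (TR R r d (basis_elt R t)) b = if splits then sgn else 0.
Proof.
have TRt (u : xbasis r d) : TR R r d (basis_elt R t) u = (compat us (xseq u))%:R.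
  by rewrite -egen_basis TR_egen // size_tuple.
have TRt' (v : xbasis s e) : TR R s e (basis_elt R t') v = (compat vs (xseq v))%:R.
  by rewrite -egen_basis TR_egen // size_tuple.
rewrite lin_extE.
under eq_bigr => u _ do rewrite TRt lin_extE.
have [good|nG] := boolP splits; last first.
  apply: big1 => u _; case: (boolP (compat us _)) => [cu|_]; last by rewrite mul0r.
  rewrite big1 ?mulr0 // => v _; rewrite TRt'.
  case: (boolP (compat vs _)) => [cv|_]; last by rewrite mul0r.
  by rewrite xcomp_gen_eq0 ?mulr0.
have [u [v [uE vE]]] := splits_basis good; have /and3P[lz cx cv] := good.
rewrite (bigD1 u) //= [X in _ + X]big1 ?addr0 => [|u' ne_u].
  rewrite uE cx mul1r (bigD1 v) //= big1 ?addr0 => [|v' ne_v].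
    by rewrite TRt' vE cv mul1r xcomp_gen_splits.
  rewrite xcomp_gen_neq ?mulr0 //; rewrite -uE -vE xpair_eqE eqxx /=.
  by rewrite (inj_eq (@xseq_inj s e)).
rewrite big1 ?mulr0 // => v' _; rewrite xcomp_gen_neq ?mulr0 //.
by rewrite -uE -vE xpair_eqE (inj_eq (@xseq_inj r d)) (negbTE ne_u).
Qed.

End Coefficient.

Lemma TR_comp (x : emod R r d) (y : emod R s e) :
  TR R (r + s).-1 (d + e) (lin_ext (fun u => lin_ext (@ecomp_gen R r s d e k u) y) x) =
  lin_ext (fun u => lin_ext (@xcomp_gen R r s d e k u) (TR R s e y)) (TR R r d x).
Proof.
apply: (@eq_linear _ _ _ (TR R _ _ \o lin_ext (fun u => lin_ext (@ecomp_gen R r s d e k u) y))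
  (lin_ext (fun u => lin_ext (@xcomp_gen R r s d e k u) (TR R s e y)) \o TR R r d)) => t.
rewrite -[LHS]/(TR R _ _ (lin_ext (fun u => lin_ext (@ecomp_gen R r s d e k u) y)
                  (basis_elt R t))) lin_ext_basis.
rewrite -[RHS]/(lin_ext (fun u => lin_ext (@xcomp_gen R r s d e k u) (TR R s e y))
                  (TR R r d (basis_elt R t))) lin_ext_swap.
apply: (@eq_linear _ _ _ (TR R _ _ \o lin_ext (@ecomp_gen R r s d e k t))
  (lin_ext (fun v => lin_ext (fun u => @xcomp_gen R r s d e k u v)
              (TR R r d (basis_elt R t))) \o TR R s e)) => t'.
rewrite -[LHS]/(TR R _ _ (lin_ext (@ecomp_gen R r s d e k t) (basis_elt R t'))) lin_ext_basis.
rewrite -[RHS]/(lin_ext (fun v => lin_ext (fun u => @xcomp_gen R r s d e k u v)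
              (TR R r d (basis_elt R t))) (TR R s e (basis_elt R t'))) -lin_ext_swap.
by apply/ffunP=> b; rewrite TR_ecomp TR_xcomp.
Qed.

End TRComposition.

(** * Stability of the filtrations under composition *)

Lemma thins_cons (T : eqType) (a : T) s t : thins t s -> thins (a :: t) (a :: s).
Proof. by move=> ts; do ?constructor. Qed.

Lemma thins_cat2l (T : eqType) (s t w : seq T) (a : T) : thins t (a :: s) ->
  thins (rcons w a ++ t) (rcons w a ++ s).
Proof.
move=> ts; elim: w => [|b w IHw]; first exact: thins_copy.
exact: thins_cons.
Qed.

Lemma thins_glue vs : all (fun v => v != [::]) vs -> linked vs ->
  thins (flatten vs) (glue vs).
Proof.
elim: vs => [|v vs IHvs] /=; first by constructor.
move=> /andP[v0 vs0] /orP[/nilP->|/andP[/eqP lv lvs]].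
  by rewrite /= !cats0; apply: thins_refl.
have := IHvs vs0 lvs; case: (glue vs) lv => [|c g] /= lv.
  move=> t0; have -> : flatten vs = [::] by inversion t0.
  exact: thins_refl.
by case/lastP: v v0 lv => // w a _; rewrite last_rcons => ->; apply: thins_cat2l.
Qed.

Section Restriction.

Variables (s k : nat).
Hypothesis s_gt0 : (0 < s)%N.

Notation skel z := (unsubst s k z).1.
Notation runs z := (unsubst s k z).2.

Lemma res_runs z i j : block s k i -> block s k j ->
  res i j z = res (i - k) (j - k) (flatten (runs z)).
Proof.
move=> bi bj; elim: z => [|a z IHz]; first by [].
rewrite flatten_runs res_cons IHz flatten_runs /=.
have eqb c : block s k a -> block s k c -> (a - k == c - k)%N = (a == c).
  rewrite /block => ba bc; lia.
case ba: (block s k a) => /=; last first.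
  have [ai|_] := eqVneq a i; first by rewrite ai bi in ba.
  by have [aj|_] := eqVneq a j; first by rewrite aj bj in ba.
by rewrite res_cons !eqb.
Qed.

(** The restriction sees the runs one after the other, and gluing removes a
    repeated end point between two of them. *)
Lemma thins_res_glue z i j : linked (runs z) -> block s k i -> block s k j ->
  thins (res i j z) (res (i - k) (j - k) (glue (runs z))).
Proof.
move=> lz bi bj; rewrite (res_runs z bi bj); apply/thins_res/thins_glue => //.
by apply: sub_all (runs_prop k s_gt0 z) => v /andP[].
Qed.

(** A run of block values restricts to repetitions of the letter which stands
    for k, or to nothing. *)
Lemma thins_res_skel z i j : i != j -> ~~ (block s k i && block s k j) ->
  thins (res i j z) (res (collapse s k i) (collapse s k j) (skel z)).
Proof.
move=> ne_ij nb.
have ne_c : collapse s k i != collapse s k j.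
  by apply: contra ne_ij => /eqP e; apply/eqP/(collapse_inj s_gt0 nb e).
elim: z => [|a z IHz]; first by constructor.
have eq_collapse c : ~~ block s k a -> (collapse s k a == collapse s k c) = (a == c).
  move=> nba; apply/eqP/eqP => [|->] // e; apply: (collapse_inj s_gt0 _ e).
  by rewrite (negbTE nba).
rewrite unsubst_cons; case: ifP => ba; last first.
  rewrite [(_, _).1]/= !res_cons !eq_collapse ?ba //.
  by case: ifP => // _; apply: thins_cons.
have [X -> IH] : exists2 X, (if block_head s k z then
      (skel z, ((a - k)%N :: head [::] (runs z)) :: behead (runs z))
    else (k :: skel z, [:: (a - k)%N] :: runs z)).1 = k :: X &
    thins (res i j z) (res (collapse s k i) (collapse s k j) (k :: X)).
  case: ifP => [/block_head_unsubst[x [v [vs E]]]|_].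
    by exists x; [rewrite E | move: IHz; rewrite E].
  exists (skel z) => //; rewrite res_cons; case: ifP => // _; exact: thins_skip.
rewrite res_cons; have [ai|_] /= := eqVneq a i.
  have ci : collapse s k i = k by rewrite -ai collapse_block.
  by rewrite res_cons ci eqxx /= in IH *; apply: thins_copy.
have [aj|_] //= := eqVneq a j.
have cj : collapse s k j = k by rewrite -aj collapse_block.
have ck : (k == collapse s k i) = false.
  by apply: contraNF ne_c => /eqP kc; rewrite -kc cj.
by rewrite res_cons ck cj eqxx /= in IH *; apply: thins_copy.
Qed.

(** Along a lattice path the first tuple is only repeated while the second one
    moves. *)
Lemma thins_path_x (g h : seq nat -> bool) us vs p :
  {in us & vs, forall u v, g (compw s k u v) = h u} ->
  thins (map g (path_tuple s k us vs p)) (map h us).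
Proof.
elim: p us vs => [|b p IHp] [|u us] [|v vs] gh; try exact: thins0.
  rewrite [path_tuple _ _ _ _ _]/=; case: ifP => _; last exact: thins0.
  rewrite /= gh ?mem_head //; apply: thins_cons; exact: thins0.
rewrite [path_tuple _ _ _ _ _]/= !map_cons gh ?mem_head //; apply: thins_copy.
case: b; last by apply: (IHp (u :: us)) => x y xu yv; apply: gh; rewrite // inE yv orbT.
by apply: thins_skip; apply: IHp => x y xu yv; apply: gh; rewrite // inE xu orbT.
Qed.

(** Symmetrically, the second tuple is only repeated while the first one
    moves. *)
Lemma thins_path_y (g h : seq nat -> bool) us vs p :
  {in us & vs, forall u v, g (compw s k u v) = h v} ->
  thins (map g (path_tuple s k us vs p)) (map h vs).
Proof.
elim: p us vs => [|b p IHp] [|u us] [|v vs] gh; try exact: thins0.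
  rewrite [path_tuple _ _ _ _ _]/=; case: ifP => _; last exact: thins0.
  rewrite /= gh ?mem_head //; apply: thins_cons; exact: thins0.
rewrite [path_tuple _ _ _ _ _]/= !map_cons gh ?mem_head //; apply: thins_copy.
case: b; first by apply: (IHp _ (v :: vs)) => x y xu yv; apply: gh; rewrite // inE xu orbT.
by apply: thins_skip; apply: IHp => x y xu yv; apply: gh; rewrite // inE yv orbT.
Qed.

End Restriction.

Section FiltrationComposition.

Variables (R : comPzRingType) (n r s d e : nat) (k : 'I_r).
Hypotheses (s_gt0 : (0 < s)%N) (n_gt0 : (0 < n)%N).

Lemma arity_letter i j : (i < (r + s).-1)%N -> (j < (r + s).-1)%N -> i != j ->
  (block s k i && block s k j ->
     [/\ (i - k < s)%N, (j - k < s)%N & (i - k)%N != (j - k)%N]) /\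
  (~~ (block s k i && block s k j) ->
     [/\ (collapse s k i < r)%N, (collapse s k j < r)%N
       & collapse s k i != collapse s k j]).
Proof.
move=> ir jr ne_ij; split=> [/andP[bi bj]|nb].
  split; rewrite ?sub_block //; apply: contra ne_ij => /eqP ek.
  by rewrite -(sub_blockK s_gt0 bi) ek (sub_blockK s_gt0 bj).
split; rewrite ?(collapse_lt s_gt0 (ltn_ord k)) //.
by apply: contra ne_ij => /eqP ec; apply/eqP/(collapse_inj s_gt0 nb ec).
Qed.

Lemma efilt_ecomp_gen (t : ebasis r d) (t' : ebasis s e) :
  efilt_gen n t -> efilt_gen n t' -> @efilt R n _ _ (ecomp_gen R k t t').
Proof.
move=> /(efilt_genP _ n_gt0) ft /(efilt_genP _ n_gt0) ft'.
apply: lin_closed_sum => [|p /eqP cd]; first exact: spanned_closed.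
apply: lin_closedZ; first exact: spanned_closed.
apply: spanned_egen => b bE; apply/(efilt_genP _ n_gt0) => i j ir jr ne_ij.
have ce : count negb p = e.
  have := count_predC id p; rewrite size_tuple cd => /addnI h.
  by apply: etrans h; apply: eq_count.
have eresE m w x y : @eres m x y w = [seq ord v x y | v <- map (@perm_seq m) w].
  by rewrite -map_comp.
have := @words_path r s k s_gt0 (val (val t)) (val (val t')) p.
rewrite !size_tuple cd ce -bE => /(_ erefl erefl) wE.
rewrite eresE wE; have [bl cl] := arity_letter ir jr ne_ij.
have mem_us m (ws : seq 'S_m) u : u \in map (@perm_seq m) ws -> perm_eq u (iota 0 m).
  by case/mapP=> w _ ->; apply: perm_seq_mem.
have ordE u v : u \in map (@perm_seq r) (val (val t)) ->
    v \in map (@perm_seq s) (val (val t')) ->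
    ord (compw s k u v) i j =
      if block s k i && block s k j then ord v (i - k) (j - k)
      else ord u (collapse s k i) (collapse s k j).
  move=> /mem_us pu /mem_us pv; have pc := compw_perm k s_gt0 pu pv.
  have mem_of m w (pw : perm_eq w (iota 0 m)) a : (a \in w) = (a < m)%N.
    by rewrite (perm_mem pw) mem_iota.
  rewrite -prec_ord ?(mem_of _ _ pc) // prec_compw //.
  - case: ifP => [/bl[is_ js ne]|/negbT/cl[ci cj ne]];
      by rewrite prec_ord ?(mem_of _ _ pu) ?(mem_of _ _ pv).
  - by rewrite (perm_uniq pu) iota_uniq.
  - by rewrite (mem_of _ _ pu).
case: (boolP (block s k i && block s k j)) ordE => [/bl|/cl] [ci cj ne] ordE.
  apply: leq_ltn_trans (ft' _ _ ci cj ne); rewrite eresE.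
  by apply/variations_thins/thins_path_y => u v uu vv; apply: ordE.
apply: leq_ltn_trans (ft _ _ ci cj ne); rewrite eresE.
by apply/variations_thins/thins_path_x => u v uu vv; apply: ordE.
Qed.

Lemma xfilt_xcomp_gen (u : xbasis r d) (v : xbasis s e) :
  xfilt_gen n u -> xfilt_gen n v -> @xfilt R n _ _ (xcomp_gen R k u v).
Proof.
move=> /xfilt_genP fu /xfilt_genP fv.
apply: lin_closed_sum => [|js js_ok]; first exact: spanned_closed.
apply: lin_closedZ; first exact: spanned_closed.
apply: spanned_xgen => b bE; apply/xfilt_genP => i j ir jr ne_ij.
have [sz_js js_lt] := cuts_props js.
have [|sE _ lz gE] := xcomp_word_inv s_gt0 sz_js js_lt _ (esym bE).
  by rewrite /valid_cuts size_xseq.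
have [bl cl] := arity_letter ir jr ne_ij.
case: (boolP (block s k i && block s k j)) => [bij|nb].
  have [ci cj ne] := bl bij; have /andP[bi bj] := bij.
  apply: leq_trans (fv _ _ ci cj ne); rewrite -gE.
  exact/variations_thins/thins_res_glue.
have [ci cj ne] := cl nb; apply: leq_trans (fu _ _ ci cj ne); rewrite -sE.
exact/variations_thins/thins_res_skel.
Qed.

Lemma efilt_comp (x : emod R r d) (y : emod R s e) :
  @efilt R n r d x -> @efilt R n s e y ->
  @efilt R n _ _ (lin_ext (fun u => lin_ext (@ecomp_gen R r s d e k u) y) x).
Proof.
move=> fx fy; apply: spanned_lin_ext fx _ => [|t ft]; first exact: spanned_closed.
apply: spanned_lin_ext fy _ => [|t' ft']; first exact: spanned_closed.
exact: efilt_ecomp_gen.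
Qed.

Lemma xfilt_comp (x : xmod R r d) (y : xmod R s e) :
  @xfilt R n r d x -> @xfilt R n s e y ->
  @xfilt R n _ _ (lin_ext (fun u => lin_ext (@xcomp_gen R r s d e k u) y) x).
Proof.
move=> fx fy; apply: spanned_lin_ext fx _ => [|t ft]; first exact: spanned_closed.
apply: spanned_lin_ext fy _ => [|t' ft']; first exact: spanned_closed.
exact: xfilt_xcomp_gen.
Qed.

End FiltrationComposition.

Theorem lemma1p6p1 (R : comPzRingType) (n : nat) (n_gt0 : (0 < n)%N) :
  (forall (r d : nat) (x : barratt_eccles R r d), (0 < r)%N ->
     @efilt R n r d x -> @xfilt R n r d (TR R r d x)) /\
  is_operad_quasi_iso (@efilt R n) (@xfilt R n) (TR R).
Proof.
have TRf r d (x : barratt_eccles R r d) : (0 < r)%N ->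
    @efilt R n r d x -> @xfilt R n r d (TR R r d x) by move=> r0; apply: TR_filt.
split=> //; split.
- split=> [r d r0|r d x r0|r d sigma x r0||r s d e k x y s0].
  + exact: spanned_closed.
  + exact: efilt_diff.
  + exact: efilt_act.
  + exact: efilt_unit.
  + exact: efilt_comp.
- split=> [r d r0|r d x r0|r d sigma x r0||r s d e k x y s0].
  + exact: spanned_closed.
  + exact: xfilt_diff.
  + exact: xfilt_act.
  + exact: xfilt_unit.
  + exact: xfilt_comp.
- split=> [//|r d x r0 _|r d sigma x r0 _||r s d e k x y s0 _ _].
  + exact: TR_diff.
  + exact: TR_act.
  + exact: TR_unit.
  + exact: TR_comp.
- by move=> r d r0; apply: TR_homology.
Qed.
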